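(* For every $G\times G$-equivariant vector bundle $\mathcal{E}$ on $X=X(\Sigma)$, the pair $\Xi(\mathcal{E}):=(\mathcal{E}\otimes k(e),\{F^\tau(\bullet,\mathcal{E})\}_{\tau\in\Sigma(1)})$, which is an object of $\mathfrak{C}(X)^+$, belongs to the full subcategory $\mathfrak{C}(X)$.
   Context: Let $k$ be an algebraically closed field of characteristic zero and $G$ a connected reductive group over $k$, with opposite Borel subgroups $B,B^-$ with common maximal torus $T$ and unipotent radicals $U,U^-$. $Z(G)$ is the centre, $G_{ad}=G/Z(G)$, $T_{ad}=T/Z(G)$; $\alpha_1,\dots,\alpha_\ell$ are the simple roots (w.r.t. $B$) and $\omega_1^\vee,\dots,\omega_\ell^\vee\in X_*(T_{ad})$ the fundamental coweights, $\langle\omega_i^\vee,\alpha_j\rangle=\delta_{ij}$. $\mathfrak{g}=\mathrm{Lie}\,G$, and $\mathfrak{g}_\alpha$ is the root space of a root $\alpha$. $G\times G$ acts on $G$ by $(g_1,g_2).x=g_1xg_2^{-1}$. $\Sigma_0$ is the fan in $X_*(T_{ad})_{\mathbb{R}}$ with cones $\sum_{i\in S}\mathbb{R}_{\ge0}\omega_i^\vee$, $S\subset\{1,\dots,\ell\}$, and $X_0$ is the De Concini-Procesi wonderful compactification of $G_{ad}$. $\Sigma$ is a fan in $X_*(T)_{\mathbb{R}}$ such that the quotient map $X_*(T)\to X_*(T_{ad})$ induces a morphism of fans $\Sigma\to\Sigma_0$ and the toric variety $T(\Sigma)$ is nonsingular. $\Sigma(1)$ is the set of one-dimensional cones; each $\tau\in\Sigma(1)$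 is identified with its primitive integral generator, a one-parameter subgroup $\tau:\mathbb{G}_m\to T$; $\sigma(1)$ is the set of rays of $\sigma\in\Sigma$. $X=X(\Sigma)$ is the associated smooth $G\times G$-equivariant partial compactification of $G$ with normal crossing boundary (regular embedding): it contains $T(\Sigma)$ as a partial closure of $T\subset G$, each $G\times G$-orbit of $X$ meets $T(\Sigma)$ in a unique $T$-orbit, there is a $G\times G$-equivariant dominant morphism $X\to X_0$ extending $G\to G_{ad}$, and $U^-\times T(\Sigma)\times U\to X$, $(g,x,h)\mapsto(g,h).x$, is an open embedding. Here $T(\Sigma)$ is a toric variety for the action of $T\cong1\times T\subset G\times G$, with base point the point $e\in X$ corresponding to $1\in G$; thus $\lim_{t\to0}(1\times\tau(t))e$ exists in $T(\Sigma)$ for $\tau\in\Sigma(1)$. $V(\mathcal{E})$ is the total space of $\mathcal{E}$. The fiber $\mathcal{E}\otimes k(e)$ is a $G$-module since $G$ (diagonally embedded) is the stabilizer of $e$. For $\tau\in\Sigma(1)$, $n\in\mathbb{Z}$, $$F^\tau(n,\mathcal{E}):=\{v\in\mathcal{E}\otimes k(e):\ \lim_{t\to0}t^{-n}(1\times\tau(t))v\text{ exists in }V(\mathcal{E})\},$$ where existence of the limit means that the morphism $\mathbb{G}_m\to V(\mathcal{E})$ extends to $\mathbb{A}^1$. For $\tau\in\Sigma(1)$, $P^\tau:=\{g\in G:\lim_{t\to0}\tau(t)g\tau(t)^{-1}\text{ exists in }G\}$. The category $\mathfrak{C}(X)^+$: objects are pairs $(V,\{F^\tau(\bullet)\}_{\tau\in\Sigma(1)})$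 of a finite-dimensional rational $G$-module $V$ and, for each $\tau$, a $\mathbb{Z}$-indexed decreasing filtration $F^\tau(\bullet)$ of $V$ by $P^\tau$-submodules with $F^\tau(n)=V$ for $n\ll0$ and $F^\tau(n)=0$ for $n\gg0$, such that for each $\sigma\in\Sigma$ there is a basis $B^\sigma$ of $V$ such that every $F^\tau(n)$ with $\tau\in\sigma(1)$, $n\in\mathbb{Z}$, is spanned by a subset of $B^\sigma$. Morphisms are the $G$-module maps $f$ with $f(F_1^\tau(n))\subset F_2^\tau(n)$ for all $n,\tau$. $\mathfrak{C}(X)$ is the full subcategory of objects satisfying, for each $\tau\in\Sigma(1)$, the transversality condition: for every $n\in\mathbb{Z}$ and each root $\alpha$ of $\mathfrak{g}$ with $\langle\tau,\alpha\rangle<0$, $\mathfrak{g}_\alpha F^\tau(n)\subset F^\tau(n+\langle\tau,\alpha\rangle)$. *)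

(* Defs.v *)
(* Varieties over the algebraically closed field k are classical ones: a set of
   closed points with its Zariski topology and its sheaf of k-valued regular
   functions.  Points x of the split torus (k^* )^d are row vectors without zero
   entry; X_*(T) and X^*(T) are both Z^d = 'rV[int]_d through a chart
   phi : (k^* )^d -> T, and <t, m> = \sum_i t_i m_i. *)
From HB Require Import structures.
From mathcomp Require Import all_boot all_order all_algebra.
From mathcomp Require Import boolp classical_sets functions cardinality reals.
Set Implicit Arguments.
Unset Strict Implicit.
Unset Printing Implicit Defensive.
Import Order.TTheory GRing.Theory Num.Theory.
Local Open Scope classical_set_scope.
Local Open Scope ring_scope.

(* reg U h is meant for open U; it depends only on the restriction of h to U
   and says that this restriction is a section of the structure sheaf. *)
Record fspace (k : fieldType) (X : choiceType) := FSpace {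
  opn : set (set X);
  reg : set X -> set (X -> k)
}.

Definition closed_in (k : fieldType) (X : choiceType) (sX : fspace k X)
  (A : set X) : Prop := opn sX (~` A).

Definition closure_in (k : fieldType) (X : choiceType) (sX : fspace k X)
  (A : set X) : set X :=
  [set x | forall U, opn sX U -> U x -> A `&` U !=set0].

Definition regular_map (k : fieldType) (X Y : choiceType) (sX : fspace k X)
  (sY : fspace k Y) (f : X -> Y) : Prop :=
  forall V, opn sY V ->
    opn sX (f @^-1` V) /\
    forall h, reg sY V h -> reg sX (f @^-1` V) (h \o f).

(* The structure induced along f: functions locally of the form g \o f. *)
Definition pull (k : fieldType) (X Y : choiceType) (sX : fspace k X)
  (f : Y -> X) : fspace k Y :=
  FSpace [set U | exists2 V, opn sX V & U = f @^-1` V]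
    (fun U => [set h | forall y, U y -> exists V g,
       [/\ opn sX V, V (f y), reg sX V g &
           forall z, U z -> V (f z) -> h z = g (f z)]]).

Definition sub_space (k : fieldType) (X : choiceType) (sX : fspace k X)
  (A : set X) : fspace k (set_type A) := pull sX (@set_val X A).

Definition embedding (k : fieldType) (X Y : choiceType) (sX : fspace k X)
  (sY : fspace k Y) (f : X -> Y) : Prop :=
  [/\ injective f,
      forall U, opn sX U <-> opn (pull sY f) U &
      forall U, opn sX U -> forall h, reg sX U h <-> reg (pull sY f) U h].

Definition open_embedding (k : fieldType) (X Y : choiceType) (sX : fspace k X)
  (sY : fspace k Y) (f : X -> Y) : Prop :=
  embedding sX sY f /\ opn sY (range f).

(* Polynomial functions on a finite-dimensional vector space. *)
Inductive polyfun (k : fieldType) (W : vectType k) : (W -> k) -> Prop :=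
| Polyfun_const (c : k) : polyfun (fun=> c)
| Polyfun_linear (u : 'Hom(W, k^o)) : polyfun (fun w => u w : k)
| Polyfun_add (p q : W -> k) :
    polyfun p -> polyfun q -> polyfun (fun w => p w + q w)
| Polyfun_mul (p q : W -> k) :
    polyfun p -> polyfun q -> polyfun (fun w => p w * q w).

Definition affine_space (k : fieldType) (W : vectType k) : fspace k W :=
  FSpace
    [set U | forall w, U w -> exists p,
       [/\ polyfun p, p w != 0 & forall z, p z != 0 -> U z]]
    (fun U => [set h | forall w, U w -> exists p q,
       [/\ polyfun p, polyfun q, q w != 0 &
           forall z, U z -> q z != 0 -> h z = p z / q z]]).

Definition affine_line (k : fieldType) : fspace k k^o := affine_space k^o.

Definition affine (k : fieldType) (X : choiceType) (sX : fspace k X) : Prop :=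
  exists (W : vectType k) (i : X -> W),
    embedding sX (affine_space W) i /\ closed_in (affine_space W) (range i).

(* The product in the category of prevarieties (finer than the product
   topology): basic opens are {h != 0} inside U x V, with h in O(U) (x) O(V). *)
Definition tensor (k : fieldType) (X Y : choiceType) (sX : fspace k X)
  (sY : fspace k Y) (U : set X) (V : set Y) : set (X * Y -> k) :=
  [set h | exists n (f : 'I_n -> X -> k) (g : 'I_n -> Y -> k),
     [/\ forall i, reg sX U (f i), forall i, reg sY V (g i) &
         forall z, h z = \sum_(i < n) f i z.1 * g i z.2]].

Definition prod_space (k : fieldType) (X Y : choiceType) (sX : fspace k X)
  (sY : fspace k Y) : fspace k (X * Y)%type :=
  FSpace
    [set W | forall z, W z -> exists U V h,
       [/\ opn sX U /\ opn sY V, (U `*` V) z, tensor sX sY U V h, h z != 0 &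
           forall y, (U `*` V) y -> h y != 0 -> W y]]
    (fun W => [set F | forall z, W z -> exists U V p q,
       [/\ opn sX U /\ opn sY V, (U `*` V) z,
           tensor sX sY U V p /\ tensor sX sY U V q, q z != 0 &
           forall y, W y -> (U `*` V) y -> q y != 0 -> F y = p y / q y]]).

Record is_space (k : fieldType) (X : choiceType) (sX : fspace k X) : Prop := {
  opnT : opn sX setT;
  opnI : forall U V, opn sX U -> opn sX V -> opn sX (U `&` V);
  opn_bigcup : forall F : set (set X),
    F `<=` opn sX -> opn sX (\bigcup_(U in F) U);
  reg_eq : forall U h h', opn sX U -> (forall x, U x -> h x = h' x) ->
    reg sX U h -> reg sX U h';
  reg_restrict : forall U V h, opn sX U -> opn sX V -> V `<=` U ->
    reg sX U h -> reg sX V h;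
  reg_glue : forall U h, opn sX U ->
    (forall x, U x -> exists V, [/\ opn sX V, V x, V `<=` U & reg sX V h]) ->
    reg sX U h
}.

Record variety (k : fieldType) (X : choiceType) (sX : fspace k X) : Prop := {
  variety_space : is_space sX;
  variety_charts : exists n (U : 'I_n -> set X),
    (forall i, opn sX (U i) /\ affine (sub_space sX (U i))) /\
    forall x, exists i, U i x;
  variety_separated : closed_in (prod_space sX sX) [set z | z.1 = z.2]
}.

Definition connected_in (k : fieldType) (X : choiceType) (sX : fspace k X)
  (A : set X) : Prop :=
  forall U V, opn sX U -> opn sX V -> A `<=` U `|` V -> A `&` U `&` V = set0 ->
    A `<=` U \/ A `<=` V.

Definition irreducible_closed (k : fieldType) (X : choiceType)
  (sX : fspace k X) (Z : set X) : Prop :=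
  [/\ closed_in sX Z, Z !=set0 &
      forall A A', closed_in sX A -> closed_in sX A' -> Z `<=` A `|` A' ->
        Z `<=` A \/ Z `<=` A'].

Definition chain_at (k : fieldType) (X : choiceType) (sX : fspace k X) (x : X)
  (n : nat) : Prop :=
  exists Z : nat -> set X,
    (forall i, (i <= n)%N -> irreducible_closed sX (Z i) /\ Z i x) /\
    (forall i, (i < n)%N -> Z i `<=` Z i.+1 /\ Z i <> Z i.+1).

Definition local_dim (k : fieldType) (X : choiceType) (sX : fspace k X) (x : X)
  (n : nat) : Prop := chain_at sX x n /\ ~ chain_at sX x n.+1.

Definition regular_at (k : fieldType) (X : choiceType) (sX : fspace k X)
  (x : X) : set (X -> k) :=
  [set h | exists U, [/\ opn sX U, U x & reg sX U h]].

(* k-derivations O_{X,x} -> k; the values of D on functions which are not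
   regular at x are irrelevant. *)
Definition tangent (k : fieldType) (X : choiceType) (sX : fspace k X) (x : X) :
  set ((X -> k) -> k) :=
  [set D | forall f g, regular_at sX x f -> regular_at sX x g ->
     [/\ forall c, D (fun y => c * f y + g y) = c * D f + D g,
         D (fun y => f y * g y) = D f * g x + f x * D g &
         (exists U, [/\ opn sX U, U x & forall y, U y -> f y = g y]) ->
         D f = D g]].

Definition tangent_dim (k : fieldType) (X : choiceType) (sX : fspace k X)
  (x : X) (n : nat) : Prop :=
  exists b : 'I_n -> (X -> k) -> k,
    (forall i, tangent sX x (b i)) /\
    forall D, tangent sX x D -> exists! c : 'rV[k]_n,
      forall f, regular_at sX x f -> D f = \sum_(i < n) c 0 i * b i f.

Definition nonsingular (k : fieldType) (X : choiceType) (sX : fspace k X) :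
  Prop := forall x, exists n, tangent_dim sX x n /\ local_dim sX x n.

Definition linear_algebraic_group (k : fieldType) (G : groupType)
  (sG : fspace k G) : Prop :=
  exists n (i : G -> 'M[k]_n) (Z : set 'M[k]_n),
    [/\ embedding sG (affine_space 'M[k]_n) i,
        i 1%g = 1%:M,
        forall g h, i (g * h)%g = i g *m i h,
        closed_in (affine_space 'M[k]_n) Z &
        range i = Z `&` [set M | M \in unitmx]].

Definition subgroup (G : groupType) (H : set G) : Prop :=
  [/\ H 1%g, forall x y, H x -> H y -> H (x * y)%g &
      forall x, H x -> H (x^-1)%g].

Definition closed_subgroup (k : fieldType) (G : groupType) (sG : fspace k G)
  (H : set G) : Prop := subgroup H /\ closed_in sG H.

Definition derived_subgroup (G : groupType) (H : set G) : set G :=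
  [set x | forall K, subgroup K ->
     (forall a b, H a -> H b -> K (a^-1 * b^-1 * a * b)%g) -> K x].

Definition solvable_subgroup (G : groupType) (H : set G) : Prop :=
  exists n, iter n (@derived_subgroup G) H `<=` [set 1%g].

Record rational_module (k : fieldType) (G : groupType) (sG : fspace k G)
  (V : vectType k) (rho : G -> V -> V) : Prop := {
  rational_linear : forall g, linear (rho g);
  rational_one : forall v, rho 1%g v = v;
  rational_mul : forall g h v, rho (g * h)%g v = rho g (rho h v);
  rational_reg : forall (u : 'Hom(V, k^o)) v,
    reg sG setT (fun g => u (rho g v) : k)
}.

Definition unipotent (k : fieldType) (G : groupType) (sG : fspace k G) (g : G) :
  Prop :=
  forall (V : vectType k) (rho : G -> V -> V), rational_module sG rho ->
    exists n, forall v, iter n (fun w => rho g w - w) v = 0.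

Definition normal_unipotent (k : fieldType) (G : groupType) (sG : fspace k G)
  (H N : set G) : Prop :=
  [/\ closed_subgroup sG N /\ N `<=` H,
      forall x h, N x -> H h -> N (h * x * h^-1)%g,
      connected_in sG N &
      forall x, N x -> unipotent sG x].

Definition unipotent_radical (k : fieldType) (G : groupType) (sG : fspace k G)
  (H N : set G) : Prop :=
  normal_unipotent sG H N /\
  forall N', normal_unipotent sG H N' -> N' `<=` N.

Definition connected_reductive (k : fieldType) (G : groupType)
  (sG : fspace k G) : Prop :=
  [/\ linear_algebraic_group sG, connected_in sG setT &
      unipotent_radical sG setT [set 1%g]].

Definition connected_solvable (k : fieldType) (G : groupType)
  (sG : fspace k G) (B : set G) : Prop :=
  [/\ closed_subgroup sG B, connected_in sG B & solvable_subgroup B].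

Definition borel (k : fieldType) (G : groupType) (sG : fspace k G)
  (B : set G) : Prop :=
  connected_solvable sG B /\
  forall B', connected_solvable sG B' -> B `<=` B' -> B' = B.

Definition dot (A : pzRingType) (d : nat) (u v : 'rV[A]_d) : A :=
  \sum_i u 0 i * v 0 i.

Definition gm (k : fieldType) (d : nat) : set 'rV[k]_d :=
  [set x | forall i, x 0 i != 0].

Definition gm_space (k : fieldType) (d : nat) :
  fspace k (set_type (@gm k d)) := sub_space (affine_space 'rV[k]_d) (@gm k d).

Definition gm_mul (k : fieldType) (d : nat) (x y : 'rV[k]_d) : 'rV[k]_d :=
  \row_i (x 0 i * y 0 i).

Definition chi (k : fieldType) (d : nat) (m : 'rV[int]_d) (x : 'rV[k]_d) : k :=
  \prod_i x 0 i ^ m 0 i.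

(* phi restricts to an isomorphism of algebraic groups (k^* )^d -> T; its values
   outside (k^* )^d are irrelevant. *)
Definition torus_chart (k : fieldType) (G : groupType) (sG : fspace k G)
  (T : set G) (d : nat) (phi : 'rV[k]_d -> G) : Prop :=
  [/\ closed_subgroup sG T,
      phi @` @gm k d = T,
      forall x y, gm x -> gm y -> phi (gm_mul x y) = (phi x * phi y)%g &
      embedding (@gm_space k d) sG (phi \o set_val)].

Definition torus (k : fieldType) (G : groupType) (sG : fspace k G)
  (T : set G) : Prop :=
  exists d (phi : 'rV[k]_d -> G), torus_chart sG T phi.

Definition maximal_torus (k : fieldType) (G : groupType) (sG : fspace k G)
  (T : set G) : Prop :=
  torus sG T /\ forall T', torus sG T' -> T `<=` T' -> T' = T.

Definition cochar (k : fieldType) (G : groupType) (d : nat)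
  (phi : 'rV[k]_d -> G) (tau : 'rV[int]_d) (t : k) : G :=
  phi (\row_i t ^ tau 0 i).

Definition lie (k : fieldType) (G : groupType) (sG : fspace k G) :
  set ((G -> k) -> k) := tangent sG 1%g.

(* D acts through the adjoint action Ad(t) D = D (f |-> f (t _ t^-1)). *)
Definition root_space (k : fieldType) (G : groupType) (sG : fspace k G)
  (d : nat) (phi : 'rV[k]_d -> G) (a : 'rV[int]_d) : set ((G -> k) -> k) :=
  [set D | lie sG D /\
     forall x f, gm x -> regular_at sG 1%g f ->
       D (fun g => f (phi x * g * (phi x)^-1)%g) = chi a x * D f].

Definition lie_root (k : fieldType) (G : groupType) (sG : fspace k G)
  (d : nat) (phi : 'rV[k]_d -> G) (a : 'rV[int]_d) : Prop :=
  a != 0 /\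
  exists D f, [/\ root_space sG phi a D, regular_at sG 1%g f & D f != 0].

(* Lie(B) inside Lie(G): derivations killing the germs vanishing on B. *)
Definition in_lie (k : fieldType) (G : groupType) (sG : fspace k G)
  (B : set G) (D : (G -> k) -> k) : Prop :=
  lie sG D /\
  forall f, regular_at sG 1%g f ->
    (exists U, [/\ opn sG U, U 1%g & forall b, U b -> B b -> f b = 0]) ->
    D f = 0.

Definition positive_root (k : fieldType) (G : groupType) (sG : fspace k G)
  (B : set G) (d : nat) (phi : 'rV[k]_d -> G) (a : 'rV[int]_d) : Prop :=
  lie_root sG phi a /\ root_space sG phi a `<=` in_lie sG B.

Definition simple_root (k : fieldType) (G : groupType) (sG : fspace k G)
  (B : set G) (d : nat) (phi : 'rV[k]_d -> G) (a : 'rV[int]_d) : Prop :=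
  positive_root sG B phi a /\
  ~ exists b c, [/\ positive_root sG B phi b, positive_root sG B phi c &
                    a = b + c].

(* The differential of rho: D v is determined by u (D v) = D (g |-> u (rho g v))
   for every linear form u. *)
Definition lie_act (k : fieldType) (G : groupType) (V : vectType k)
  (rho : G -> V -> V) (D : (G -> k) -> k) (v : V) : V :=
  \sum_i D (fun g => coord (vbasis {:V}) i (rho g v)) *: (vbasis {:V})`_i.

Record reductive_data (k : fieldType) (G : groupType) (sG : fspace k G)
  (B Bm U Um T : set G) (d : nat) (phi : 'rV[k]_d -> G)
  (l : nat) (alpha : 'I_l -> 'rV[int]_d) : Prop := {
  rd_reductive : connected_reductive sG;
  rd_borel : borel sG B;
  rd_borel_opp : borel sG Bm;
  rd_torus : maximal_torus sG T;
  rd_opposite : B `&` Bm = T;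
  rd_unip : unipotent_radical sG B U;
  rd_unip_opp : unipotent_radical sG Bm Um;
  rd_chart : torus_chart sG T phi;
  rd_simple_inj : injective alpha;
  rd_simple : forall a, simple_root sG B phi a <-> exists i, a = alpha i
}.

(* Lines in W, i.e. the points of the projective space of W, which carries the
   quotient structure of W \ {0}. *)
Definition pline (k : fieldType) (W : vectType k) : choiceType :=
  {L : {vspace W} | \dim L == 1%N}.

Definition punctured_cone (k : fieldType) (W : vectType k)
  (U : set (pline W)) : set W :=
  [set w | w != 0 /\ exists2 L : pline W, U L & val L = <[w]>%VS].

Definition projective_space (k : fieldType) (W : vectType k) :
  fspace k (pline W) :=
  FSpace [set U | opn (affine_space W) (punctured_cone U)]
    (fun U => [set h | exists2 H, reg (affine_space W) (punctured_cone U) H &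
       forall (L : pline W) w, U L -> w != 0 -> val L = <[w]>%VS ->
         H w = h L]).

(* An irreducible module with regular highest weight with respect to B: the
   stabilizer of the highest weight line is B, not a larger parabolic. *)
Definition regular_irreducible (k : fieldType) (G : groupType)
  (sG : fspace k G) (B : set G) (V : vectType k) (rho : G -> V -> V) : Prop :=
  [/\ rational_module sG rho,
      forall W : {vspace V}, (forall g w, w \in W -> rho g w \in W) ->
        W = 0%VS \/ W = fullv &
      exists2 v, v != 0 & forall g, B g <-> rho g v \in <[v]>%VS].

(* The closure of the image of G_ad in P(End V), [g] |-> [rho g]. *)
Definition wonderful (k : fieldType) (G : groupType) (V : vectType k)
  (rho : G -> V -> V) : set (pline 'End(V)) :=
  closure_in (projective_space 'End(V))
    [set L | exists g, val L = <[linfun (rho g)]>%VS].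

Definition conic (R : realType) (n d : nat) (S : pred 'I_n)
  (v : 'I_n -> 'rV[R]_d) : set 'rV[R]_d :=
  [set w | exists2 c : 'I_n -> R, (forall i, 0 <= c i) &
     w = \sum_(i | S i) c i *: v i].

Definition real_vec (R : realType) (d : nat) (t : 'rV[int]_d) : 'rV[R]_d :=
  map_mx intr t.

Definition rational_cone (R : realType) (d : nat) (s : set 'rV[R]_d) : Prop :=
  (exists n (v : 'I_n -> 'rV[int]_d),
     s = conic predT (fun i => real_vec R (v i))) /\
  (forall v, s v -> s (- v) -> v = 0).

Definition face (R : realType) (d : nat) (s' s : set 'rV[R]_d) : Prop :=
  exists2 u, (forall v, s v -> 0 <= dot v u) &
    s' = [set v | s v /\ dot v u = 0].

Record fan (R : realType) (d : nat) (Sigma : set (set 'rV[R]_d)) : Prop := {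
  fan_finite : finite_set Sigma;
  fan_cone : forall s, Sigma s -> rational_cone s;
  fan_face : forall s s', Sigma s -> face s' s -> Sigma s';
  fan_meet : forall s s', Sigma s -> Sigma s' ->
    face (s `&` s') s /\ face (s `&` s') s'
}.

Definition primitive (d : nat) (t : 'rV[int]_d) : Prop :=
  forall (m : nat) (t' : 'rV[int]_d), t = t' *+ m -> m = 1%N.

Definition ray (R : realType) (d : nat) (t : 'rV[int]_d) : set 'rV[R]_d :=
  [set v | exists2 c : R, 0 <= c & v = c *: real_vec R t].

(* Sigma(1) and sigma(1), rays being identified with their primitive
   generators. *)
Definition fan_ray (R : realType) (d : nat) (Sigma : set (set 'rV[R]_d)) :
  set 'rV[int]_d := [set t | primitive t /\ Sigma (ray t)].

Definition cone_ray (R : realType) (d : nat) (s : set 'rV[R]_d) :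
  set 'rV[int]_d := [set t | primitive t /\ face (ray t) s].

(* X_*(T_ad) has the fundamental coweights as a basis, and in these coordinates
   X_*(T) -> X_*(T_ad) is t |-> (<t, alpha_i>)_i. *)
Definition to_coweights (R : realType) (d l : nat)
  (alpha : 'I_l -> 'rV[int]_d) (v : 'rV[R]_d) : 'rV[R]_l :=
  \row_i dot v (real_vec R (alpha i)).

Definition adjoint_fan (R : realType) (l : nat) : set (set 'rV[R]_l) :=
  [set s | exists S : pred 'I_l, s = conic S (fun i => delta_mx 0 i)].

(* The compatibility with the lattices is automatic for to_coweights. *)
Definition fan_morphism (R : realType) (d l : nat)
  (f : 'rV[R]_d -> 'rV[R]_l) (Sigma : set (set 'rV[R]_d))
  (Sigma' : set (set 'rV[R]_l)) : Prop :=
  forall s, Sigma s -> exists2 s', Sigma' s' & f @` s `<=` s'.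

Definition dual_monoid (R : realType) (d : nat) (s : set 'rV[R]_d) :
  set 'rV[int]_d := [set m | forall v, s v -> 0 <= dot v (real_vec R m)].

(* U is an affine open torus-stable set containing y0, with coordinate ring
   k[s^dual \cap M] when functions are restricted to the orbit of y0. *)
Record toric_chart (k : fieldType) (R : realType) (d : nat) (Y : choiceType)
  (sY : fspace k Y) (aY : 'rV[k]_d -> Y -> Y) (y0 : Y) (s : set 'rV[R]_d)
  (U : set Y) : Prop := {
  tc_open : opn sY U;
  tc_affine : affine (sub_space sY U);
  tc_base : U y0;
  tc_stable : forall x y, gm x -> U y -> U (aY x y);
  tc_inj : forall f g, reg sY U f -> reg sY U g ->
    (forall x, gm x -> f (aY x y0) = g (aY x y0)) -> forall y, U y -> f y = g y;
  tc_char : forall m, dual_monoid s m ->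
    exists2 f, reg sY U f & forall x, gm x -> f (aY x y0) = chi m x;
  tc_span : forall f, reg sY U f ->
    exists n (c : 'I_n -> k) (m : 'I_n -> 'rV[int]_d),
      (forall i, dual_monoid s (m i)) /\
      forall x, gm x -> f (aY x y0) = \sum_i c i * chi (m i) x
}.

(* (Y, y0) is the toric variety T(Sigma): the charts U_s glued along the
   U_(s `&` s'). *)
Record toric_variety (k : fieldType) (R : realType) (d : nat)
  (Sigma : set (set 'rV[R]_d)) (Y : choiceType) (sY : fspace k Y)
  (aY : 'rV[k]_d -> Y -> Y) (y0 : Y) : Prop := {
  tv_variety : variety sY;
  tv_one : forall y, aY (const_mx 1) y = y;
  tv_mul : forall x x' y, gm x -> gm x' ->
    aY (gm_mul x x') y = aY x (aY x' y);
  tv_morph : regular_map (prod_space (@gm_space k d) sY) sY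
    (fun z => aY (set_val z.1) z.2);
  tv_charts : exists U : set 'rV[R]_d -> set Y,
    [/\ forall s, Sigma s -> toric_chart sY aY y0 s (U s),
        forall s s', Sigma s -> Sigma s' -> U s `&` U s' = U (s `&` s') &
        forall y, exists2 s, Sigma s & U s y]
}.

Record algebraic_action (k : fieldType) (G : groupType) (sG : fspace k G)
  (X : choiceType) (sX : fspace k X) (act : G * G -> X -> X) : Prop := {
  act_one : forall x, act 1%g x = x;
  act_mul : forall g h x, act (g * h)%g x = act g (act h x);
  act_morph : regular_map (prod_space (prod_space sG sG) sX) sX
    (fun z => act z.1 z.2)
}.

(* (X, e) is the partial compactification X(Sigma) of G and j : T(Sigma) -> X
   the closure of T in it.  Since the G x G-translates of the cell
   U^- T(Sigma) U cover X, these properties determine (X, e) up to a unique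
   isomorphism, and make its boundary a normal crossing divisor. *)
Record group_embedding (k : fieldType) (R : realType) (G : groupType)
  (sG : fspace k G) (B U Um : set G) (d : nat) (phi : 'rV[k]_d -> G)
  (Sigma : set (set 'rV[R]_d))
  (Y : choiceType) (sY : fspace k Y) (aY : 'rV[k]_d -> Y -> Y) (y0 : Y)
  (X : choiceType) (sX : fspace k X) (act : G * G -> X -> X) (e : X)
  (j : Y -> X) : Prop := {
  ge_variety : variety sX;
  ge_smooth : nonsingular sX;
  ge_action : algebraic_action sG sX act;
  ge_open_orbit : open_embedding sG sX (fun g => act (g, 1%g) e);
  ge_orbit_equiv : forall g h x : G,
    act (g, h) (act (x, 1%g) e) = act ((g * x * h^-1)%g, 1%g) e;
  ge_toric : toric_variety Sigma sY aY y0;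
  ge_toric_smooth : nonsingular sY;
  ge_toric_sub : embedding sY sX j;
  ge_toric_base : j y0 = e;
  ge_toric_equiv : forall x y, gm x -> j (aY x y) = act (1%g, phi x) (j y);
  ge_orbit_meet : forall p, exists g y, act g p = j y;
  ge_orbit_unique : forall g y y', act g (j y) = j y' ->
    exists2 x, gm x & y' = aY x y;
  ge_cell : open_embedding
    (prod_space (prod_space (sub_space sG Um) sY) (sub_space sG U)) sX
    (fun z => act (set_val z.1.1, set_val z.2) (j z.1.2));
  ge_wonderful : exists (V : vectType k) (rho : G -> V -> V)
      (q : X -> set_type (wonderful rho)),
    [/\ regular_irreducible sG B rho,
        regular_map sX (sub_space (projective_space 'End(V)) (wonderful rho)) q,
        forall g, val (set_val (q (act (g, 1%g) e))) = <[linfun (rho g)]>%VS &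
        forall (g h : G) x (M : 'End(V)), val (set_val (q x)) = <[M]>%VS ->
          val (set_val (q (act (g, h) x))) =
            <[(linfun (rho g) \o M \o linfun (rho h^-1%g))%VF]>%VS]
}.

(* The total_space space of a bundle with fibers E x is {x : X & E x}. *)
Definition total_space (k : fieldType) (X : choiceType) (E : X -> vectType k) :
  choiceType := {x : X & E x}.

Definition vector_bundle (k : fieldType) (X : choiceType) (sX : fspace k X)
  (E : X -> vectType k) (sE : fspace k (total_space E)) : Prop :=
  is_space sE /\
  forall x, exists (U : set X) (r : nat) (psi : forall y, 'rV[k]_r -> E y),
    [/\ opn sX U, U x,
        forall y, U y -> linear (psi y) /\ bijective (psi y) &
        open_embedding (prod_space (sub_space sX U) (affine_space 'rV[k]_r)) sE
          (fun z => Tagged E (psi (set_val z.1) z.2) : total_space E)].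

Definition tot_act (k : fieldType) (G : groupType) (X : choiceType)
  (act : G * G -> X -> X) (E : X -> vectType k)
  (actE : forall g x, E x -> E (act g x)) (g : G * G) (v : total_space E) :
  total_space E := Tagged E (actE g (tag v) (tagged v)).

Record equivariant_bundle (k : fieldType) (G : groupType) (sG : fspace k G)
  (X : choiceType) (sX : fspace k X) (act : G * G -> X -> X)
  (E : X -> vectType k) (sE : fspace k (total_space E))
  (actE : forall g x, E x -> E (act g x)) : Prop := {
  eb_bundle : vector_bundle sX sE;
  eb_linear : forall g x, linear (actE g x);
  eb_action : algebraic_action sG sE (tot_act actE)
}.

Record filtered_module (k : fieldType) (G : groupType) (d : nat) :=
  FilteredModule {
    fm_space : vectType k;
    fm_act : G -> fm_space -> fm_space;
    fm_filt : 'rV[int]_d -> int -> set fm_space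
  }.
Arguments fm_act {k G d} M g v : rename.
Arguments fm_filt {k G d} M tau n _ : rename.

Definition parabolic (k : fieldType) (G : groupType) (sG : fspace k G)
  (d : nat) (phi : 'rV[k]_d -> G) (tau : 'rV[int]_d) : set G :=
  [set g | exists2 c, regular_map (affine_line k) sG c &
     forall t : k, t != 0 ->
       c t = (cochar phi tau t * g * (cochar phi tau t)^-1)%g].

Definition submodule_under (k : fieldType) (G : groupType) (V : vectType k)
  (rho : G -> V -> V) (P : set G) (F : set V) : Prop :=
  [/\ F 0, forall (a : k) v w, F v -> F w -> F (a *: v + w) &
      forall g v, P g -> F v -> F (rho g v)].

Record in_Cplus (k : fieldType) (R : realType) (G : groupType)
  (sG : fspace k G) (d : nat) (phi : 'rV[k]_d -> G)
  (Sigma : set (set 'rV[R]_d)) (M : filtered_module k G d) : Prop := {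
  cp_rational : rational_module sG (fm_act M);
  cp_submodule : forall tau n, fan_ray Sigma tau ->
    submodule_under (fm_act M) (parabolic sG phi tau)
      (fm_filt M tau n);
  cp_decreasing : forall tau (n n' : int), fan_ray Sigma tau -> n <= n' ->
    fm_filt M tau n' `<=` fm_filt M tau n;
  cp_full : forall tau, fan_ray Sigma tau -> exists n0 : int,
    forall n : int, n <= n0 ->
    fm_filt M tau n = setT;
  cp_zero : forall tau, fan_ray Sigma tau -> exists n0 : int,
    forall n : int, n0 <= n ->
    fm_filt M tau n = [set 0];
  cp_basis : forall s, Sigma s -> exists b : seq (fm_space M),
    basis_of fullv b /\
    forall tau n, cone_ray s tau -> exists2 b' : seq (fm_space M),
      {subset b' <= b} & fm_filt M tau n = [set v | v \in <<b'>>%VS]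
}.

Definition transversality (k : fieldType) (R : realType) (G : groupType)
  (sG : fspace k G) (d : nat) (phi : 'rV[k]_d -> G)
  (Sigma : set (set 'rV[R]_d)) (M : filtered_module k G d) : Prop :=
  forall tau, fan_ray Sigma tau ->
  forall (n : int) a, lie_root sG phi a -> dot tau a < 0 ->
  forall D v, root_space sG phi a D -> fm_filt M tau n v ->
    fm_filt M tau (n + dot tau a) (lie_act (fm_act M) D v).

Definition in_C (k : fieldType) (R : realType) (G : groupType)
  (sG : fspace k G) (d : nat) (phi : 'rV[k]_d -> G)
  (Sigma : set (set 'rV[R]_d)) (M : filtered_module k G d) : Prop :=
  in_Cplus sG phi Sigma M /\ transversality sG phi Sigma M.

(* The diagonal action on E e; tagged_as transports from E (act (g, g) e) to
   E e, as act (g, g) e = e. *)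
Definition fiber_act (k : fieldType) (G : groupType) (X : choiceType)
  (act : G * G -> X -> X) (e : X) (E : X -> vectType k)
  (actE : forall g x, E x -> E (act g x)) (g : G) (v : E e) : E e :=
  tagged_as (Tagged E v) (tot_act actE (g, g) (Tagged E v)).

Definition fiber_filt (k : fieldType) (G : groupType) (d : nat)
  (phi : 'rV[k]_d -> G) (X : choiceType) (act : G * G -> X -> X) (e : X)
  (E : X -> vectType k) (sE : fspace k (total_space E))
  (actE : forall g x, E x -> E (act g x))
  (tau : 'rV[int]_d) (n : int) : set (E e) :=
  [set v | exists2 c : k^o -> total_space E, regular_map (affine_line k) sE c &
     forall t : k, t != 0 ->
       let w := tot_act actE (1%g, cochar phi tau t) (Tagged E v) in
       c t = Tagged E (t ^ (- n) *: tagged w)].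

Definition Xi (k : fieldType) (G : groupType) (d : nat)
  (phi : 'rV[k]_d -> G) (X : choiceType) (act : G * G -> X -> X) (e : X)
  (E : X -> vectType k) (sE : fspace k (total_space E))
  (actE : forall g x, E x -> E (act g x)) : filtered_module k G d :=
  @FilteredModule k G d (E e) (fiber_act actE) (fiber_filt phi sE actE).

(* Main.v *)
Require Import Defs.
From HB Require Import structures.
From mathcomp Require Import all_boot all_order all_algebra.
From mathcomp Require Import boolp classical_sets functions cardinality reals.
From mathcomp Require Import ring.

(** Let A be the action of G x G on the total space and V the fibre at e.  A
    vector v lies in F^tau(n) when the curve t^-n A(1, tau(t)) v extends over
    t = 0; in a trivialization near the limit of (1, tau(t)) e this says that
    some rational functions of t have no pole there.

    Transversality.  For v in F^tau(n) let c(t) = t^-n A(1, tau(t)) v.  Since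
    (1, tau)(g, g) = (g, tau g tau^-1)(1, tau), the curve attached to g v is
    A(g, tau(t) g tau(t)^-1) c(t).  Differentiate its local coordinates at g = 1
    along D in the root space of a.  The chain rule gives
    R1(t) + t^<tau,a> R2(t), where R1 and R2 are the derivatives of the
    coordinates of A(g, 1) c(t) and A(1, g) c(t); both are regular at 0 because
    the action is a morphism and c is a regular curve (transversality_coord).
    If <tau,a> < 0, multiplying by t^-<tau,a> leaves a regular function, which
    says that D v lies in F^tau(n + <tau,a>) (filt_transversal).

    Membership in C(X)^+.  Stability under P^tau is the same identity, not
    differentiated (filt_parabolic).  Everything else about the filtrations
    follows from a basis of V adapted to those of all the rays tau_1, ..., tau_p
    of a cone (adapted_basis).  The toric chart yields a regular map gamma from
    affine p-space to X with gamma(x) = (1, tau_1(x_1) ... tau_p(x_p)) e on the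
    torus (toric_curve), and the point is that the pulled back bundle, which is
    equivariant for the torus, has a frame of homogeneous sections near 0.
    Let S(x) be the matrix carrying the fibre over gamma(x), in a trivialization
    near gamma(0), back to V.  As 0 is fixed by the torus, S(x) S(sx)^-1 is
    regular at x = 0 for every s.  So if h S is regular at 0 for a polynomial h,
    then so is h(sx) S(x), and linear independence of characters extracts a
    monomial of h: x^N S = Q / f with f(0) <> 0 (clear_monomial).  Write
    Q = sum_m x^m C_m.  The same independence shows that each
    x^(m-N) C_m S(x)^-1 is regular at 0; these matrices add up to f times the
    identity, so r of their rows form a frame at 0 (homogeneous_frame).  In the
    basis of V made of the corresponding rows of the C_m, A(1, tau_j(t)) acts by
    powers of t up to an invertible matrix, from which F^(tau_j) is read off
    (filt_frame_coord). *)

Set Implicit Arguments.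
Unset Strict Implicit.
Unset Printing Implicit Defensive.
Import Order.TTheory GRing.Theory Num.Theory.
Local Open Scope classical_set_scope.
Local Open Scope ring_scope.

(** * Ringed function spaces and maps regular on an open set *)

(** Sections form rings in which nonvanishing functions are invertible, which
    the sheaf axioms alone do not give. *)
Record ringed (k : fieldType) (X : choiceType) (sX : fspace k X) : Prop := {
  ringed_space :> is_space sX;
  reg_cst : forall U c, opn sX U -> reg sX U (fun=> c);
  reg_add : forall U f g, opn sX U -> reg sX U f -> reg sX U g ->
    reg sX U (fun x => f x + g x);
  reg_mul : forall U f g, opn sX U -> reg sX U f -> reg sX U g ->
    reg sX U (fun x => f x * g x);
  reg_inv : forall U f, opn sX U -> reg sX U f -> (forall x, U x -> f x != 0) ->
    reg sX U (fun x => (f x)^-1);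
  opn_neq0 : forall U f, opn sX U -> reg sX U f ->
    opn sX (U `&` [set x | f x != 0])
}.

(** Maps are total functions of which only the values on N matter; this keeps
    subtypes out of the source. *)
Definition regular_on (k : fieldType) (X Y : choiceType) (sX : fspace k X)
    (N : set X) (sY : fspace k Y) (f : X -> Y) : Prop :=
  opn sX N /\ forall V, opn sY V ->
    opn sX (N `&` f @^-1` V) /\
    forall h, reg sY V h -> reg sX (N `&` f @^-1` V) (h \o f).

Section Spaces.
Variable k : fieldType.
Implicit Types X Y Z : choiceType.

Lemma opn_local X (sX : fspace k X) (A : set X) : is_space sX ->
  (forall x, A x -> exists U, [/\ opn sX U, U x & U `<=` A]) -> opn sX A.
Proof.
move=> hX hA.
have -> : A = \bigcup_(U in [set U | opn sX U /\ U `<=` A]) U.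
  apply/seteqP; split=> x; last by case=> U [_ UA] Ux; exact: UA.
  by move=> /hA [U [oU Ux UA]]; exists U.
by apply: (opn_bigcup hX) => U [].
Qed.

Lemma opn_set0 X (sX : fspace k X) : is_space sX -> opn sX set0.
Proof. by move=> hX; apply: opn_local => // x []. Qed.

Lemma regular_mapE X Y (sX : fspace k X) (sY : fspace k Y) f : is_space sX ->
  regular_map sX sY f <-> regular_on sX setT sY f.
Proof.
move=> hX; split=> [h|[_ h] V /h]; last by rewrite setTI.
by split=> [|V /h]; [exact: opnT | rewrite setTI].
Qed.

Lemma regular_on_comp X Y Z (sX : fspace k X) (sY : fspace k Y)
    (sZ : fspace k Z) N f g : regular_on sX N sY f -> regular_map sY sZ g ->
  regular_on sX N sZ (g \o f).
Proof.
move=> [oN hf] hg; split=> // V /hg [oV hV]; have [o r] := hf _ oV.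
by split=> // h /hV /r.
Qed.

Lemma regular_on_restrict X Y (sX : fspace k X) (sY : fspace k Y) N N' f :
  is_space sX -> regular_on sX N sY f -> opn sX N' -> N' `<=` N ->
  regular_on sX N' sY f.
Proof.
move=> hX [oN hf] oN' NN'; split=> // V /hf [o r].
have e : N' `&` f @^-1` V = N' `&` (N `&` f @^-1` V).
  apply/seteqP; split=> x; first by case=> a b; split=> //; split=> //; exact: NN'.
  by case=> a [].
rewrite e; split; first exact: opnI.
move=> h /r; apply: reg_restrict => //; first exact: opnI.
Qed.

Lemma regular_on_eq X Y (sX : fspace k X) (sY : fspace k Y) N f g :
  is_space sX -> regular_on sX N sY f -> (forall x, N x -> f x = g x) ->
  regular_on sX N sY g.
Proof.
move=> hX [oN hf] e; split=> // V /hf [o r].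
have <- : N `&` f @^-1` V = N `&` g @^-1` V.
  by apply/seteqP; split=> x [Nx]; rewrite /= ?e // => Vx; split=> //=; rewrite ?e.
split=> // h /r; apply: reg_eq => // x [Nx _] /=.
by rewrite e.
Qed.

Lemma regular_on_local X Y (sX : fspace k X) (sY : fspace k Y) N f :
  is_space sX -> opn sX N ->
  (forall x, N x -> exists N', [/\ N' x, N' `<=` N & regular_on sX N' sY f]) ->
  regular_on sX N sY f.
Proof.
move=> hX oN H; split=> // V oV.
have o : opn sX (N `&` f @^-1` V).
  apply: opn_local => // x [/H [N' [N'x N'N [oN' hf]]] Vx].
  have [o _] := hf _ oV.
  by exists (N' `&` f @^-1` V); split=> // y [/N'N Ny Vy].
split=> // h rh; apply: reg_glue => // x [/H [N' [N'x N'N [oN' hf]]] Vx].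
have [o' r] := hf _ oV.
by exists (N' `&` f @^-1` V); split=> //; [move=> y [] /N'N // | exact: r].
Qed.

Lemma regular_on_cst X Y (sX : fspace k X) (sY : fspace k Y) N c :
  ringed sX -> opn sX N -> regular_on sX N sY (fun=> c).
Proof.
move=> hX oN; split=> // V oV.
have o : opn sX (N `&` (fun=> c) @^-1` V).
  have [Vc|Vc] := pselect (V c).
    by rewrite (_ : _ `&` _ = N) //; apply/seteqP; split=> x; [case|].
  rewrite (_ : _ `&` _ = set0); first exact: (opn_set0 hX).
  by apply/seteqP; split=> x; [case|].
by split=> // h _; exact: (reg_cst hX).
Qed.

Lemma regular_on_reg X Y (sX : fspace k X) (sY : fspace k Y) N f V h :
  regular_on sX N sY f -> opn sY V -> reg sY V h -> N `<=` f @^-1` V ->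
  reg sX N (h \o f).
Proof.
move=> [oN hf] /hf [_ r] /r {}r sub.
have e : N `&` f @^-1` V = N.
  by apply/seteqP; split=> x; [case|move=> Nx; split=> //; exact: sub].
by rewrite e in r.
Qed.

Lemma regular_on_id X (sX : fspace k X) N : is_space sX -> opn sX N ->
  regular_on sX N sX id.
Proof.
move=> hX oN; split=> // V oV; split; first exact: opnI.
move=> h; apply: (reg_restrict hX) => //; exact: (opnI hX).
Qed.

Lemma reg_sum X (sX : fspace k X) (I : Type) (s : seq I) U (f : I -> X -> k) :
  ringed sX -> opn sX U -> (forall i, reg sX U (f i)) ->
  reg sX U (fun x => \sum_(i <- s) f i x).
Proof.
move=> hX oU hf; elim: s => [|i s IH].
  apply: (reg_eq hX oU _ (reg_cst hX 0 oU)) => x _.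
  by rewrite big_nil.
apply: (reg_eq hX oU _ (reg_add hX oU (hf i) IH)) => x _.
by rewrite big_cons.
Qed.

(** The topology of the product is generated by the nonvanishing loci of
    tensors.  Along (f, g) a tensor pulls back to a sum of products of regular
    functions of one variable, hence the ring structure required of sZ. *)
Lemma regular_on_pair Z X Y (sZ : fspace k Z) (sX : fspace k X)
    (sY : fspace k Y) N f g :
  ringed sZ -> regular_on sZ N sX f -> regular_on sZ N sY g ->
  regular_on sZ N (prod_space sX sY) (fun z => (f z, g z)).
Proof.
move=> hZ [oN hf] [_ hg].
pose box U V := N `&` f @^-1` U `&` (N `&` g @^-1` V).
have obox U V : opn sX U -> opn sY V -> opn sZ (box U V).
  by move=> oU oV; apply: (opnI hZ); [case: (hf _ oU) | case: (hg _ oV)].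
have rT U V h : opn sX U -> opn sY V -> tensor sX sY U V h ->
    reg sZ (box U V) (fun z => h (f z, g z)).
  move=> oU oV [n [a [b [ra rb /funext ->]]]].
  have o := obox _ _ oU oV.
  apply: (@reg_sum _ _ _ _ _ (fun i z => a i (f z) * b i (g z))) => // i.
  apply: (reg_mul hZ) => //.
    have [oU' r] := hf _ oU; apply: (reg_restrict hZ) (r _ (ra i)) => //.
    by move=> z [].
  have [oV' r] := hg _ oV; apply: (reg_restrict hZ) (r _ (rb i)) => //.
  by move=> z [].
split=> // W oW.
have oP : opn sZ (N `&` (fun z => (f z, g z)) @^-1` W).
  apply: (opn_local hZ) => z [Nz /oW [U [V [h [[oU oV] [/= Uz Vz] th hz hW]]]]].
  exists (box U V `&` [set z | h (f z, g z) != 0]); split.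
  - by apply: (opn_neq0 hZ); [exact: obox | exact: rT].
  - by [].
  - move=> y [[[Ny Uy] [_ Vy]] hy]; split=> //=; exact: hW.
split=> // F rF; apply: (reg_glue hZ) => // z [Nz Wz].
have [U [V [p [q [[oU oV] [/= Uz Vz] [tp tq] qz hF]]]]] := rF _ Wz.
have ob := obox _ _ oU oV.
have oq := opn_neq0 hZ ob (rT _ _ _ oU oV tq).
have oM := opnI hZ oP oq.
exists (N `&` (fun z => (f z, g z)) @^-1` W `&` (box U V `&` [set z | q (f z, g z) != 0])).
split=> //.
have sub : (N `&` (fun z => (f z, g z)) @^-1` W `&` (box U V `&` [set z | q (f z, g z) != 0])) `<=` box U V.
  by move=> y [_ []].
apply: (reg_eq hZ oM (h := fun z => p (f z, g z) * (q (f z, g z))^-1)).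
  by move=> y [[Ny Wy] [[[_ Uy] [_ Vy]] qy]] /=; rewrite hF.
apply: (reg_mul hZ) => //.
  exact: (reg_restrict hZ ob oM sub (rT _ _ _ oU oV tp)).
apply: (reg_inv hZ) => //; last by move=> y [_ []].
exact: (reg_restrict hZ ob oM sub (rT _ _ _ oU oV tq)).
Qed.

Lemma regular_on_pull Z X Y (sZ : fspace k Z) (sX : fspace k X) (i : Y -> X)
    N f : is_space sZ -> regular_on sZ N sX (i \o f) ->
  regular_on sZ N (pull sX i) f.
Proof.
move=> hZ [oN hf]; split=> // _ [V oV ->].
have [o r] := hf _ oV; split=> // h rh.
apply: (reg_glue hZ) => // z [Nz Vz].
have [V' [g [oV' V'z rg hg]]] := rh _ Vz.
have [o' r'] := hf _ oV'.
exists (N `&` (i \o f) @^-1` V `&` (N `&` (i \o f) @^-1` V')); split=> //.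
- exact: (opnI hZ).
- apply: (reg_eq hZ (h := g \o (i \o f))).
  + exact: (opnI hZ).
  + by move=> y [[_ Vy] [_ V'y]] /=; rewrite hg.
  + apply: (reg_restrict hZ _ _ _ (r' _ rg)) => //; exact: (opnI hZ).
Qed.

Lemma regular_on_embedding Z X Y (sZ : fspace k Z) (sX : fspace k X)
    (sY : fspace k Y) (i : X -> Y) N f : is_space sZ -> embedding sX sY i ->
  regular_on sZ N sY (i \o f) -> regular_on sZ N sX f.
Proof.
move=> hZ [_ eo er] /(regular_on_pull hZ) [oN hf]; split=> // V oV.
have [o r] := hf _ (proj1 (eo V) oV).
by split=> // h /(er _ oV) /r.
Qed.

Lemma pull_regular X Y (sX : fspace k X) (i : Y -> X) :
  regular_map (pull sX i) sX i.
Proof.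
move=> V oV; split; first by exists V.
by move=> h rh y Vy; exists V, h.
Qed.

Lemma embedding_regular X Y (sX : fspace k X) (sY : fspace k Y) i :
  embedding sX sY i -> regular_map sX sY i.
Proof.
move=> [_ eo er] V /(@pull_regular _ _ _ i) [o r].
have o' := proj2 (eo _) o; split=> // h /r.
by move/(er _ o').
Qed.

Lemma pull_space X Y (sX : fspace k X) (i : Y -> X) :
  is_space sX -> is_space (pull sX i).
Proof.
move=> hX; split.
- by exists setT; first exact: opnT.
- move=> _ _ [U oU ->] [V oV ->]; exists (U `&` V) => //; exact: opnI.
- move=> F FO.
  exists (\bigcup_(V in [set V | opn sX V /\ F (i @^-1` V)]) V).
    by apply: (opn_bigcup hX) => V [].
  apply/seteqP; split=> y.
    by case=> U FU Uy; have [V oV e] := FO _ FU; rewrite e in FU Uy; exists V.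
  by case=> V [oV FV] Vy; exists (i @^-1` V).
- move=> U h h' _ e rh y Uy; have [V [g [oV Vy rg hg]]] := rh _ Uy.
  by exists V, g; split=> // z Uz Vz; rewrite -e // hg.
- move=> U V h _ _ VU rh y Vy; have [V' [g [oV' V'y rg hg]]] := rh _ (VU _ Vy).
  by exists V', g; split=> // z /VU; exact: hg.
- move=> U h _ H y Uy; have [_ [[V oV ->] Vy VU rh]] := H _ Uy.
  have [V' [g [oV' V'y rg hg]]] := rh _ Vy.
  exists (V `&` V'), g; split=> //; first exact: opnI.
  + by apply: (reg_restrict hX) rg => //; exact: opnI.
  + by move=> z Uz [Vz V'z]; exact: hg.
Qed.

Lemma pull_ringed X Y (sX : fspace k X) (i : Y -> X) :
  ringed sX -> ringed (pull sX i).
Proof.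
move=> hX; have hP := pull_space i hX; split=> //.
- by move=> U c _ y Uy; exists setT, (fun=> c); split=> //; [|apply: (reg_cst hX)];
    exact: (opnT hX).
- move=> U f g _ rf rg y Uy.
  have [V [f' [oV Vy rf' hf]]] := rf _ Uy.
  have [W [g' [oW Wy rg' hg]]] := rg _ Uy.
  have o := opnI hX oV oW.
  exists (V `&` W), (fun x => f' x + g' x); split=> //.
    apply: (reg_add hX) => //; last by apply: (reg_restrict hX) rg' => // x [].
    by apply: (reg_restrict hX) rf' => // x [].
  by move=> z Uz [Vz Wz]; rewrite hf // hg.
- move=> U f g _ rf rg y Uy.
  have [V [f' [oV Vy rf' hf]]] := rf _ Uy.
  have [W [g' [oW Wy rg' hg]]] := rg _ Uy.
  have o := opnI hX oV oW.
  exists (V `&` W), (fun x => f' x * g' x); split=> //.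
    apply: (reg_mul hX) => //; last by apply: (reg_restrict hX) rg' => // x [].
    by apply: (reg_restrict hX) rf' => // x [].
  by move=> z Uz [Vz Wz]; rewrite hf // hg.
- move=> U f _ rf f0 y Uy.
  have [V [f' [oV Vy rf' hf]]] := rf _ Uy.
  have o := opn_neq0 hX oV rf'.
  exists (V `&` [set x | f' x != 0]), (fun x => (f' x)^-1); split=> //.
  + by split=> //=; rewrite -hf // f0.
  + apply: (reg_inv hX) => // [|x []//].
    by apply: (reg_restrict hX) rf' => // x [].
  + by move=> z Uz [Vz _]; rewrite hf.
- move=> U f [V oV UE] rf; apply: (opn_local hP) => y [Uy fy].
  have [W [f' [oW Wy rf' hf]]] := rf _ Uy.
  exists (i @^-1` (V `&` (W `&` [set x | f' x != 0]))); split.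
  + by exists (V `&` (W `&` [set x | f' x != 0])) => //; apply: (opnI hX oV);
      apply: opn_neq0.
  + by split; [rewrite UE in Uy|split=> //=; rewrite -hf].
  + by move=> z [Vz [Wz fz]]; split; [rewrite UE|rewrite /= hf // UE].
Qed.

Lemma embedding_ringed X Y (sX : fspace k X) (sY : fspace k Y) i :
  ringed sY -> embedding sX sY i -> ringed sX.
Proof.
move=> hY [_ eo er]; have hP := pull_ringed i hY.
have hS : is_space sX.
  split.
  - by apply/eo/(opnT hP).
  - by move=> U V /eo oU /eo oV; apply/eo/(opnI hP).
  - by move=> F FO; apply/eo/(opn_bigcup hP) => U /FO /eo.
  - move=> U h h' oU e /(er _ oU) rh; apply/(er _ oU).
    exact: (reg_eq hP (proj1 (eo _) oU) e rh).
  - move=> U V h oU oV VU /(er _ oU) rh; apply/(er _ oV).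
    by apply: (reg_restrict hP) rh => //; exact/eo.
  - move=> U h oU H; apply/(er _ oU)/(reg_glue hP); first exact/eo.
    move=> x /H [V [oV Vx VU rh]]; exists V; split=> //; [exact/eo|exact/er].
split=> //.
- by move=> U c oU; apply/(er _ oU)/(reg_cst hP)/eo.
- move=> U f g oU /(er _ oU) rf /(er _ oU) rg.
  by apply/(er _ oU)/(reg_add hP) => //; apply/eo.
- move=> U f g oU /(er _ oU) rf /(er _ oU) rg.
  by apply/(er _ oU)/(reg_mul hP) => //; apply/eo.
- move=> U f oU /(er _ oU) rf f0.
  by apply/(er _ oU)/(reg_inv hP) => //; apply/eo.
- move=> U f oU /(er _ oU) rf; apply/eo/(opn_neq0 hP) => //.
  exact/eo.
Qed.

End Spaces.

(** * Polynomial functions *)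

Section Polyfun.
Variable k : fieldType.
Implicit Types W : vectType k.

Lemma polyfun_lin W (f : W -> k^o) : linear f -> polyfun (f : W -> k).
Proof.
move=> hf.
pose fL : {linear W -> k^o} := HB.pack f (GRing.isLinear.Build k W k^o *:%R f hf).
suff -> : f = (fun w => linfun fL w : k^o) by exact: Polyfun_linear.
by apply: funext => w; rewrite lfunE.
Qed.

Lemma polyfun_opp W (p : W -> k) : polyfun p -> polyfun (fun w => - p w).
Proof.
move=> hp; have -> : (fun w => - p w) = (fun w => -1 * p w).
  by apply: funext => w; rewrite mulN1r.
by apply: Polyfun_mul => //; exact: Polyfun_const.
Qed.

Lemma polyfun_sum W (I : Type) (s : seq I) (P : pred I) (p : I -> W -> k) :
  (forall i, polyfun (p i)) -> polyfun (fun w => \sum_(i <- s | P i) p i w).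
Proof.
move=> hp; elim: s => [|i s IH].
  rewrite (_ : (fun _ => _) = fun=> 0); first exact: Polyfun_const.
  by apply: funext => w; rewrite big_nil.
rewrite (_ : (fun _ => _) = fun w => (if P i then p i w else 0) +
  \sum_(j <- s | P j) p j w); last first.
  by apply: funext => w; rewrite big_cons; case: (P i) => //; rewrite add0r.
apply: Polyfun_add => //; case: (P i) => //; exact: Polyfun_const.
Qed.

Lemma polyfun_prod W (I : Type) (s : seq I) (P : pred I) (p : I -> W -> k) :
  (forall i, polyfun (p i)) -> polyfun (fun w => \prod_(i <- s | P i) p i w).
Proof.
move=> hp; elim: s => [|i s IH].
  rewrite (_ : (fun _ => _) = fun=> 1); first exact: Polyfun_const.
  by apply: funext => w; rewrite big_nil.
rewrite (_ : (fun _ => _) = fun w => (if P i then p i w else 1) *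
  \prod_(j <- s | P j) p j w); last first.
  by apply: funext => w; rewrite big_cons; case: (P i) => //; rewrite mul1r.
apply: Polyfun_mul => //; case: (P i) => //; exact: Polyfun_const.
Qed.

Lemma polyfun_exp W (p : W -> k) n : polyfun p -> polyfun (fun w => p w ^+ n).
Proof.
move=> hp; elim: n => [|n IH]; first exact: Polyfun_const.
rewrite (_ : (fun _ => _) = fun w => p w * p w ^+ n); first exact: Polyfun_mul.
by apply: funext => w; rewrite exprS.
Qed.

Lemma polyfun_comp W W' (f : W -> W') (p : W' -> k) :
  (forall u : 'Hom(W', k^o), polyfun (fun w => u (f w) : k)) -> polyfun p ->
  polyfun (p \o f).
Proof.
move=> hf; elim=> [c|u|p1 p2 _ h1 _ h2|p1 p2 _ h1 _ h2].
- exact: Polyfun_const.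
- exact: hf.
- exact: Polyfun_add h1 h2.
- exact: Polyfun_mul h1 h2.
Qed.

Lemma polyfun_coord p (j : 'I_p) : polyfun (fun x : 'rV[k]_p => x 0 j).
Proof. by apply: polyfun_lin => a x y; rewrite !mxE. Qed.

Lemma hom_rowE p (u : 'Hom('rV[k]_p, k^o)) (x : 'rV[k]_p) :
  u x = \sum_j x 0 j * u (delta_mx 0 j).
Proof. by rewrite [in LHS](row_sum_delta x) linear_sum; apply: eq_bigr => j _; rewrite linearZ. Qed.

Lemma polyfun_comp_row W p (f : W -> 'rV[k]_p) (q : 'rV[k]_p -> k) :
  (forall j, polyfun (fun w => f w 0 j)) -> polyfun q -> polyfun (q \o f).
Proof.
move=> hf; apply: polyfun_comp => u.
rewrite (_ : (fun _ => _) = fun w => \sum_j f w 0 j * (u (delta_mx 0 j) : k)).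
  by apply: polyfun_sum => j; apply: Polyfun_mul => //; exact: Polyfun_const.
by apply: funext => w; rewrite hom_rowE.
Qed.

Lemma polyfun_line W (p : W -> k) (a b : W) : polyfun p ->
  exists q : {poly k}, forall t, p (a + t *: b) = q.[t].
Proof.
elim=> [c|u|p1 p2 _ [q1 h1] _ [q2 h2]|p1 p2 _ [q1 h1] _ [q2 h2]].
- by exists c%:P => t; rewrite hornerC.
- exists ((u a : k)%:P + (u b : k) *: 'X) => t.
  by rewrite linearD linearZ /= !hornerE /= mulrC.
- by exists (q1 + q2) => t; rewrite hornerD h1 h2.
- by exists (q1 * q2) => t; rewrite hornerM h1 h2.
Qed.

Lemma polyfun_det n W (P : W -> 'M[k]_n) :
  (forall i j, polyfun (fun w => P w i j)) -> polyfun (fun w => \det (P w)).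
Proof.
move=> hP; apply: polyfun_sum => s; apply: Polyfun_mul; first exact: Polyfun_const.
exact: polyfun_prod.
Qed.

End Polyfun.

Section Dense.
Variable k : closedFieldType.
Implicit Types W : vectType k.

(** On the line through a and b both p and q are polynomials in one variable. *)
Lemma polyfun_dense W (p q : W -> k) a b : polyfun p -> polyfun q ->
  p a != 0 -> q b != 0 -> exists x, p x != 0 /\ q x != 0.
Proof.
move=> hp hq pa qb.
have [P hP] := polyfun_line a (b - a) hp.
have [Q hQ] := polyfun_line a (b - a) hq.
have : P * Q != 0.
  rewrite mulf_neq0 //.
    by apply: contraNneq pa => P0; rewrite -(addr0 a) -(scale0r (b - a)) hP P0 horner0.
  apply: contraNneq qb => Q0.
  by rewrite -(subrKC a b) -[b - a]scale1r hQ Q0 horner0.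
move=> /closed_nonrootP [t]; rewrite rootM negb_or => /andP [Pt Qt].
by exists (a + t *: (b - a)); rewrite hP hQ.
Qed.

Lemma polyfun_ext W (p q : W -> k) a : polyfun p -> polyfun q -> q a != 0 ->
  (forall x, q x != 0 -> p x = 0) -> forall x, p x = 0.
Proof.
move=> hp hq qa H x; apply/eqP/negP => /negP px.
have [y [py /H /eqP]] := polyfun_dense hp hq px qa.
by apply/negP.
Qed.

End Dense.

Section AffineSpace.
Variables (k : fieldType) (W : vectType k).
Local Notation sW := (affine_space W).

Lemma affine_space_space : is_space sW.
Proof.
split.
- move=> w _; exists (fun=> 1); split=> //; first exact: Polyfun_const.
  exact: oner_neq0.
- move=> U V oU oV w [/oU [p [hp pw pU]] /oV [q [hq qw qV]]].
  exists (fun w => p w * q w); split; first exact: Polyfun_mul.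
    by rewrite mulf_neq0.
  by move=> z; rewrite mulf_eq0 negb_or => /andP [/pU ? /qV].
- move=> F FO w [U FU Uw]; have [p [hp pw pU]] := FO _ FU _ Uw.
  by exists p; split=> // z /pU; exists U.
- move=> U h h' _ e rh w Uw; have [p [q [hp hq qw H]]] := rh _ Uw.
  by exists p, q; split=> // z Uz qz; rewrite -e // H.
- move=> U V h _ _ VU rh w Vw; have [p [q [hp hq qw H]]] := rh _ (VU _ Vw).
  by exists p, q; split=> // z /VU; exact: H.
- move=> U h _ H w Uw; have [V [oV Vw VU rh]] := H _ Uw.
  have [p [q [hp hq qw hh]]] := rh _ Vw.
  have [v [hv vw vV]] := oV _ Vw.
  exists (fun w => v w * p w), (fun w => v w * q w).
  split; try exact: Polyfun_mul; first by rewrite mulf_neq0.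
  move=> z Uz; rewrite mulf_eq0 negb_or => /andP [vz qz].
  by rewrite hh //; [rewrite -mulf_div divff // mul1r | exact: vV].
Qed.

Lemma affine_space_ringed : ringed sW.
Proof.
split; first exact: affine_space_space.
- move=> U c _ w _; exists (fun=> c), (fun=> 1).
  by split; [exact: Polyfun_const..|exact: oner_neq0|move=> z _ _; rewrite divr1].
- move=> U f g _ rf rg w Uw.
  have [p [q [hp hq qw hf]]] := rf _ Uw; have [p' [q' [hp' hq' qw' hg]]] := rg _ Uw.
  exists (fun w => p w * q' w + p' w * q w), (fun w => q w * q' w).
  split; [|exact: Polyfun_mul|by rewrite mulf_neq0|].
    by apply: Polyfun_add; exact: Polyfun_mul.
  move=> z Uz; rewrite mulf_eq0 negb_or => /andP [qz q'z].
  by rewrite hf // hg // addf_div.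
- move=> U f g _ rf rg w Uw.
  have [p [q [hp hq qw hf]]] := rf _ Uw; have [p' [q' [hp' hq' qw' hg]]] := rg _ Uw.
  exists (fun w => p w * p' w), (fun w => q w * q' w).
  split; try exact: Polyfun_mul; first by rewrite mulf_neq0.
  move=> z Uz; rewrite mulf_eq0 negb_or => /andP [qz q'z].
  by rewrite hf // hg // mulf_div.
- move=> U f _ rf f0 w Uw; have [p [q [hp hq qw hf]]] := rf _ Uw.
  have := f0 _ Uw; rewrite hf // mulf_eq0 negb_or => /andP [pw _].
  exists (fun w => q w * q w), (fun w => q w * p w).
  split; try exact: Polyfun_mul; first by rewrite mulf_neq0.
  move=> z Uz; rewrite mulf_eq0 negb_or => /andP [qz pz].
  by rewrite hf // invf_div -mulf_div divff // mul1r.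
- move=> U f oU rf w [Uw fw]; have [p [q [hp hq qw hf]]] := rf _ Uw.
  have [u [hu uw uU]] := oU _ Uw.
  have := fw; rewrite /= hf // mulf_eq0 negb_or => /andP [pw _].
  exists (fun w => u w * (p w * q w)); split; try by do ?apply: Polyfun_mul.
    by rewrite !mulf_neq0.
  move=> z; rewrite !mulf_eq0 !negb_or => /and3P [uz pz qz].
  by split; [exact: uU|rewrite /= hf ?mulf_neq0 ?invr_neq0 //; exact: uU].
Qed.

Lemma reg_polyfun U p : polyfun p -> reg sW U p.
Proof.
move=> hp w _; exists p, (fun=> 1); split=> //; first exact: Polyfun_const.
  exact: oner_neq0.
by move=> z _ _; rewrite divr1.
Qed.

Lemma opn_polyfun p : polyfun p -> opn sW [set w | p w != 0].
Proof. by move=> hp w pw; exists p. Qed.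

Lemma polyfun_reg_comp Z (sZ : fspace k Z) N (f : Z -> W) p : ringed sZ ->
  opn sZ N -> (forall u : 'Hom(W, k^o), reg sZ N (fun z => u (f z) : k)) ->
  polyfun p -> reg sZ N (p \o f).
Proof.
move=> hZ oN hf; elim=> [c|u|p1 p2 _ h1 _ h2|p1 p2 _ h1 _ h2].
- exact: (reg_cst hZ).
- exact: hf.
- exact: (reg_add hZ).
- exact: (reg_mul hZ).
Qed.

Lemma regular_on_affine Z (sZ : fspace k Z) N (f : Z -> W) : ringed sZ ->
  opn sZ N -> (forall u : 'Hom(W, k^o), reg sZ N (fun z => u (f z) : k)) ->
  regular_on sZ N sW f.
Proof.
move=> hZ oN hf; split=> // V oV.
have o : opn sZ (N `&` f @^-1` V).
  apply: (opn_local hZ) => z [Nz /oV [p [hp pw pV]]].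
  exists (N `&` [set z | (p \o f) z != 0]); split=> //.
    by apply: (opn_neq0 hZ) => //; exact: polyfun_reg_comp.
  by move=> y [Ny py]; split=> //; exact: pV.
split=> // h rh; apply: (reg_glue hZ) => // z [Nz Vz].
have [p [q [hp hq qw hh]]] := rh _ Vz.
have oq : opn sZ (N `&` [set z | (q \o f) z != 0]).
  by apply: (opn_neq0 hZ) => //; exact: polyfun_reg_comp.
have oM := opnI hZ o oq.
have sub : (N `&` f @^-1` V `&` (N `&` [set z | (q \o f) z != 0])) `<=` N.
  by move=> y [[]].
exists (N `&` f @^-1` V `&` (N `&` [set z | (q \o f) z != 0])); split=> //.
apply: (reg_eq hZ oM (h := fun z => (p \o f) z * ((q \o f) z)^-1)).
  by move=> y [[Ny Vy] [_ qy]]; rewrite /= hh.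
apply: (reg_mul hZ) => //.
  by apply: (reg_restrict hZ oN) => //; exact: polyfun_reg_comp.
apply: (reg_inv hZ) => //; last by move=> y [_ []].
by apply: (reg_restrict hZ oN) => //; exact: polyfun_reg_comp.
Qed.

End AffineSpace.

Lemma regular_on_row (k : fieldType) p Z (sZ : fspace k Z) N
    (f : Z -> 'rV[k]_p) : ringed sZ -> opn sZ N ->
  (forall j, reg sZ N (fun z => f z 0 j)) ->
  regular_on sZ N (affine_space 'rV[k]_p) f.
Proof.
move=> hZ oN hf; apply: regular_on_affine => // u.
rewrite (_ : (fun _ => _) = fun z => \sum_j f z 0 j * (u (delta_mx 0 j) : k)).
  apply: (@reg_sum _ _ _ _ _ _ (fun j z => f z 0 j * (u (delta_mx 0 j) : k))) => // j.
  by apply: (reg_mul hZ) => //; exact: (reg_cst hZ).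
by apply: funext => w; rewrite hom_rowE.
Qed.

(** A function regular on an open set of an affine space is determined by its
    values on a dense subset, since its local numerators are polynomials. *)
Lemma reg_affine_ext (k : closedFieldType) (W : vectType k) (U : set W)
    (a q : W -> k) w0 : opn (affine_space W) U -> reg (affine_space W) U a ->
  polyfun q -> q w0 != 0 -> (forall w, U w -> q w != 0 -> a w = 0) ->
  forall w, U w -> a w = 0.
Proof.
move=> oU ra hq qw0 H w Uw.
have [u [hu uw uU]] := oU _ Uw.
have [n [d [hn hd dw aE]]] := ra _ Uw.
have hud : polyfun (fun w => u w * d w) by exact: Polyfun_mul.
have udw : u w * d w != 0 by rewrite mulf_neq0.
have [w1 [udw1 qw1]] := polyfun_dense hud hq udw qw0.
have n0 : forall x, n x = 0.
  have hD : polyfun (fun w => u w * d w * q w) by exact: Polyfun_mul.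
  apply: (polyfun_ext hn hD (a := w1)); first by rewrite mulf_neq0.
  move=> x; rewrite !mulf_eq0 !negb_or => /andP [/andP [ux dx] qx].
  have := H x (uU _ ux) qx; rewrite aE //; last exact: uU.
  by move/eqP; rewrite mulf_eq0 invr_eq0 (negPf dx) orbF => /eqP.
by rewrite aE // n0 mul0r.
Qed.

(** * Characters of a torus and homogeneous components *)

Section Characters.
Variables (k : fieldType) (p : nat).
Implicit Types (x y s : 'rV[k]_p) (m : 'rV[int]_p).

Lemma gm_mul_gm x y : gm x -> gm y -> gm (gm_mul x y).
Proof. by move=> hx hy i; rewrite mxE mulf_neq0. Qed.

Lemma gm_mulC x y : gm_mul x y = gm_mul y x.
Proof. by apply/rowP => i; rewrite !mxE mulrC. Qed.

Definition gm_inv x : 'rV[k]_p := \row_i (x 0 i)^-1.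

Lemma gm_inv_gm x : gm x -> gm (gm_inv x).
Proof. by move=> hx i; rewrite mxE invr_neq0. Qed.

Lemma gm_mulVK x y : gm x -> gm_mul (gm_inv x) (gm_mul x y) = y.
Proof. by move=> hx; apply/rowP => i; rewrite !mxE mulKf. Qed.

Lemma gm_mul1 x : gm_mul (const_mx 1) x = x.
Proof. by apply/rowP => i; rewrite !mxE mul1r. Qed.

Lemma gm_mulV x : gm x -> gm_mul x (gm_inv x) = const_mx 1.
Proof. by move=> hx; apply/rowP => i; rewrite !mxE divff. Qed.

Lemma gm_one : gm (const_mx 1 : 'rV[k]_p).
Proof. by move=> i; rewrite mxE oner_neq0. Qed.

Lemma chi_neq0 m x : gm x -> chi m x != 0.
Proof. by move=> hx; apply/prodf_neq0 => i _; rewrite expfz_neq0. Qed.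

Lemma chi1 m : chi m (const_mx 1 : 'rV[k]_p) = 1.
Proof. by rewrite /chi big1 // => i _; rewrite mxE exp1rz. Qed.

Lemma chi0 x : chi 0 x = 1.
Proof. by rewrite /chi big1 // => i _; rewrite mxE expr0z. Qed.

Lemma chiM m x y : chi m (gm_mul x y) = chi m x * chi m y.
Proof. by rewrite /chi -big_split; apply: eq_bigr => i _; rewrite mxE expfzMl. Qed.

Lemma chiD m m' x : gm x -> chi (m + m') x = chi m x * chi m' x.
Proof.
by move=> hx; rewrite /chi -big_split; apply: eq_bigr => i _; rewrite mxE expfzDr.
Qed.

Lemma chiB m m' x : gm x -> chi (m - m') x = chi m x / chi m' x.
Proof.
move=> hx; apply: (mulIf (chi_neq0 m' hx)).
by rewrite -chiD // subrK divfK // chi_neq0.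
Qed.

Lemma gm_polyfun : polyfun (fun x : 'rV[k]_p => \prod_j x 0 j).
Proof. by apply: polyfun_prod => j; exact: polyfun_coord. Qed.

Lemma gmP x : gm x <-> \prod_j x 0 j != 0.
Proof. by split=> [hx|/prodf_neq0 hx j]; [apply/prodf_neq0 => j _|apply: hx]. Qed.

Lemma polyfun_scale s (P : 'rV[k]_p -> k) :
  polyfun P -> polyfun (fun x => P (gm_mul s x)).
Proof.
apply: (@polyfun_comp_row _ _ _ (gm_mul s)) => j.
rewrite (_ : (fun _ => _) = fun x => s 0 j * x 0 j).
  by apply: Polyfun_mul; [exact: Polyfun_const|exact: polyfun_coord].
by apply: funext => x; rewrite mxE.
Qed.

Lemma gm_mul0 s : gm_mul s 0 = 0 :> 'rV[k]_p.
Proof. by apply/rowP => i; rewrite !mxE mulr0. Qed.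

(** Exponents may be repeated in the list, so that sums and products need no
    bookkeeping; polyfun_chi collects equal exponents. *)
Lemma polyfun_chi_list (P : 'rV[k]_p -> k) : polyfun P ->
  exists l : seq (k * 'rV[int]_p),
    forall x, gm x -> P x = \sum_(z <- l) z.1 * chi z.2 x.
Proof.
elim=> [c|u|p1 p2 _ [l1 h1] _ [l2 h2]|p1 p2 _ [l1 h1] _ [l2 h2]].
- by exists [:: (c, 0)] => x hx; rewrite big_seq1 chi0 mulr1.
- exists [seq (u (delta_mx 0 j) : k, delta_mx 0 j) | j <- enum 'I_p] => x hx.
  rewrite big_map big_enum /= hom_rowE; apply: eq_bigr => j _.
  rewrite mulrC; congr (_ * _); rewrite /chi (bigD1 j) //= mxE !eqxx expr1z big1 ?mulr1 //.
  by move=> i ij; rewrite mxE eqxx (negPf ij) expr0z.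
- by exists (l1 ++ l2) => x hx; rewrite big_cat h1 // h2.
- exists [seq (z1.1 * z2.1, z1.2 + z2.2) | z1 <- l1, z2 <- l2] => x hx.
  rewrite h1 // h2 // big_allpairs_dep /= mulr_suml; apply: eq_bigr => z1 _.
  by rewrite mulr_sumr; apply: eq_bigr => z2 _; rewrite chiD // mulrACA.
Qed.

Lemma polyfun_chi (I : finType) (P : I -> 'rV[k]_p -> k) :
  (forall i, polyfun (P i)) ->
  exists (u : seq 'rV[int]_p) (c : 'rV[int]_p -> I -> k), uniq u /\
    forall i x, gm x -> P i x = \sum_(m <- u) c m i * chi m x.
Proof.
move=> hP.
have /choice [l hl] : forall i, exists l : seq (k * 'rV[int]_p),
    forall x, gm x -> P i x = \sum_(z <- l) z.1 * chi z.2 x.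
  by move=> i; exact: polyfun_chi_list.
exists (undup (flatten [seq map snd (l i) | i <- enum I])).
exists (fun m i => \sum_(z <- l i | z.2 == m) z.1); split; first exact: undup_uniq.
move=> i x hx; rewrite hl //.
under [RHS]eq_bigr => m _ do rewrite mulr_suml big_mkcond.
rewrite exchange_big /= !big_seq; apply: eq_bigr => z zl.
rewrite -big_mkcond /= (eq_bigl (pred1 z.2)); last by move=> m; rewrite /= eq_sym.
rewrite -big_filter filter_pred1_uniq ?undup_uniq ?big_seq1 // mem_undup.
apply/flattenP; exists (map snd (l i)); last exact: map_f.
by apply/mapP; exists i => //; rewrite mem_enum.
Qed.

End Characters.

Lemma chi_separates (k : closedFieldType) p (m m' : 'rV[int]_p) : m != m' ->
  exists2 s : 'rV[k]_p, gm s & chi m s != chi m' s.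
Proof.
move=> mm'; have [j jm] : exists j, m 0 j != m' 0 j.
  apply/existsP; apply: contraNT mm'; rewrite negb_exists => /forallP h.
  by apply/eqP/rowP => j; have := h j; rewrite negbK => /eqP.
have [y [y0 hy]] : exists y : k, y != 0 /\ y ^ (m 0 j - m' 0 j) != 1.
  have : m 0 j - m' 0 j != 0 by rewrite subr_eq0.
  move: (_ - _) => a a0.
  have an : (0 < `|a|)%N by rewrite absz_gt0.
  have : 'X * ('X^`|a| - 1) != 0 :> {poly k}.
    by rewrite mulf_neq0 ?polyX_eq0 // monic_neq0 // monicXnsubC.
  move=> /closed_nonrootP [y]; rewrite /root !hornerE mulf_eq0 negb_or => /andP [y0].
  rewrite subr_eq0 => hy; exists y; split=> //.
  case: a a0 an hy => n _ _; rewrite ?NegzE /= => hy //.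
  by rewrite -exprnN invr_eq1.
pose s : 'rV[k]_p := \row_i (if i == j then y else 1).
have sE n : chi n s = y ^ n 0 j.
  rewrite /chi (bigD1 j) //= mxE eqxx big1 ?mulr1 // => i ij.
  by rewrite mxE (negPf ij) exp1rz.
exists s => [i|]; first by rewrite mxE; case: ifP => // _; exact: oner_neq0.
rewrite !sE; apply: contraNneq hy => e.
by rewrite expfzDr // e -expfzDr // subrr expr0z.
Qed.

(** Distinct characters are linearly independent; this is the same argument,
    relative to a subspace L: a difference of two translates kills one
    component and multiplies the others by constants. *)
Lemma chi_components (k : closedFieldType) p (T : Type) (L : set (T -> k))
    (u : seq 'rV[int]_p) (a : 'rV[int]_p -> T -> k) :
  (forall c f g, L f -> L g -> L (fun t => c * f t + g t)) -> uniq u ->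
  (forall s : 'rV[k]_p, gm s -> L (fun t => \sum_(m <- u) chi m s * a m t)) ->
  forall m, m \in u -> L (a m).
Proof.
move=> hL; elim: u a => // m0 u IH a /andP [m0u uu] H.
have tl m1 : m1 \in u -> L (a m1).
  move=> m1u; have m10 : m1 != m0 by apply: contraNneq m0u => <-.
  have [s0 hs0 ne] := chi_separates k m10.
  have ne' : chi m1 s0 - chi m0 s0 != 0 by rewrite subr_eq0.
  have L2 : L (fun t => (chi m1 s0 - chi m0 s0) * a m1 t).
    apply: (IH (fun m t => (chi m s0 - chi m0 s0) * a m t)) => // s hs.
    have := hL (- chi m0 s0) _ _ (H _ hs) (H _ (gm_mul_gm hs hs0)).
    congr L; apply: funext => t; rewrite mulr_sumr -big_split /= big_cons chiM.
    rewrite [X in X + _](_ : _ = 0) ?add0r; last by ring.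
    by apply: eq_bigr => m _; rewrite chiM; ring.
  have := hL ((chi m1 s0 - chi m0 s0)^-1 - 1) _ _ L2 L2.
  congr L; apply: funext => t.
  by rewrite mulrBl mul1r subrK mulKf.
move=> m; rewrite inE => /orP [/eqP ->|]; last exact: tl.
have hu : forall v : seq 'rV[int]_p, {subset v <= u} -> forall f, L f ->
    L (fun t => f t - \sum_(m <- v) a m t).
  elim=> [|m1 v IHv] sub f Lf.
    by move: Lf; congr L; apply: funext => t; rewrite big_nil subr0.
  have sub' : {subset v <= u} by move=> y yv; apply: sub; rewrite inE yv orbT.
  have Lv := IHv sub' f Lf.
  have := hL (-1) _ _ (tl _ (sub _ (mem_head _ _))) Lv.
  by congr L; apply: funext => t; rewrite big_cons; ring.
have := hu u (fun _ => id) _ (H _ (@gm_one k p)).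
congr L; apply: funext => t; rewrite big_cons chi1 mul1r.
by under eq_bigr => i _ do rewrite chi1 mul1r; rewrite addrK.
Qed.

(** * Homogeneous frames *)

(** The local ring of affine space at the origin.  The functions of interest
    are meaningful on the torus only, so this is where they are compared with
    fractions. *)
Definition regular_at_origin (k : fieldType) p (a : 'rV[k]_p -> k) : Prop :=
  exists P Q, [/\ polyfun P, polyfun Q, Q 0 != 0 &
    forall x, gm x -> Q x != 0 -> a x = P x / Q x].

Section Origin.
Variables (k : fieldType) (p : nat).
Implicit Types a b : 'rV[k]_p -> k.

Lemma origin_polyfun a : polyfun a -> regular_at_origin a.
Proof.
move=> ha; exists a, (fun=> 1); split=> //; first exact: Polyfun_const.
  exact: oner_neq0.
by move=> x _ _; rewrite divr1.
Qed.

Lemma origin_eq a b d : regular_at_origin a -> polyfun d -> d 0 != 0 ->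
  (forall x, gm x -> d x != 0 -> a x = b x) -> regular_at_origin b.
Proof.
move=> [P [Q [hP hQ Q0 aE]]] hd d0 e.
exists (fun x => P x * d x), (fun x => Q x * d x); split; try exact: Polyfun_mul.
  by rewrite mulf_neq0.
move=> x hx; rewrite mulf_eq0 negb_or => /andP [Qx dx].
by rewrite -e // aE // -mulf_div divff // mulr1.
Qed.

Lemma origin_add a b : regular_at_origin a -> regular_at_origin b ->
  regular_at_origin (fun x => a x + b x).
Proof.
move=> [P [Q [hP hQ Q0 aE]]] [P' [Q' [hP' hQ' Q'0 bE]]].
exists (fun x => P x * Q' x + P' x * Q x), (fun x => Q x * Q' x); split.
- by apply: Polyfun_add; exact: Polyfun_mul.
- exact: Polyfun_mul.
- by rewrite mulf_neq0.
- move=> x hx; rewrite mulf_eq0 negb_or => /andP [Qx Q'x].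
  by rewrite aE // bE // addf_div.
Qed.

Lemma origin_mul a b : regular_at_origin a -> regular_at_origin b ->
  regular_at_origin (fun x => a x * b x).
Proof.
move=> [P [Q [hP hQ Q0 aE]]] [P' [Q' [hP' hQ' Q'0 bE]]].
exists (fun x => P x * P' x), (fun x => Q x * Q' x); split;
  try exact: Polyfun_mul; first by rewrite mulf_neq0.
move=> x hx; rewrite mulf_eq0 negb_or => /andP [Qx Q'x].
by rewrite aE // bE // mulf_div.
Qed.

Lemma origin_sum (I : Type) (s : seq I) (a : I -> 'rV[k]_p -> k) :
  (forall i, regular_at_origin (a i)) ->
  regular_at_origin (fun x => \sum_(i <- s) a i x).
Proof.
move=> ha; elim: s => [|i s IH].
  rewrite (_ : (fun _ => _) = fun=> 0); first exact/origin_polyfun/Polyfun_const.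
  by apply: funext => x; rewrite big_nil.
rewrite (_ : (fun _ => _) = fun x => a i x + \sum_(j <- s) a j x).
  exact: origin_add.
by apply: funext => x; rewrite big_cons.
Qed.

Lemma origin_lin c a b : regular_at_origin a -> regular_at_origin b ->
  regular_at_origin (fun x => c * a x + b x).
Proof.
move=> ha hb; apply: origin_add => //; apply: origin_mul => //.
exact/origin_polyfun/Polyfun_const.
Qed.

Lemma origin_scale s a : gm s -> regular_at_origin a ->
  regular_at_origin (fun x => a (gm_mul s x)).
Proof.
move=> hs [P [Q [hP hQ Q0 aE]]].
exists (fun x => P (gm_mul s x)), (fun x => Q (gm_mul s x)); split.
- exact: polyfun_scale.
- exact: polyfun_scale.
- by rewrite gm_mul0.
- by move=> x hx; apply: aE; exact: gm_mul_gm.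
Qed.

Lemma origin_common (I : finType) (a : I -> 'rV[k]_p -> k) :
  (forall i, regular_at_origin (a i)) -> exists P q,
    [/\ forall i, polyfun (P i), polyfun q, q 0 != 0 &
        forall i x, gm x -> q x != 0 -> a i x = P i x / q x].
Proof.
move=> /choice [P /choice [Q h]].
exists (fun i x => P i x * \prod_(j | j != i) Q j x), (fun x => \prod_j Q j x).
split.
- move=> i; have [hP _ _ _] := h i; apply: Polyfun_mul => //.
  by apply: polyfun_prod => j; have [] := h j.
- by apply: polyfun_prod => j; have [] := h j.
- by apply/prodf_neq0 => j _; have [] := h j.
- move=> i x hx /prodf_neq0 qx; have [_ _ _ ->] := h i => //; last exact: qx.
  rewrite [X in _ = _ / X](bigD1 i) //= -mulf_div divff ?mulr1 //.
  by apply/prodf_neq0 => j _; exact: qx.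
Qed.

End Origin.

Section Frame.
Variables (k : closedFieldType) (p r : nat) (S : 'rV[k]_p -> 'M[k]_r).
Variable g : 'rV[k]_p -> k.
Hypotheses (hg : polyfun g) (g0 : g 0 != 0).
Hypothesis S_unit : forall x, gm x -> g x != 0 -> S x \in unitmx.
Hypothesis S_cocycle : forall s, gm s -> forall i j,
  regular_at_origin (fun x => (S x *m invmx (S (gm_mul s x))) i j).

(** The functions h for which h S is regular at the origin form a vector space,
    stable under h |-> h(s x) by the cocycle condition; such a space contains
    the monomials of the polynomials in it. *)
Lemma clear_monomial (h : 'rV[k]_p -> k) (Q : 'rV[k]_p -> 'M[k]_r) w :
  polyfun h -> h w != 0 -> (forall i j, polyfun (fun x => Q x i j)) ->
  (forall x, gm x -> g x != 0 -> h x *: S x = Q x) ->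
  exists N, forall i j, regular_at_origin (fun x => chi N x * S x i j).
Proof.
move=> hh hw hQ hS.
pose L := [set f | forall i j, regular_at_origin (fun x => f x * S x i j)].
have hL c f f' : L f -> L f' -> L (fun t => c * f t + f' t).
  move=> Lf Lf' i j; have := origin_lin c (Lf i j) (Lf' i j).
  by congr regular_at_origin; apply: funext => x; ring.
have Lscale s : gm s -> L (fun x => h (gm_mul s x)).
  move=> hs i j.
  pose b x := \sum_l (S x *m invmx (S (gm_mul s x))) i l * Q (gm_mul s x) l j.
  apply: (@origin_eq _ _ b _ (fun x => g (gm_mul s x))).
  - apply: origin_sum => l; apply: origin_mul; first exact: S_cocycle.
    apply: origin_polyfun; exact: (polyfun_scale s (hQ l j)).
  - exact: polyfun_scale.
  - by rewrite gm_mul0.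
  - move=> x hx gx; have hsx := gm_mul_gm hs hx; rewrite /b.
    have -> : \sum_l (S x *m invmx (S (gm_mul s x))) i l * Q (gm_mul s x) l j =
       (S x *m invmx (S (gm_mul s x)) *m Q (gm_mul s x)) i j by rewrite !mxE.
    by rewrite -hS // -scalemxAr mulmxKV ?mxE // S_unit.
have [u [c [uu hc]]] := polyfun_chi (I := 'I_1) (P := fun _ => h) (fun _ => hh).
have [N Nu cN] : exists2 N, N \in u & c N 0 != 0.
  apply/hasP; apply: contraT; rewrite -all_predC => /allP c0.
  have [x [px hx]] := polyfun_dense (@gm_polyfun k p) hh (proj1 (gmP _) (@gm_one k p)) hw.
  move: hx; rewrite (hc 0) ?big_seq ?big1 ?eqxx //; last exact/gmP.
  by move=> m /c0 /=; rewrite negbK => /eqP ->; rewrite mul0r.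
exists N; have : L (fun x => c N 0 * chi N x).
  apply: (@chi_components _ p _ L u (fun m x => c m 0 * chi m x)) => // s hs i j.
  apply: (@origin_eq _ _ _ _ (fun=> 1) (Lscale s hs i j)).
  - exact: Polyfun_const.
  - exact: oner_neq0.
  - move=> x hx _; rewrite (hc 0); last exact: gm_mul_gm.
    by congr (_ * _); apply: eq_bigr => m _; rewrite chiM; ring.
move=> LN i j; have := hL ((c N 0)^-1 - 1) _ _ LN LN i j.
congr regular_at_origin; apply: funext => x.
by rewrite mulrBl mul1r subrK mulKf.
Qed.

(** The rows of v do not depend on x, so row i of v S(x)^-1, divided by the
    character mu i, is a homogeneous section; these sections are a frame at the
    origin. *)
Theorem homogeneous_frame (h : 'rV[k]_p -> k) (Q : 'rV[k]_p -> 'M[k]_r) w :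
  polyfun h -> h w != 0 -> (forall i j, polyfun (fun x => Q x i j)) ->
  (forall x, gm x -> g x != 0 -> h x *: S x = Q x) ->
  exists (v : 'M[k]_r) (mu : 'I_r -> 'rV[int]_p) (P : 'rV[k]_p -> 'M[k]_r) q,
    [/\ forall i j, polyfun (fun x => P x i j), polyfun q, q 0 != 0,
        \det (P 0) != 0 &
        (forall x, q x != 0 -> g x != 0) /\
        forall x, gm x -> q x != 0 ->
          forall i j, (v *m invmx (S x)) i j = chi (mu i) x * (P x i j / q x)].
Proof.
move=> hh hw hQ hS; have [N hN] := clear_monomial hh hw hQ hS.
have [A [f [hA hf f0 fE]]] :=
  @origin_common k p _ (fun (z : 'I_r * 'I_r) x => chi N x * S x z.1 z.2)
    (fun z => hN z.1 z.2).
have [u [c [uu hc]]] := polyfun_chi hA.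
pose C m : 'M[k]_r := \matrix_(i, j) c m (i, j).
have CE x : gm x -> f x != 0 ->
    (f x * chi N x) *: S x = \sum_(m <- u) chi m x *: C m.
  move=> hx fx; apply/matrixP => i j; rewrite summxE !mxE.
  have := fE (i, j) x hx fx; rewrite /= -mulrA => ->; rewrite mulrC divfK //.
  by rewrite hc //; apply: eq_bigr => m _; rewrite !mxE mulrC.
(* D m is the homogeneous section attached to the component C m of Q. *)
pose D m i j x := chi m x / chi N x * (C m *m invmx (S x)) i j.
have DE s x i j : gm s -> gm x -> f (gm_mul s x) != 0 ->
    \sum_(m <- u) chi m s * D m i j x =
    chi N s * f (gm_mul s x) * (S (gm_mul s x) *m invmx (S x)) i j.
  move=> hs hx fx; have hsx := gm_mul_gm hs hx.
  transitivity ((chi N x)^-1 * ((\sum_(m <- u) chi m (gm_mul s x) *: C m)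
     *m invmx (S x)) i j).
    rewrite mulmx_suml summxE mulr_sumr; apply: eq_bigr => m _.
    by rewrite -scalemxAl mxE /D chiM; ring.
  rewrite -CE // -scalemxAl mxE chiM; field.
  exact: chi_neq0.
have Dreg m : m \in u -> forall i j, regular_at_origin (D m i j).
  move=> mu i j; pose L := [set f : 'rV[k]_p -> k | regular_at_origin f].
  apply: (@chi_components _ p _ L u (fun m => D m i j)) mu => //.
    by move=> *; exact: origin_lin.
  move=> s hs; have hs' := gm_inv_gm hs.
  (* S (s x) S (x)^-1 is the cocycle of s^-1 at the point s x. *)
  pose b x := chi N s * f (gm_mul s x) *
    (S (gm_mul s x) *m invmx (S (gm_mul (gm_inv s) (gm_mul s x)))) i j.
  apply: (@origin_eq _ _ b _ (fun x => f (gm_mul s x))).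
  - apply: origin_mul.
      apply: origin_polyfun; apply: Polyfun_mul; first exact: Polyfun_const.
      exact: polyfun_scale.
    exact: (origin_scale hs (S_cocycle hs' i j)).
  - exact: polyfun_scale.
  - by rewrite gm_mul0.
  - by move=> x hx fx; rewrite /b gm_mulVK // DE.
(* The sections D m sum up to f times the identity; clearing denominators, this
   is an identity of polynomials and can be evaluated at the origin. *)
pose I := ('I_(size u) * 'I_r)%type.
pose U (z : 'I_(size u)) := nth 0 u z.
have Uu z : U z \in u by rewrite mem_nth.
have [P [q [hP hq q0 PE]]] :=
  @origin_common k p _ (fun (z : I * 'I_r) => D (U z.1.1) z.1.2 z.2)
    (fun z => Dreg _ (Uu z.1.1) z.1.2 z.2).
have sumP i j x : \sum_(z < size u) P ((z, i), j) x = q x * f x * (i == j)%:R.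
  pose T x := \sum_(z < size u) P ((z, i), j) x - q x * f x * (i == j)%:R.
  suff /(_ x) : forall x, T x = 0 by move/eqP; rewrite subr_eq0 => /eqP.
  have hT : polyfun T.
    apply: Polyfun_add; first exact: polyfun_sum.
    apply: polyfun_opp; apply: Polyfun_mul; last exact: Polyfun_const.
    exact: Polyfun_mul.
  have hfg : polyfun (fun x => f x * g x * q x).
    by do ?apply: Polyfun_mul.
  have fg0 : f 0 * g 0 * q 0 != 0 by rewrite !mulf_neq0.
  have [y [py fgy]] := polyfun_dense (@gm_polyfun k p) hfg
    (proj1 (gmP _) (@gm_one k p)) fg0.
  apply: (polyfun_ext hT (Polyfun_mul (@gm_polyfun k p) hfg) (a := y)).
    by rewrite mulf_neq0.
  move=> z; rewrite !mulf_eq0 !negb_or => /andP [/gmP hz /andP [/andP [fz gz] qz]].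
  apply/eqP; rewrite subr_eq0; apply/eqP.
  have := DE _ z i j (@gm_one k p) hz; rewrite gm_mul1 => /(_ fz).
  rewrite mulmxV ?S_unit // chi1 mul1r mxE => e.
  rewrite -mulrA -e mulr_sumr (big_nth 0) big_mkord; apply: eq_bigr => l _.
  by rewrite chi1 mul1r (PE ((l, i), j)) // mulrC divfK.
pose M : 'M[k]_(#|{: I}|, r) := \matrix_(a, j) P (enum_val a, j) 0.
have fM : row_full M.
  rewrite -sub1mx; apply/row_subP => i.
  have -> : row i (1%:M : 'M[k]_r) =
      (q 0 * f 0)^-1 *: \sum_(z < size u) row (enum_rank ((z, i) : I)) M.
    apply/rowP => j; rewrite !mxE summxE.
    under eq_bigr => z _ do rewrite !mxE enum_rankK.
    by rewrite sumP mulKf // mulf_neq0.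
  by apply: scalemx_sub; apply: summx_sub => z _; exact: row_sub.
pose e (i : 'I_r) : I := enum_val (fullrankfun fM i).
exists (\matrix_(i, j) C (U (e i).1) (e i).2 j), (fun i => N - U (e i).1).
exists (fun x => g x *: \matrix_(i, j) P (e i, j) x), (fun x => q x * g x); split.
- move=> i j; rewrite (_ : (fun _ => _) = fun x => g x * P (e i, j) x).
    exact: Polyfun_mul.
  by apply: funext => x; rewrite !mxE.
- exact: Polyfun_mul.
- by rewrite mulf_neq0.
- rewrite detZ mulf_neq0 ?expf_neq0 // -unitfE -unitmxE -row_full_unit.
  have := fullrowsub_full fM.
  rewrite (_ : rowsub _ _ = \matrix_(i, j) P (e i, j) 0) //.
  by apply/matrixP => i j; rewrite !mxE.
- split=> [x|x hx]; rewrite mulf_eq0 negb_or => /andP [qx gx] // i j.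
  have := PE (e i, j) x hx qx; rewrite /D /= => h1.
  rewrite !mxE chiB // [q x * g x]mulrC -mulf_div divff // mul1r -h1.
  rewrite mulrA (_ : chi N x / _ * _ = 1); last first.
    by rewrite mulf_div [X in X / _]mulrC divff // mulf_neq0 // chi_neq0.
  by rewrite mul1r mxE; apply: eq_bigr => l _; rewrite mxE.
Qed.

End Frame.

(** * Trivializations of vector bundles *)

Lemma open_embedding_reg (k : fieldType) (Z Y : choiceType) (sZ : fspace k Z)
    (sY : fspace k Y) i (O : set Y) h : is_space sY ->
  open_embedding sZ sY i -> opn sY O -> O `<=` range i ->
  reg sZ (i @^-1` O) (h \o i) -> reg sY O h.
Proof.
move=> hY [emb oR] oO OR rh; have [_ eo er] := emb.
have oZ : opn sZ (i @^-1` O) by have [] := embedding_regular emb oO.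
have {}rh := proj1 (er _ oZ _) rh.
apply: (reg_glue hY) => // y Oy; have [z _ zy] := OR _ Oy.
move: Oy; rewrite -zy => Oy.
have [V [g [oV Vz rg hg]]] := rh _ Oy.
exists (O `&` V); split=> //; first exact: opnI.
apply: (reg_eq hY (h := g)); first exact: opnI.
  by move=> y' [Oy' Vy']; have [z' _ e] := OR _ Oy'; rewrite -e -hg //= e.
by apply: (reg_restrict hY) rg => //; exact: opnI.
Qed.

Lemma open_embedding_image (k : fieldType) (Z Y : choiceType) (sZ : fspace k Z)
    (sY : fspace k Y) i (O : set Z) : is_space sY ->
  open_embedding sZ sY i -> opn sZ O -> opn sY (i @` O).
Proof.
move=> hY [[inj eo _] oR] /eo [V oV OE].
rewrite (_ : _ @` _ = V `&` range i); first exact: opnI.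
apply/seteqP; split=> [y [z Oz <-]|y [Vy [z _ zy]]].
  by split; [rewrite OE in Oz|exists z].
by exists z => //; rewrite OE /= zy.
Qed.

Lemma prod_fst_regular (k : fieldType) (X Y : choiceType) (sX : fspace k X)
    (sY : fspace k Y) : opn sY setT -> (forall U, opn sX U -> reg sX U (fun=> 1)) ->
  reg sY setT (fun=> 1) -> regular_map (prod_space sX sY) sX fst.
Proof.
move=> oY cX cY U oU; split.
  move=> z Uz; exists U, setT, (fun=> 1); split=> //; last 2 first.
  - exact: oner_neq0.
  - by move=> y [].
  exists 1%N, (fun _ _ => 1), (fun _ _ => 1); split=> // [_|z']; first exact: cX.
  by rewrite big_ord1 mulr1.
move=> h rh z Uz; exists U, setT, (h \o fst), (fun=> 1); split=> //.
- split.
    exists 1%N, (fun _ => h), (fun _ _ => 1); split=> // z'.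
    by rewrite big_ord1 mulr1.
  exists 1%N, (fun _ _ => 1), (fun _ _ => 1); split=> // [_|z']; first exact: cX.
  by rewrite big_ord1 mulr1.
- exact: oner_neq0.
- by move=> y _ _ _; rewrite divr1.
Qed.

(** Constants are sections of the structure sheaf because this holds on affine
    charts. *)
Lemma variety_cst (k : fieldType) (X : choiceType) (sX : fspace k X) U c :
  variety sX -> opn sX U -> reg sX U (fun=> c).
Proof.
move=> [hX [n [C [hC cov]]] _] oU; apply: (reg_glue hX) => // x Ux.
have [i Cx] := cov x; have [oC [W [f [emb _]]]] := hC i.
have hS := embedding_ringed (affine_space_ringed W) emb.
have /(_ (exist _ x (mem_set Cx)) I) [V [g [oV Vx rg hg]]] :=
  reg_cst hS c (opnT hS).
exists (U `&` (V `&` C i)).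
have o : opn sX (U `&` (V `&` C i)) by do ?apply: (opnI hX).
split=> //.
apply: (reg_eq hX o (h := g)).
  by move=> y [_ [Vy Cy]]; rewrite -(hg (exist _ y (mem_set Cy))).
by apply: (reg_restrict hX oV o) => // y [_ []].
Qed.

Lemma tagged_eta (I : Type) (F : I -> Type) (z : {i & F i}) :
  Tagged F (tagged z) = z.
Proof. by case: z. Qed.

Lemma linear_scale (k : fieldType) (V W : lmodType k) (f : V -> W) a v :
  linear f -> f (a *: v) = a *: f v.
Proof.
move=> hf.
pose fL : {linear V -> W} := HB.pack f (GRing.isLinear.Build k V W *:%R f hf).
exact: (linearZ_LR fL).
Qed.

Section Bundle.
Variables (k : fieldType) (X : choiceType) (sX : fspace k X).
Variables (E : X -> vectType k) (sE : fspace k (total_space E)).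
Local Notation total := (total_space E).
Local Notation over U := [set z : total | U (tag z)].

(** kap inverts psi on fibres.  It is a function on the whole total space, so
    that no transport between fibres over equal points is needed. *)
Record trivialization (U : set X) (r : nat) (psi : forall y, 'rV[k]_r -> E y)
    (kap : total -> 'rV[k]_r) : Prop := {
  tr_open : opn sX U;
  tr_lin : forall y, U y -> linear (psi y);
  tr_K : forall y w, U y -> kap (Tagged E (psi y w)) = w;
  tr_VK : forall z : total, U (tag z) -> psi (tag z) (kap z) = tagged z;
  tr_over : opn sE (over U);
  tr_reg : forall i, reg sE (over U) (fun z => kap z 0 i);
  tr_tag : regular_on sE (over U) sX (@tag _ _);
  tr_section : forall Z (sZ : fspace k Z) N f (w : Z -> 'rV[k]_r), ringed sZ ->
    regular_on sZ N sX f -> N `<=` f @^-1` U ->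
    (forall i, reg sZ N (fun z => w z 0 i)) ->
    regular_on sZ N sE (fun z => Tagged E (psi (f z) (w z)) : total)
}.

Hypothesis hX : variety sX.
Hypothesis hE : vector_bundle sX sE.

Lemma trivialization_exists x : exists U r psi kap,
  U x /\ @trivialization U r psi kap.
Proof.
have [hsE /(_ x) [U [r [psi [oU Ux hpsi oe]]]]] := hE.
have sXs := variety_space hX.
pose kap (z : total) : 'rV[k]_r := xget 0 [set w | psi (tag z) w = tagged z].
have K y w : U y -> kap (Tagged E (psi y w)) = w.
  move=> /hpsi [_ [f fK Kf]]; apply: (can_inj fK).
  by apply: (@xgetPex _ 0 [set w' | psi y w' = psi y w]); exists w.
have VK z : U (tag z) -> psi (tag z) (kap z) = tagged z.
  move=> /hpsi [_ [f fK Kf]].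
  by apply: (@xgetPex _ 0 [set w | psi (tag z) w = tagged z]); exists (f (tagged z)).
exists U, r, psi, kap; split=> //.
pose Psi (z : set_type U * 'rV[k]_r) : total := Tagged E (psi (set_val z.1) z.2).
have rE : range Psi = over U.
  apply/seteqP; split=> [_ [z _ <-]|z Uz] /=.
    exact: set_valP.
  exists (exist _ (tag z) (mem_set Uz), kap z) => //=.
  by rewrite /Psi /= VK // tagged_eta.
have oO : opn sE (over U) by rewrite -rE; case: oe.
have oA := opnT (affine_space_space 'rV[k]_r).
have cU c V : opn (sub_space sX U) V -> reg (sub_space sX U) V (fun=> c).
  move=> _ y _; exists setT, (fun=> c); split=> //; first exact: (opnT sXs).
  exact: (variety_cst _ hX (opnT sXs)).
have cA : reg (affine_space 'rV[k]_r) setT (fun=> 1).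
  by apply: reg_polyfun; exact: Polyfun_const.
split=> //.
- by move=> y /hpsi [].
- move=> i; apply: (open_embedding_reg hsE oe) => //; first by rewrite rE.
  pose c (z : set_type U * 'rV[k]_r) : k := z.2 0 i.
  rewrite (_ : _ \o _ = c); last first.
    by apply: funext => z; rewrite /= K //; exact: set_valP.
  move=> z _; exists setT, setT, c, (fun=> 1); split=> //.
  + by split=> //; exact: (opnT (pull_space _ sXs)).
  + split.
      exists 1%N, (fun _ _ => 1), (fun _ (w : 'rV[k]_r) => w 0 i); split=> //.
      * by move=> _; apply: cU; exact: (opnT (pull_space _ sXs)).
      * by move=> _; apply: reg_polyfun; exact: polyfun_coord.
      * by move=> y; rewrite big_ord1 mul1r.
    exists 1%N, (fun _ _ => 1), (fun _ _ => 1); split=> //.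
    * by move=> _; apply: cU; exact: (opnT (pull_space _ sXs)).
    * by move=> y; rewrite big_ord1 mul1r.
  + exact: oner_neq0.
  + by move=> y _ _ _; rewrite divr1.
- have hp : regular_map (prod_space (sub_space sX U) (affine_space 'rV[k]_r)) sX
      (set_val \o fst).
    move=> V /(@pull_regular _ _ _ sX (@set_val X U)) [oV rV].
    have [o r'] := prod_fst_regular oA (cU 1) cA oV.
    by split=> // h /rV /r'.
  split=> // V oV; have [o rV] := hp _ oV.
  have e : over U `&` (@tag _ _) @^-1` V = Psi @` ((set_val \o fst) @^-1` V).
    apply/seteqP; split=> [z [Uz Vz]|_ [z Vz <-]]; last by split=> //; exact: set_valP.
    exists (exist _ (tag z) (mem_set Uz), kap z) => //=.
    by rewrite /Psi /= VK // tagged_eta.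
  have oI : opn sE (over U `&` (@tag _ _) @^-1` V).
    by rewrite e; exact: (open_embedding_image hsE oe).
  split=> // h /rV rh; apply: (open_embedding_reg hsE oe) => //.
    by rewrite rE => z [].
  rewrite (_ : _ @^-1` _ = (set_val \o fst) @^-1` V) //.
  apply/seteqP; split=> [z []|z Vz] //.
  by split=> //; exact: set_valP.
- move=> Z sZ N f w hZ hf NU hw.
  pose f' z := if pselect (U (f z)) is left Uz then exist _ (f z) (mem_set Uz)
     else exist _ x (mem_set Ux) : set_type U.
  have f'E z : N z -> set_val (f' z) = f z.
    by move=> /NU Uz; rewrite /f'; case: pselect.
  have hf' : regular_on sZ N (sub_space sX U) f'.
    apply: (regular_on_pull hZ); apply: (regular_on_eq hZ hf) => z Nz.
    by rewrite /= f'E.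
  have hw' : regular_on sZ N (affine_space 'rV[k]_r) w.
    by apply: regular_on_row => //; case: hf.
  have := regular_on_comp (regular_on_pair hZ hf' hw') (embedding_regular (proj1 oe)).
  move=> h; apply: (regular_on_eq hZ h) => z Nz.
  by rewrite /= f'E.
Qed.

Lemma tag_regular : regular_on sE setT sX (@tag _ _ : total -> X).
Proof.
have [hsE _] := hE; apply: (regular_on_local hsE); first exact: opnT.
move=> z _; have [U [r [psi [kap [Uz tr]]]]] := trivialization_exists (tag z).
by exists (over U); split=> //; exact: (tr_tag tr).
Qed.

Definition scale_tot (a : k) (z : total) : total := Tagged E (a *: tagged z).

Lemma scale_regular Z (sZ : fspace k Z) N (f : Z -> total) a : ringed sZ ->
  regular_on sZ N sE f -> reg sZ N a ->
  regular_on sZ N sE (fun z => scale_tot (a z) (f z)).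
Proof.
move=> hZ hf ra; have oN := proj1 hf.
apply: (regular_on_local hZ) => // z0 Nz0.
have [U [r [psi [kap [Uz tr]]]]] := trivialization_exists (tag (f z0)).
have [oN' _] := proj2 hf _ (tr_over tr).
have sub : (N `&` f @^-1` over U) `<=` N by move=> z [].
have hf' := regular_on_restrict hZ hf oN' sub.
exists (N `&` f @^-1` over U); split=> //.
have hw i : reg sZ (N `&` f @^-1` over U) (fun z => (a z *: kap (f z)) 0 i).
  apply: (reg_eq hZ oN' (h := fun z => a z * kap (f z) 0 i)).
    by move=> z _; rewrite mxE.
  apply: (reg_mul hZ) => //; first exact: (reg_restrict hZ oN oN' sub ra).
  exact: (regular_on_reg hf' (tr_over tr) (tr_reg tr i)) => z [].
have := tr_section tr hZ (regular_on_comp hf' (proj2 (regular_mapE _ _ (proj1 hE)) tag_regular))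
  _ hw.
move=> h; apply: (regular_on_eq hZ (h _)) => [z []|z [_ Uz']] //.
have l : linear (psi (tag (f z))) by exact: (tr_lin tr).
rewrite /= (linear_scale _ _ l); congr (Tagged E (_ *: _)).
exact: (tr_VK tr).
Qed.

End Bundle.

(** * Algebraic groups and torus charts *)

Section Powers.
Variables (k : fieldType) (X : choiceType) (sX : fspace k X).
Hypothesis hX : ringed sX.

Lemma reg_exprn U (f : X -> k) n : opn sX U -> reg sX U f ->
  reg sX U (fun x => f x ^+ n).
Proof.
move=> oU rf; elim: n => [|n IH]; first exact: (reg_cst hX 1).
apply: (reg_eq hX oU _ (reg_mul hX oU rf IH)) => x _.
by rewrite exprS.
Qed.

Lemma reg_exprz U (f : X -> k) (n : int) : opn sX U -> reg sX U f ->
  (forall x, U x -> f x != 0) -> reg sX U (fun x => f x ^ n).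
Proof.
move=> oU rf f0; case: n => n; first exact: reg_exprn.
apply: (reg_eq hX oU _ (reg_inv hX oU (reg_exprn n.+1 oU rf) _)) => x Ux.
  by rewrite NegzE.
by rewrite expf_neq0 // f0.
Qed.

Lemma reg_bigprod (I : Type) (s : seq I) U (f : I -> X -> k) : opn sX U ->
  (forall i, reg sX U (f i)) -> reg sX U (fun x => \prod_(i <- s) f i x).
Proof.
move=> oU hf; elim: s => [|i s IH].
  by apply: (reg_eq hX oU _ (reg_cst hX 1 oU)) => x _; rewrite big_nil.
by apply: (reg_eq hX oU _ (reg_mul hX oU (hf i) IH)) => x _; rewrite big_cons.
Qed.

Lemma opn_common (I : finType) (N : I -> set X) x :
  (forall i, opn sX (N i) /\ N i x) ->
  exists M, [/\ opn sX M, M x & forall i, M `<=` N i].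
Proof.
move=> hN.
suff [M [oM Mx MN]] : exists M,
    [/\ opn sX M, M x & forall i, i \in enum I -> M `<=` N i].
  by exists M; split=> // i; apply: MN; rewrite mem_enum.
elim: (enum I) => [|i s [M [oM Mx MN]]]; first by exists setT; split=> //; exact: (opnT hX).
have [oN Nx] := hN i.
exists (N i `&` M); split=> //; first exact: (opnI hX).
by move=> j; rewrite inE => /orP [/eqP -> y []|/MN js y [_ /js]].
Qed.

End Powers.

Section Group.
Variables (k : fieldType) (G : groupType) (sG : fspace k G).
Hypothesis hG : linear_algebraic_group sG.

Lemma group_ringed : ringed sG.
Proof.
have [n [i [Z [emb _ _ _ _]]]] := hG.
exact: (embedding_ringed (affine_space_ringed _) emb).
Qed.

Lemma translate_regular (a b : G) : regular_map sG sG (fun g => a * g * b)%g.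
Proof.
have [n [i [Z [emb _ iM _ _]]]] := hG; have hS := group_ringed.
apply/(regular_mapE _ _ hS)/(regular_on_embedding hS emb).
apply: regular_on_affine => //; first exact: (opnT hS).
move=> u; pose l (M : 'M[k]_n) : k := u (i a *m M *m i b).
have hl : polyfun l.
  by apply: polyfun_lin => c M M'; rewrite /l mulmxDr mulmxDl -scalemxAr -scalemxAl linearP.
rewrite (_ : (fun _ => _) = l \o i); last by apply: funext => g; rewrite /= !iM.
have [oT r] := embedding_regular emb (opnT (affine_space_space _)).
by rewrite preimage_setT in r; apply: r; exact: reg_polyfun.
Qed.

Lemma chart_regular T d (phi : 'rV[k]_d -> G) Z (sZ : fspace k Z) N
    (f : Z -> 'rV[k]_d) :
  torus_chart sG T phi -> ringed sZ -> opn sZ N ->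
  (forall j, reg sZ N (fun z => f z 0 j)) -> N `<=` f @^-1` @gm k d ->
  regular_on sZ N sG (phi \o f).
Proof.
move=> [_ _ _ emb] hZ oN hf Ng.
pose f' z := if pselect (gm (f z)) is left h then exist _ (f z) (mem_set h)
   else exist _ (const_mx 1) (mem_set (@gm_one k d)) : set_type (@gm k d).
have f'E z : N z -> set_val (f' z) = f z.
  by move=> /Ng h; rewrite /f'; case: pselect.
have hf' : regular_on sZ N (@gm_space k d) f'.
  apply: (regular_on_pull hZ); apply: (regular_on_eq hZ (regular_on_row hZ oN hf)).
  by move=> z Nz; rewrite /= f'E.
have := regular_on_comp hf' (embedding_regular emb).
by move=> h; apply: (regular_on_eq hZ h) => z Nz; rewrite /= f'E.
Qed.

End Group.

Lemma expz_sum (k : fieldType) (t : k) (I : Type) (s : seq I) (n : I -> int) :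
  t != 0 -> t ^ (\sum_(i <- s) n i) = \prod_(i <- s) t ^ n i.
Proof.
move=> t0; apply: (big_morph (fun m : int => t ^ m)) => // a b.
exact: expfzDr.
Qed.

Lemma chi_cochar (k : fieldType) d (tau a : 'rV[int]_d) (t : k) : t != 0 ->
  chi a (\row_i t ^ tau 0 i) = t ^ dot tau a.
Proof.
move=> t0; rewrite /dot expz_sum //; apply: eq_bigr => i _.
by rewrite mxE exprz_exp.
Qed.

Lemma gm_cochar (k : fieldType) d (tau : 'rV[int]_d) (t : k) : t != 0 ->
  gm (\row_i t ^ tau 0 i).
Proof. by move=> t0 i; rewrite mxE expfz_neq0. Qed.

Lemma punctured_opn (k : fieldType) : opn (affine_line k) [set t : k^o | t != 0].
Proof. exact/opn_polyfun/(polyfun_lin (f := id)). Qed.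

Lemma reg_line_id (k : fieldType) U : reg (affine_line k) U (fun t : k^o => t : k).
Proof. exact/reg_polyfun/(polyfun_lin (f := id)). Qed.

(** * Derivations *)

Section Derivations.
Variables (k : fieldType) (X : choiceType) (sX : fspace k X) (x0 : X).
Variable D : (X -> k) -> k.
Hypotheses (hX : ringed sX) (hD : tangent sX x0 D).
Local Notation ra := (regular_at sX x0).

Lemma regular_at_add f g : ra f -> ra g -> ra (fun x => f x + g x).
Proof.
move=> [U [oU Ux rf]] [V [oV Vx rg]]; have o := opnI hX oU oV.
exists (U `&` V); split=> //; apply: (reg_add hX) => //.
  by apply: (reg_restrict hX oU) => // x [].
by apply: (reg_restrict hX oV) => // x [].
Qed.

Lemma regular_at_mul f g : ra f -> ra g -> ra (fun x => f x * g x).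
Proof.
move=> [U [oU Ux rf]] [V [oV Vx rg]]; have o := opnI hX oU oV.
exists (U `&` V); split=> //; apply: (reg_mul hX) => //.
  by apply: (reg_restrict hX oU) => // x [].
by apply: (reg_restrict hX oV) => // x [].
Qed.

Lemma regular_at_cst c : ra (fun=> c).
Proof. by exists setT; split=> //; [|apply: (reg_cst hX)]; exact: (opnT hX). Qed.

Lemma regular_at_sum (I : Type) (s : seq I) (f : I -> X -> k) :
  (forall i, ra (f i)) -> ra (fun x => \sum_(i <- s) f i x).
Proof.
move=> hf; elim: s => [|i s IH].
  rewrite (_ : (fun _ => _) = fun=> 0); first exact: regular_at_cst.
  by apply: funext => x; rewrite big_nil.
rewrite (_ : (fun _ => _) = fun x => f i x + \sum_(j <- s) f j x).
  exact: regular_at_add.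
by apply: funext => x; rewrite big_cons.
Qed.

Lemma tangent0 : D (fun=> 0) = 0.
Proof.
have [l _ _] := hD (regular_at_cst 0) (regular_at_cst 0).
have e0 : (fun=> 1 * 0 + 0) = (fun=> 0) :> (X -> k).
  by apply: funext => y; rewrite mulr0 addr0.
have := l 1; rewrite e0 mul1r => h.
by apply: (addrI (D (fun=> 0))); rewrite -h addr0.
Qed.

Lemma tangentZ c f : ra f -> D (fun x => c * f x) = c * D f.
Proof.
move=> hf; have [l _ _] := hD hf (regular_at_cst 0).
have := l c; rewrite tangent0 addr0 => <-; congr D.
by apply: funext => y; rewrite addr0.
Qed.

Lemma tangentD f g : ra f -> ra g -> D (fun x => f x + g x) = D f + D g.
Proof.
move=> hf hg; have [l _ _] := hD hf hg; have := l 1; rewrite mul1r => <-.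
by congr D; apply: funext => y; rewrite mul1r.
Qed.

Lemma tangentM f g : ra f -> ra g ->
  D (fun x => f x * g x) = D f * g x0 + f x0 * D g.
Proof. by move=> hf hg; have [_ -> _] := hD hf hg. Qed.

Lemma tangent_local f g U : ra f -> ra g -> opn sX U -> U x0 ->
  (forall x, U x -> f x = g x) -> D f = D g.
Proof. by move=> hf hg oU Ux e; have [_ _ -> //] := hD hf hg; exists U. Qed.

Lemma tangent_sum (I : Type) (s : seq I) (f : I -> X -> k) :
  (forall i, ra (f i)) ->
  D (fun x => \sum_(i <- s) f i x) = \sum_(i <- s) D (f i).
Proof.
move=> hf; elim: s => [|i s IH].
  by rewrite big_nil -[RHS]tangent0; congr D; apply: funext => x; rewrite big_nil.
rewrite big_cons -IH -tangentD //; last exact: (regular_at_sum s hf).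
by congr D; apply: funext => x; rewrite big_cons.
Qed.

End Derivations.

Lemma regular_at_comp (k : fieldType) (X Y : choiceType) (sX : fspace k X)
    (sY : fspace k Y) (s : X -> Y) x f : is_space sX -> regular_map sX sY s ->
  regular_at sY (s x) f -> regular_at sX x (f \o s).
Proof.
by move=> hX hs [U [oU Ux rf]]; have [o r] := hs _ oU; exists (s @^-1` U); split=> //; exact: r.
Qed.

Section Diagonal.
Variables (k : fieldType) (G : groupType) (sG : fspace k G).
Variable D : (G -> k) -> k.
Hypotheses (hS : ringed sG) (hD : tangent sG 1%g D).
Variables (kappa : G -> G) (a : k).
Hypotheses (kappa_reg : regular_map sG sG kappa) (kappa1 : kappa 1%g = 1%g).
Hypothesis D_kappa : forall f, regular_at sG 1%g f -> D (f \o kappa) = a * D f.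
Local Notation ra := (regular_at sG 1%g).

Definition left_slot (g : G) : G * G := (g, 1%g).
Definition right_slot (g : G) : G * G := (1%g, g).
Definition graph (g : G) : G * G := (g, kappa g).

Let oT : opn sG setT := opnT hS.
Let regT f : regular_map sG sG f <-> regular_on sG setT sG f := regular_mapE _ _ hS.

Lemma left_slot_regular : regular_map sG (prod_space sG sG) left_slot.
Proof.
apply/(regular_mapE _ _ hS)/(regular_on_pair hS); last exact: regular_on_cst.
exact: (regular_on_id hS oT).
Qed.

Lemma right_slot_regular : regular_map sG (prod_space sG sG) right_slot.
Proof.
apply/(regular_mapE _ _ hS)/(regular_on_pair hS); first exact: regular_on_cst.
exact: (regular_on_id hS oT).
Qed.

Lemma graph_regular : regular_map sG (prod_space sG sG) graph.
Proof.
apply/(regular_mapE _ _ hS)/(regular_on_pair hS); last exact/regT.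
exact: (regular_on_id hS oT).
Qed.

(** On tensors this is the Leibniz rule.  A fraction F = p / q is reduced to
    tensors by differentiating F q = p along the three maps, which agree at 1. *)
Lemma tangent_graph U F : opn (prod_space sG sG) U -> U (1%g, 1%g) ->
  reg (prod_space sG sG) U F ->
  D (F \o graph) = D (F \o left_slot) + a * D (F \o right_slot).
Proof.
move=> oU U1 rF.
have regF s : regular_map sG (prod_space sG sG) s -> s 1%g = (1%g, 1%g) -> ra (F \o s).
  by move=> hs s1; apply: (regular_at_comp hS hs); rewrite s1; exists U.
have [U1' [V1 [p [q [[oU1 oV1] [/= Ux Vx] [tp tq] q0 FE]]]]] := rF _ U1.
have tens h : tensor sG sG U1' V1 h -> forall s,
    regular_map sG (prod_space sG sG) s -> s 1%g = (1%g, 1%g) -> ra (h \o s).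
  move=> th s hs s1; apply: (regular_at_comp hS hs); rewrite s1.
  exists (U1' `*` V1); split=> //.
    move=> z Uz; exists U1', V1, (fun=> 1); split=> //; last exact: oner_neq0.
    exists 1%N, (fun _ _ => 1), (fun _ _ => 1); split=> [_|_|z'].
    - exact: (reg_cst hS).
    - exact: (reg_cst hS).
    - by rewrite big_ord1 mulr1.
  move=> z Uz; exists U1', V1, h, (fun=> 1); split=> //; last first.
  - by move=> y _ _ _; rewrite divr1.
  - exact: oner_neq0.
  - split=> //; exists 1%N, (fun _ _ => 1), (fun _ _ => 1); split=> [_|_|z'].
    + exact: (reg_cst hS).
    + exact: (reg_cst hS).
    + by rewrite big_ord1 mulr1.
have g1 : graph 1%g = (1%g, 1%g) by rewrite /graph kappa1.
have step h : tensor sG sG U1' V1 h ->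
    D (h \o graph) = D (h \o left_slot) + a * D (h \o right_slot).
  move=> [n [f [e [rf re hE]]]].
  have raf i : ra (f i) by exists U1'.
  have rae i : ra (e i) by exists V1.
  have raec i : ra (e i \o kappa).
    by apply: (regular_at_comp hS kappa_reg); rewrite kappa1.
  have sumE (s : G -> G * G) :
      h \o s = fun g => \sum_(i < n) f i (s g).1 * e i (s g).2.
    by apply: funext => g; rewrite /= hE.
  rewrite !sumE /=.
  rewrite !(tangent_sum hS hD) => [|i|i|i]; last first.
  - exact: (regular_at_mul hS (raf i) (raec i)).
  - exact: (regular_at_mul hS (raf i) (regular_at_cst _ hS _)).
  - exact: (regular_at_mul hS (regular_at_cst _ hS _) (rae i)).
  rewrite mulr_sumr -big_split /=; apply: eq_bigr => i _.
  rewrite (tangentM hD (raf i) (raec i)) /= kappa1 (D_kappa (rae i)).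
  rewrite (tangentZ hS hD _ (rae i)).
  rewrite (_ : (fun x => f i x * e i 1%g) = fun x => e i 1%g * f i x).
    by rewrite (tangentZ hS hD _ (raf i)); ring.
  by apply: funext => x; rewrite mulrC.
have oW : opn (prod_space sG sG) [set y | (U1' `*` V1) y /\ q y != 0].
  move=> y [hy qy]; exists U1', V1, q; split=> //.
have Leib s : regular_map sG (prod_space sG sG) s -> s 1%g = (1%g, 1%g) ->
    D (p \o s) = D (F \o s) * q (1%g, 1%g) + F (1%g, 1%g) * D (q \o s).
  move=> hs s1.
  have -> : D (F \o s) * q (1%g, 1%g) + F (1%g, 1%g) * D (q \o s) =
      D (fun g => (F \o s) g * (q \o s) g).
    by rewrite (tangentM hD (regF s hs s1) (tens q tq s hs s1)) /= s1.
  have [oU' _] := hs _ oU; have [oW' _] := hs _ oW.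
  apply: (tangent_local hD _ _ (opnI hS oU' oW')).
  - exact: tens.
  - by apply: regular_at_mul => //; [exact: regF|exact: tens].
  - by rewrite /= s1; split.
  - by move=> g [Ug [bg qg]]; rewrite /= FE // divfK.
have := Leib _ graph_regular g1; rewrite (step p tp) (step q tq).
rewrite (Leib _ left_slot_regular erefl) (Leib _ right_slot_regular erefl) => e.
apply: (mulIf q0); apply: (addIr (F (1%g, 1%g) *
  (D (q \o left_slot) + a * D (q \o right_slot)))).
by rewrite -e; ring.
Qed.

End Diagonal.

(** * Equivariant bundles *)

Lemma Tagged_inj (I : eqType) (F : I -> eqType) (x : I) (v w : F x) :
  Tagged F v = Tagged F w -> v = w.
Proof. by move=> /eqP; rewrite eq_Tagged => /eqP. Qed.

Lemma Tagged_as_eq (I : eqType) (F : I -> Type) (x : I) (v : F x) (z : {i & F i}) :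
  tag z = x -> Tagged F (tagged_as (Tagged F v) z) = z.
Proof. by case: z => y w /= ey; subst x; rewrite tagged_asE. Qed.

Lemma Tagged_lin (k : fieldType) (X : choiceType) (E : X -> vectType k) x y
    (v w : E x) (v' w' : E y) a :
  Tagged E v = Tagged E v' -> Tagged E w = Tagged E w' ->
  Tagged E (a *: v + w) = Tagged E (a *: v' + w').
Proof.
move=> ev; have exy : x = y by exact: (congr1 (@tag _ _) ev).
by case: y / exy v' w' ev => v' w' /Tagged_inj -> /Tagged_inj ->.
Qed.

Section Equivariant.
Variables (k : closedFieldType) (G : groupType) (sG : fspace k G).
Variables (X : choiceType) (sX : fspace k X) (act : G * G -> X -> X) (e : X).
Variables (E : X -> vectType k) (sE : fspace k (total_space E)).
Variable actE : forall g x, E x -> E (act g x).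
Variables (T : set G) (d : nat) (phi : 'rV[k]_d -> G).
Hypotheses (hG : linear_algebraic_group sG) (hT : torus_chart sG T phi).
Hypotheses (hX : variety sX) (hE : equivariant_bundle sG sX sE actE).
Hypothesis stab : forall g, act (g, g) e = e.

Local Notation total := (total_space E).
Local Notation over U := [set z : total | U (tag z)].
Local Notation A := (tot_act actE).
Local Notation line := (affine_line k).
Local Notation fa := (fiber_act (e := e) actE).
Local Notation filt := (fiber_filt phi (e := e) sE actE).

Let hB : vector_bundle sX sE := eb_bundle hE.
Let hsE : is_space sE := proj1 hB.
Let hS : ringed sG := group_ringed hG.
Let hL : ringed line := affine_space_ringed _.

Lemma totM g h z : A (g * h)%g z = A g (A h z).
Proof. exact: (act_mul (eb_action hE)). Qed.

Lemma tot1 z : A 1%g z = z.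
Proof. exact: (act_one (eb_action hE)). Qed.

Lemma tot_scale g a z : A g (scale_tot a z) = scale_tot a (A g z).
Proof.
by rewrite /tot_act /scale_tot /= (linear_scale _ _ (eb_linear hE g (x := tag z))).
Qed.

(** The transport hidden in fiber_act is invisible in the total space. *)
Lemma fiber_actE g v : Tagged E (fa g v) = A (g, g) (Tagged E v).
Proof.
exact/Tagged_as_eq/stab.
Qed.

Lemma act_regular Z (sZ : fspace k Z) N (a b : Z -> G) (f : Z -> total) :
  ringed sZ -> regular_on sZ N sG a -> regular_on sZ N sG b ->
  regular_on sZ N sE f -> regular_on sZ N sE (fun z => A (a z, b z) (f z)).
Proof.
move=> hZ ha hb hf.
have hab := regular_on_pair hZ (regular_on_pair hZ ha hb) hf.
exact: (regular_on_comp hab (act_morph (eb_action hE))).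
Qed.

Lemma cochar_regular tau :
  regular_on line [set t : k^o | t != 0] sG (cochar phi tau).
Proof.
rewrite (_ : cochar phi tau = phi \o (fun t : k^o => \row_i (t : k) ^ tau 0 i)) //.
apply: (chart_regular hT hL (@punctured_opn k)); last by move=> t; exact: gm_cochar.
move=> j; apply: (reg_eq hL (@punctured_opn k) (h := fun t : k^o => (t : k) ^ tau 0 j)).
  by move=> t _; rewrite mxE.
by apply: (reg_exprz hL) => //; [exact: punctured_opn|exact: reg_line_id].
Qed.

(** Away from 0 the curve is regular because the action and the powers of t
    are, so an extension near 0 suffices. *)
Lemma filt_intro tau n v N (f : k^o -> total) : N 0 -> regular_on line N sE f ->
  (forall t : k, N t -> t != 0 ->
     f t = scale_tot (t ^ (- n)) (A (1%g, cochar phi tau t) (Tagged E v))) ->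
  filt tau n v.
Proof.
move=> N0 hf fE.
pose c (t : k^o) : total := if (t : k) == 0 then f 0 else
   scale_tot ((t : k) ^ (- n)) (A (1%g, cochar phi tau t) (Tagged E v)).
exists c; last by move=> t /negPf t0; rewrite /c t0.
apply/(regular_mapE _ _ hL)/(regular_on_local hL); first exact: (opnT hL).
move=> t _; have [t0|t0] := eqVneq (t : k) 0.
  exists N; split=> //; first by rewrite t0.
  apply: (regular_on_eq hL hf) => s Ns; rewrite /c.
  by case: eqVneq => [->//|s0]; exact: fE.
exists [set t : k^o | t != 0]; split=> //.
have oP := @punctured_opn k.
have h1 : regular_on line [set t : k^o | t != 0] sE
    (fun t => A (1%g, cochar phi tau t) (Tagged E v)).
  apply: act_regular => //; [exact: regular_on_cst|exact: cochar_regular|].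
  exact: regular_on_cst.
have h2 : reg line [set t : k^o | t != 0] (fun t : k^o => (t : k) ^ (- n)).
  by apply: (reg_exprz hL) => //; exact: reg_line_id.
apply: (regular_on_eq hL (scale_regular hX hB hL h1 h2)) => s /negPf s0.
by rewrite /c s0.
Qed.

(** (1, tau)(g, g) = (g, tau g tau^-1)(1, tau), and tau g tau^-1 has a limit. *)
Lemma filt_parabolic tau n g v : parabolic sG phi tau g ->
  filt tau n v -> filt tau n (fa g v).
Proof.
move=> [c' hc' c'E] [c hc cE].
have h : regular_on line setT sE (fun t => A (g, c' t) (c t)).
  apply: act_regular => //; last exact/(regular_mapE _ _ hL).
    by apply: regular_on_cst => //; exact: (opnT hL).
  exact/(regular_mapE _ _ hL).
apply: (filt_intro _ h) => // t _ t0.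
have -> : c t = scale_tot (t ^ (- n)) (A (1%g, cochar phi tau t) (Tagged E v)).
  exact: cE.
rewrite tot_scale fiber_actE -!totM c'E //; congr (scale_tot _ (A _ _)).
by congr pair; rewrite ?mulg1 ?mul1g // mulgVK.
Qed.

Section Trivialized.
Variables (U : set X) (r : nat) (psi : forall y, 'rV[k]_r -> E y).
Variable kap : total -> 'rV[k]_r.
Hypothesis tr : trivialization sX sE U psi kap.

Lemma kap_lin y (v w : E y) a : U y ->
  kap (Tagged E (a *: v + w)) = a *: kap (Tagged E v) + kap (Tagged E w).
Proof.
move=> Uy; have K (x : E y) : psi y (kap (Tagged E x)) = x by exact: (tr_VK tr (z := Tagged E x)).
by rewrite -{1}(K v) -{1}(K w) -(tr_lin tr Uy) (tr_K tr).
Qed.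

Lemma kap_scale a z : U (tag z) -> kap (scale_tot a z) = a *: kap z.
Proof.
move=> Uz; have := kap_lin (tagged z) 0 a Uz; rewrite addr0 => ->.
have := kap_lin (0 : E (tag z)) 0 1 Uz; rewrite scale1r addr0 scale1r.
move=> /eqP; rewrite addrC -subr_eq subrr => /eqP <-.
by rewrite addr0 tagged_eta.
Qed.

Lemma tr_tagged z : U (tag z) -> Tagged E (psi (tag z) (kap z)) = z.
Proof. by move=> Uz; rewrite (tr_VK tr Uz) tagged_eta. Qed.

Lemma tr_fiber y (v : E y) : U y -> psi y (kap (Tagged E v)) = v.
Proof. by move=> Uy; exact: (tr_VK tr (z := Tagged E v)). Qed.

Lemma kap_regular Z (sZ : fspace k Z) N f i : regular_on sZ N sE f ->
  N `<=` f @^-1` over U -> reg sZ N (fun z => kap (f z) 0 i).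
Proof. by move=> hf sub; exact: (regular_on_reg hf (tr_over tr) (tr_reg tr i)). Qed.

End Trivialized.

Lemma fiber_rational : rational_module sG fa.
Proof.
split.
- move=> g a v w; apply: (@Tagged_inj _ (fun x => E x : eqType)).
  rewrite fiber_actE; rewrite /tot_act /= (eb_linear hE).
  by apply: Tagged_lin; rewrite fiber_actE.
- move=> v; apply: (@Tagged_inj _ (fun x => E x : eqType)).
  by rewrite fiber_actE tot1.
- move=> g h v; apply: (@Tagged_inj _ (fun x => E x : eqType)).
  by rewrite !fiber_actE -totM.
- move=> u v.
  have [U [r [psi [kap [Ue tr]]]]] := trivialization_exists hX hB e.
  have oT := opnT hS.
  have hf : regular_on sG setT sE (fun g => A (g, g) (Tagged E v)).
    apply: (act_regular hS); try exact: (regular_on_id hS oT).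
    exact: regular_on_cst.
  have hk i : reg sG setT (fun g => kap (A (g, g) (Tagged E v)) 0 i).
    by apply: (kap_regular tr _ hf) => g _ /=; rewrite stab.
  have lu : linear (u \o psi e : 'rV[k]_r -> k^o).
    by move=> a x y; rewrite /= (tr_lin tr Ue) linearP.
  have := polyfun_reg_comp (f := fun g => kap (A (g, g) (Tagged E v))) hS oT _
    (polyfun_lin lu).
  move=> h; apply: (reg_eq hS oT (h := _)) (h _) => [g _|w].
    by rewrite /= -fiber_actE (tr_fiber tr).
  rewrite (_ : (fun _ => _) = fun g =>
    \sum_j kap (A (g, g) (Tagged E v)) 0 j * (w (delta_mx 0 j) : k)).
    apply: (reg_sum _ hS oT) => j; apply: (reg_mul hS) => //.
    exact: (reg_cst hS).
  by apply: funext => g; rewrite hom_rowE.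
Qed.

(** The diagonal of X is closed, so f and g differ on an open set, which would
    meet the locus where q does not vanish. *)
Lemma separated_ext (W : vectType k) (f g : W -> X) q w0 :
  regular_map (affine_space W) sX f -> regular_map (affine_space W) sX g ->
  polyfun q -> q w0 != 0 -> (forall w, q w != 0 -> f w = g w) ->
  forall w, f w = g w.
Proof.
move=> hf hg hq qw0 fg w; apply: contrapT => ne.
have hW := affine_space_ringed W.
have [_ /(_ _ (variety_separated hX)) [o _]] :=
  regular_on_pair hW (proj1 (regular_mapE _ _ hW) hf) (proj1 (regular_mapE _ _ hW) hg).
have [p [hp pw pO]] := o w (conj I ne).
have [s [ps qs]] := polyfun_dense hp hq pw qw0.
by have [_ []] := pO _ ps; exact: fg.
Qed.

Lemma tag_map_regular Z (sZ : fspace k Z) (c : Z -> total) : is_space sZ ->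
  regular_map sZ sE c -> regular_map sZ sX (fun z => tag (c z)).
Proof.
move=> hZ hc; apply/(regular_mapE _ _ hZ).
apply: (regular_on_comp (proj1 (regular_mapE _ _ hZ) hc)).
exact: (proj2 (regular_mapE sX (@tag _ _) hsE) (tag_regular hX hB)).
Qed.

Section Transversality.
Variables (tau a : 'rV[int]_d) (D : (G -> k) -> k).
Hypothesis hD : root_space sG phi a D.
Hypothesis neg : dot tau a < 0.

Let conjt (t : k) (g : G) := (cochar phi tau t * g * (cochar phi tau t)^-1)%g.

Lemma tangent_lie_act (l : E e -> k^o) v : linear l ->
  D (fun g => l (fa g v)) = l (lie_act fa D v).
Proof.
move=> hl.
have hr (i : 'I_(\dim {:E e})) : regular_at sG 1%g
    (fun g => coord (vbasis {:E e}) i (fa g v)).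
  exists setT; split=> //; first exact: (opnT hS).
  pose ci (x : E e) : k^o := coord (vbasis {:E e}) i x.
  have cl : linear ci by move=> b x y; rewrite /ci linearP.
  pose cL : {linear E e -> k^o} :=
    HB.pack ci (GRing.isLinear.Build k (E e) k^o *:%R ci cl).
  have := rational_reg fiber_rational (linfun cL) v.
  by apply: (reg_eq hS (opnT hS)) => g _; rewrite lfunE.
pose fL : {linear E e -> k^o} := HB.pack l (GRing.isLinear.Build k (E e) k^o *:%R l hl).
have lE x : l x = \sum_(i < \dim {:E e}) l (vbasis {:E e})`_i * coord (vbasis {:E e}) i x.
  rewrite [in LHS](coord_vbasis (memvf x)) -[l]/(fL : _ -> _) linear_sum.
  by apply: eq_bigr => i _; rewrite linearZ_LR /= mulrC.
have hDt : tangent sG 1%g D by case: hD.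
rewrite (_ : (fun g => l (fa g v)) = fun g => \sum_(i < \dim {:E e}) l (vbasis {:E e})`_i *
   coord (vbasis {:E e}) i (fa g v)); last by apply: funext => g; rewrite lE.
rewrite (tangent_sum hS hDt); last first.
  move=> i; apply: (regular_at_mul hS) => //; exact: (regular_at_cst _ hS).
rewrite /lie_act -[l]/(fL : _ -> _) linear_sum; apply: eq_bigr => i _.
by rewrite (tangentZ hS hDt) // linearZ_LR /= mulrC.
Qed.

(** Differentiating (g, h) c(t) along D in one slot keeps it regular in t,
    because locally its coordinates are quotients of sums of products of a
    function of (g, h) and a function of t. *)
Lemma transversality_coord (c : k^o -> total) U r psi kap i :
  @trivialization _ _ sX _ sE U r psi kap -> regular_map line sE c ->
  U (tag (c 0)) ->
  exists N R1 R2, [/\ opn line N, N 0, reg line N R1, reg line N R2 &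
    forall t, N t -> t != 0 ->
      D (fun g => kap (A (g, conjt t g) (c t)) 0 i) = R1 t + t ^ dot tau a * R2 t].
Proof.
move=> tr hc U0.
have [hDt hDc] := hD.
have hDt' : tangent sG 1%g D by [].
have [oO rO] := act_morph (eb_action hE) (tr_over tr).
pose O := (fun z : (G * G) * total => A z.1 z.2) @^-1` over U.
have OE (h : G * G) t : h = 1%g -> U (tag (c t)) -> O (h, c t).
  by move=> -> Ut; change (U (tag (A 1%g (c t)))); rewrite tot1.
have O1 : O (1%g, c 0) by exact: OE.
have [U0' [V0 [p [q [[oU0 oV0] [/= Ug Vc] [tp tq] q0 FE]]]]] :=
  rO _ (tr_reg tr i) _ O1.
have [n [f [b [rf rb pE]]]] := tp; have [n' [f' [b' [rf' rb' qE]]]] := tq.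
have oV := opnI hsE oV0 (tr_over tr).
have [oN1 _] := hc _ oV.
have regN1 h : reg sE V0 h -> reg line (c @^-1` (V0 `&` over U)) (h \o c).
  move=> rh; have [_ r'] := hc _ oV; apply: r'.
  by apply: (reg_restrict hsE oV0 oV) => // z [].
have rq1 : reg line (c @^-1` (V0 `&` over U)) (fun t => q (1%g, c t)).
  apply: (reg_eq hL oN1 (h := fun t => \sum_(l < n') f' l 1%g * (b' l \o c) t)).
    by move=> t _; rewrite qE.
  apply: (@reg_sum _ _ _ _ _ _ (fun l t => f' l 1%g * (b' l \o c) t)) => // l.
  by apply: (reg_mul hL) => //; [exact: reg_cst|exact: regN1].
have oN := opn_neq0 hL oN1 rq1; set N := _ `&` _ in oN.
have NN1 : N `<=` c @^-1` (V0 `&` over U) by move=> t [].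
pose F1 t := kap (c t) 0 i.
have rF1 : reg line N F1.
  apply: (kap_regular tr _ (N := N)); last by move=> t [[]].
  apply: (regular_on_restrict hL (N := setT)) => //.
  exact: (proj1 (regular_mapE _ _ hL)).
pose R s t := (\sum_(l < n) b l (c t) * D (f l \o s) -
  F1 t * \sum_(l < n') b' l (c t) * D (f' l \o s)) / q (1%g, c t).
have rN h : reg sE V0 h -> reg line N (h \o c).
  by move=> rh; exact: (reg_restrict hL oN1 oN NN1 (regN1 _ rh)).
have rR s : reg line N (R s).
  have rlin m (x : 'I_m -> (G * G -> k)) (y : 'I_m -> total -> k) :
      (forall l, reg sE V0 (y l)) ->
      reg line N (fun t => \sum_(l < m) y l (c t) * D (x l \o s)).
    move=> ry; apply: (@reg_sum _ _ _ _ _ _ (fun l t => y l (c t) * D (x l \o s))) => // l.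
    by apply: (reg_mul hL) => //; [exact: (rN _ (ry l))|exact: reg_cst].
  apply: (reg_mul hL) => //; last first.
    apply: (reg_inv hL) => //; last by move=> t [].
    exact: (reg_restrict hL oN1 oN NN1 rq1).
  apply: (reg_eq hL oN (h := fun t => \sum_(l < n) b l (c t) * D (f l \o s) +
    (-1) * (F1 t * \sum_(l < n') b' l (c t) * D (f' l \o s)))).
    by move=> t _; rewrite mulN1r.
  apply: (reg_add hL) => //; first exact: rlin.
  apply: (reg_mul hL) => //; first exact: reg_cst.
  by apply: (reg_mul hL) => //; exact: rlin.
have oW : opn (prod_space (prod_space sG sG) sE)
    [set y | (U0' `*` V0) y /\ q y != 0].
  by move=> y [hy qy]; exists U0', V0, q; split.
have main s t : regular_map sG (prod_space sG sG) s -> s 1%g = 1%g -> N t ->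
    D (fun g => kap (A (s g) (c t)) 0 i) = R s t.
  move=> hs s1 [[Vt Ut] qt].
  have oT := opnT hS.
  have hst : regular_on sG setT (prod_space (prod_space sG sG) sE)
      (fun g => (s g, c t)).
    apply: (regular_on_pair hS); first exact: (proj1 (regular_mapE _ _ hS)).
    exact: regular_on_cst.
  have [oO' rO'] := proj2 hst _ oO.
  have [oW' _] := proj2 hst _ oW.
  have st1 : (s 1%g, c t) = (1%g, c t) by rewrite s1.
  have raf m (x : 'I_m -> (G * G -> k)) l : (forall l, reg (prod_space sG sG) U0' (x l)) ->
      regular_at sG 1%g (x l \o s).
    by move=> rx; apply: (regular_at_comp hS hs); rewrite s1; exists U0'.
  pose P m (x : 'I_m -> (G * G -> k)) (y : 'I_m -> total -> k) g :=
    \sum_(l < m) y l (c t) * (x l \o s) g.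
  have raP m x y : (forall l, reg (prod_space sG sG) U0' (x l)) ->
      regular_at sG 1%g (@P m x y).
    move=> rx; apply: (regular_at_sum hS) => l.
    by apply: (regular_at_mul hS); [exact: regular_at_cst|exact: raf].
  have DP m x y : (forall l, reg (prod_space sG sG) U0' (x l)) ->
      D (@P m x y) = \sum_(l < m) y l (c t) * D (x l \o s).
    move=> rx; rewrite (tangent_sum hS hDt'); last first.
      by move=> l; apply: (regular_at_mul hS); [exact: regular_at_cst|exact: raf].
    by apply: eq_bigr => l _; rewrite (tangentZ hS hDt') //; exact: raf.
  have PE g : @P n f b g = p (s g, c t).
    by rewrite pE; apply: eq_bigr => l _; rewrite mulrC.
  have QE g : @P n' f' b' g = q (s g, c t).
    by rewrite qE; apply: eq_bigr => l _; rewrite mulrC.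
  have raF : regular_at sG 1%g (fun g => kap (A (s g) (c t)) 0 i).
    exists (setT `&` (fun g => (s g, c t)) @^-1` O); split=> //.
      by split=> //; exact: OE.
    exact: (rO' _ (rO _ (tr_reg tr i))).
  have e1 : D (@P n f b) = D (fun g => kap (A (s g) (c t)) 0 i) * q (1%g, c t) +
      F1 t * D (@P n' f' b').
    rewrite (_ : q (1%g, c t) = @P n' f' b' 1%g); last by rewrite QE s1.
    rewrite (_ : F1 t = kap (A (s 1%g) (c t)) 0 i); last by rewrite s1 tot1.
    rewrite -(tangentM hDt' raF (raP _ _ _ rf')).
    apply: (tangent_local hDt' _ _ (opnI hS oO' oW')).
    - exact: raP.
    - by apply: (regular_at_mul hS) => //; exact: raP.
    - by split; split=> //; [exact: OE|rewrite /= s1].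
    - move=> g [[_ Og] [_ [bg qg]]]; rewrite PE QE.
      by have := FE _ Og bg qg; rewrite /= => ->; rewrite divfK.
  by rewrite /R -DP // -DP // e1 addrK mulfK.
exists N, (R (@left_slot G)), (R (@right_slot G)); split.
- exact: oN.
- by split.
- exact: rR.
- exact: rR.
move=> t Nt t0.
have cr : regular_map sG sG (conjt t) by exact: translate_regular.
have c1 : conjt t 1%g = 1%g by rewrite /conjt mulg1 mulgV.
have Dc h : regular_at sG 1%g h -> D (h \o conjt t) = t ^ dot tau a * D h.
  move=> rh; rewrite -chi_cochar // -hDc //; exact: gm_cochar.
have gE h : reg (prod_space sG sG) U0' h -> D (h \o graph (conjt t)) =
    D (h \o @left_slot G) + t ^ dot tau a * D (h \o @right_slot G).
  by move=> rh; apply: (tangent_graph hS hDt' cr c1 Dc oU0).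
have g1 : graph (conjt t) 1%g = 1%g by rewrite /graph c1.
rewrite (main _ t (graph_regular hS cr) g1 Nt) /R.
under eq_bigr => l _ do rewrite gE // mulrDr mulrCA.
under [X in _ - _ * X]eq_bigr => l _ do rewrite gE // mulrDr mulrCA.
rewrite !big_split /= -!mulr_sumr.
by rewrite mulrA -mulrDl; congr (_ / _); ring.
Qed.

(** Near 0 the curve attached to D v is built from its coordinates, which are
    those of transversality_coord multiplied by a positive power of t. *)
Lemma filt_transversal n v : filt tau n v -> filt tau (n + dot tau a) (lie_act fa D v).
Proof.
move=> [c hc cE].
have {}cE (t : k) : t != 0 ->
    c t = scale_tot (t ^ (- n)) (A (1%g, cochar phi tau t) (Tagged E v)) by exact: cE.
have [U [r [psi [kap [U0 tr]]]]] := trivialization_exists hX hB (tag (c 0)).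
have /choice [N /choice [R1 /choice [R2 hR]]] : forall i, exists N R1 R2,
    [/\ opn line N, N 0, reg line N R1, reg line N R2 &
    forall t, N t -> t != 0 ->
      D (fun g => kap (A (g, conjt t g) (c t)) 0 i) = R1 t + t ^ dot tau a * R2 t].
  by move=> i; exact: (transversality_coord i tr hc U0).
have oU : opn line (c @^-1` over U) by have [] := hc _ (tr_over tr).
have [M [oM M0 MN]] := @opn_common _ _ _ hL _ (fun i => N i) (0 : k^o)
  (fun i => let: And5 oN N0 _ _ _ := hR i in conj oN N0).
have oM' := opnI hL oM oU; set M' := M `&` _ in oM'.
pose b : nat := `|dot tau a|%N.
have bE : dot tau a = - (b%:Z) by rewrite /b; case: (dot tau a) neg.
pose w (t : k^o) : 'rV[k]_r := \row_i ((t : k) ^+ b * R1 i t + R2 i t).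
pose f (t : k^o) : total := Tagged E (psi (tag (c t)) (w t)).
have hf : regular_on line M' sE f.
  apply: (tr_section tr hL); last 2 first.
  - by move=> t [].
  - move=> i; have [oN _ r1 r2 _] := hR i.
    have sub : M' `<=` N i by move=> t [/MN].
    apply: (reg_eq hL oM' (h := fun t => (t : k) ^+ b * R1 i t + R2 i t)).
      by move=> t _; rewrite mxE.
    apply: (reg_add hL) => //; last exact: (reg_restrict hL oN).
    apply: (reg_mul hL) => //; last exact: (reg_restrict hL oN).
    by apply: (reg_exprn hL) => //; exact: reg_line_id.
  have htag := proj2 (regular_mapE sX (@tag _ _) hsE) (tag_regular hX hB).
  apply: (regular_on_restrict hL _ oM' (N := setT)) => //.
  exact: (regular_on_comp (proj1 (regular_mapE _ _ hL) hc) htag).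
apply: (filt_intro (N := M') (f := f)) => //.
move=> t [Mt Ut] t0.
set z := A (1%g, cochar phi tau t) _.
have tz : tag (c t) = tag z by rewrite cE.
have Uz : U (tag z) by rewrite -tz.
rewrite /f tz -[RHS](tr_tagged tr) //; congr (Tagged E (psi _ _)).
apply/rowP => i; rewrite mxE (kap_scale tr) // !mxE.
have [_ _ _ _ hDE] := hR i; have {hDE} := hDE t (MN i t Mt) t0.
pose l (x : E e) : k^o :=
  kap (scale_tot (t ^ (- n)) (A (1%g, cochar phi tau t) (Tagged E x))) 0 i.
have ll : linear l.
  move=> s x y; rewrite /l !(kap_scale tr) //.
  rewrite {1}/tot_act /= (eb_linear hE) (kap_lin tr) //.
  by rewrite !mxE mulrDr mulrCA.
have -> : (fun g => kap (A (g, conjt t g) (c t)) 0 i) = fun g => l (fa g v).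
  apply: funext => g; rewrite /l cE // tot_scale fiber_actE -!totM.
  by congr (kap (scale_tot _ (A _ _)) 0 i); congr pair;
    rewrite ?mulg1 ?mul1g // /conjt mulgVK.
rewrite tangent_lie_act // /l (kap_scale tr) // mxE => e1.
rewrite opprD expfzDr // mulrAC e1 [RHS]mulrC mulrDr mulrA -expfzDr // addNr expr0z mul1r.
by rewrite bE opprK.
Qed.

End Transversality.

End Equivariant.

(** * Curves in toric charts *)

Section Theta.
Variables (k : fieldType) (p d : nat) (tau : 'I_p -> 'rV[int]_d).
Implicit Types x y : 'rV[k]_p.

(** The homomorphism of tori with cocharacters tau. *)
Definition theta x : 'rV[k]_d := \row_i chi (\row_j tau j 0 i) x.

Lemma theta_gm x : gm x -> gm (theta x).
Proof. by move=> hx i; rewrite mxE chi_neq0. Qed.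

Lemma thetaM x y : theta (gm_mul x y) = gm_mul (theta x) (theta y).
Proof. by apply/rowP => i; rewrite !mxE chiM. Qed.

Lemma chi_theta m x : gm x -> chi m (theta x) = \prod_j x 0 j ^ dot (tau j) m.
Proof.
move=> hx.
have prodz (a : 'I_p -> k) (n : int) : (\prod_j a j) ^ n = \prod_j a j ^ n.
  by rewrite (big_morph (fun y : k => y ^ n) (fun b c => expfzMl b c n) (exp1rz k n)).
rewrite [LHS]/chi; under eq_bigr => i _ do rewrite mxE /chi prodz.
rewrite exchange_big; apply: eq_bigr => j _; rewrite /dot expz_sum //.
by apply: eq_bigr => i _; rewrite mxE exprz_exp.
Qed.

Lemma gm_opn : opn (affine_space 'rV[k]_p) (@gm k p).
Proof.
rewrite (_ : @gm k p = [set x | \prod_j x 0 j != 0]).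
  exact/opn_polyfun/gm_polyfun.
by apply/seteqP; split=> x /gmP.
Qed.

Lemma chi_reg N (m : 'rV[int]_p) : opn (affine_space 'rV[k]_p) N ->
  N `<=` @gm k p -> reg (affine_space 'rV[k]_p) N (chi m).
Proof.
move=> oN sub; have hA := affine_space_ringed 'rV[k]_p.
apply: (@reg_bigprod _ _ _ hA _ _ _ (fun i (x : 'rV[k]_p) => x 0 i ^ m 0 i)) => // i.
apply: (reg_exprz hA) => //; first exact/reg_polyfun/polyfun_coord.
by move=> x /sub.
Qed.

End Theta.

Lemma dot_real (R : realType) d (t m : 'rV[int]_d) :
  dot (real_vec R t) (real_vec R m) = (dot t m)%:~R.
Proof.
rewrite /dot rmorph_sum; apply: eq_bigr => i _.
by rewrite !mxE rmorphM.
Qed.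

(** A toric chart is a closed subset of an affine space whose coordinates are
    combinations of characters that are nonnegative on the cone; along the
    cocharacters tau these are polynomials. *)
Lemma toric_curve (k : closedFieldType) (R : realType) (d p : nat)
    (tau : 'I_p -> 'rV[int]_d) (Y : choiceType) (sY : fspace k Y)
    (aY : 'rV[k]_d -> Y -> Y) (y0 : Y) (s : set 'rV[R]_d) (U : set Y) :
  is_space sY -> toric_chart sY aY y0 s U -> (forall j, s (real_vec R (tau j))) ->
  exists2 f : 'rV[k]_p -> Y, regular_map (affine_space 'rV[k]_p) sY f &
    forall x, gm x -> f x = aY (theta tau x) y0.
Proof.
move=> hY hU hs; have [W [i [emb clo]]] := tc_affine hU.
have hA := affine_space_ringed 'rV[k]_p.
pose L := \dim {:W}.
pose lift y (h : U y) : set_type U := exist _ y (mem_set h).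
pose u (l : 'I_L) (y : Y) : k := if pselect (U y) is left h
  then coord (vbasis {:W}) l (i (lift y h)) else 0.
have uE l (z : set_type U) : u l (set_val z) = coord (vbasis {:W}) l (i z).
  rewrite /u; case: pselect => [h|[]]; last exact: set_valP.
  by congr (coord _ _ (i _)); apply: val_inj.
have ru l : reg sY U (u l).
  have r1 : reg (pull (affine_space W) i) setT (fun z => coord (vbasis {:W}) l (i z)).
    move=> z _; exists setT, (coord (vbasis {:W}) l); split=> //.
      exact: (opnT (affine_space_space W)).
    by apply/reg_polyfun/polyfun_lin => a x y; rewrite linearP.
  have [_ eo er] := emb.
  have oT : opn (sub_space sY U) setT by exact: (opnT (pull_space _ hY)).
  have r2 := proj2 (er _ oT _) r1.
  apply: (reg_glue hY (tc_open hU)) => y Uy.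
  have [V [g [oV Vy rg hg]]] := r2 (lift y Uy) I.
  have o := opnI hY (tc_open hU) oV.
  exists (U `&` V); split=> //.
  apply: (reg_eq hY o (h := g)); last by apply: (reg_restrict hY oV o) => // z [].
  move=> z [Uz Vz]; rewrite -(hg (lift z Uz)) //.
  by rewrite -uE.
have /choice [P hP] : forall l, exists P : 'rV[k]_p -> k, polyfun P /\
    forall x, gm x -> u l (aY (theta tau x) y0) = P x.
  move=> l; have [n [c [m [hm cE]]]] := tc_span hU (ru l).
  have dm i' j : 0 <= dot (tau j) (m i').
    by have := hm i' _ (hs j); rewrite dot_real ler0z.
  exists (fun x => \sum_i c i * \prod_j x 0 j ^+ `|dot (tau j) (m i)|%N); split.
    apply: polyfun_sum => i'; apply: Polyfun_mul; first exact: Polyfun_const.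
    apply: polyfun_prod => j; apply: polyfun_exp; exact: polyfun_coord.
  move=> x hx; rewrite cE; last exact: theta_gm.
  apply: eq_bigr => i' _; congr (_ * _); rewrite chi_theta //.
  apply: eq_bigr => j _; have := dm i' j.
  by case: (dot _ _) => // n' _.
pose Pw (x : 'rV[k]_p) : W := \sum_l P l x *: (vbasis {:W})`_l.
have PwE x (hx : gm x) (Uy : U (aY (theta tau x) y0)) :
    i (lift _ Uy) = Pw x.
  rewrite [LHS](coord_vbasis (memvf _)); apply: eq_bigr => l _.
  by rewrite -uE /= -(proj2 (hP l)).
have stable x : gm x -> U (aY (theta tau x) y0).
  move=> hx; apply: (tc_stable hU); [exact: theta_gm|exact: (tc_base hU)].
have Pwlin (v : 'Hom(W, k^o)) : polyfun (fun x => v (Pw x) : k).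
  rewrite (_ : (fun _ => _) = fun x => \sum_l P l x * (v (vbasis {:W})`_l : k)).
    by apply: polyfun_sum => l; apply: Polyfun_mul; [case: (hP l)|exact: Polyfun_const].
  by apply: funext => x; rewrite linear_sum; apply: eq_bigr => l _; rewrite linearZ.
have /choice [g gE] : forall x, exists z, i z = Pw x.
  move=> x; apply: contrapT => nr.
  have [|q [hq qx qO]] := clo (Pw x); first by move=> [z _ zE]; apply: nr; exists z.
  have [x' [gx' qx']] := polyfun_dense (@gm_polyfun k p) (polyfun_comp Pwlin hq)
    (proj1 (gmP _) (@gm_one k p)) qx.
  apply: (qO _ qx').
  by exists (lift _ (stable x' (proj2 (gmP _) gx'))) => //; exact: PwE (proj2 (gmP _) gx') _.
exists (fun x => set_val (g x)).
  have h1 : regular_on (affine_space 'rV[k]_p) setT (sub_space sY U) g.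
    apply: (regular_on_embedding hA emb); rewrite (_ : i \o g = Pw); last exact: funext.
    apply: (regular_on_affine hA); first exact: (opnT hA).
    by move=> v; apply: reg_polyfun; exact: Pwlin.
  apply/(regular_mapE _ _ hA); exact: (regular_on_comp h1 (@pull_regular _ _ _ sY _)).
move=> x hx; have [inj _ _] := emb.
have -> : g x = lift _ (stable x hx) by apply: inj; rewrite gE PwE.
by [].
Qed.

(** * Bases adapted to the filtrations of a cone *)

Lemma mul_row_linear (k : fieldType) r s (f : 'rV[k]_r -> 'rV[k]_s) w :
  linear f -> w *m \matrix_(i < r) f (delta_mx 0 i) = f w.
Proof.
move=> hf.
pose fL : {linear 'rV[k]_r -> 'rV[k]_s} :=
  HB.pack f (GRing.isLinear.Build k _ _ *:%R f hf).
rewrite mulmx_sum_row -[f]/(fL : _ -> _) [in RHS](row_sum_delta w) linear_sum.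
by apply: eq_bigr => i _; rewrite linearZ_LR rowK.
Qed.

Lemma reg_origin (k : fieldType) p N (a : 'rV[k]_p -> k) :
  opn (affine_space 'rV[k]_p) N -> N 0 -> reg (affine_space 'rV[k]_p) N a ->
  regular_at_origin a.
Proof.
move=> oN N0 ra; have [P [Q [hP hQ Q0 aE]]] := ra _ N0.
have [u [hu u0 uN]] := oN _ N0.
apply: (@origin_eq _ _ (fun x => P x * (Q x)^-1) _ (fun x => u x * Q x)).
- exists P, Q; split=> //.
- exact: Polyfun_mul.
- by rewrite mulf_neq0.
- move=> x hx; rewrite mulf_eq0 negb_or => /andP [ux Qx].
  by rewrite aE //; exact: uN.
Qed.

(** A family of regular functions has a common denominator near a point; it
    clears the denominators on all of N, since regular functions that agree on
    a dense subset are equal. *)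
Lemma reg_clear (k : closedFieldType) (W : vectType k) (I : finType)
    (a : I -> W -> k) N w0 : opn (affine_space W) N -> N w0 ->
  (forall i, reg (affine_space W) N (a i)) ->
  exists h Q, [/\ polyfun h, h w0 != 0, forall i, polyfun (Q i) &
    forall i w, N w -> h w * a i w = Q i w].
Proof.
move=> oN Nw0 ra; have hW := affine_space_ringed W.
have /choice [P /choice [Q hPQ]] : forall i, exists P Q,
    [/\ polyfun P, polyfun Q, Q w0 != 0 &
        forall w, N w -> Q w != 0 -> a i w = P w / Q w].
  by move=> i; exact: ra.
pose h w := \prod_i Q i w.
pose Q' i w := P i w * \prod_(j | j != i) Q j w.
have hh : polyfun h by apply: polyfun_prod => i; case: (hPQ i).
have hQ' i : polyfun (Q' i).
  by apply: Polyfun_mul; [case: (hPQ i)|apply: polyfun_prod => j; case: (hPQ j)].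
have h0 : h w0 != 0 by apply/prodf_neq0 => i _; case: (hPQ i).
exists h, Q'; split=> // i w Nw.
apply/eqP; rewrite -subr_eq0; apply/eqP.
apply: (@reg_affine_ext _ _ N (fun w => h w * a i w - Q' i w) h w0) => //.
  apply: (reg_add hW) => //; first by apply: (reg_mul hW) => //; exact: reg_polyfun.
  by apply: reg_polyfun; exact: polyfun_opp.
move=> x Nx /prodf_neq0 hx; have [_ _ _ ->] := hPQ i => //; last exact: hx.
rewrite /h /Q' (bigD1 i) //=; set R := \prod_(_ | _) _.
by field; exact: hx.
Qed.

Section Adapted.
Variables (k : closedFieldType) (G : groupType) (sG : fspace k G).
Variables (X : choiceType) (sX : fspace k X) (act : G * G -> X -> X) (e : X).
Variables (E : X -> vectType k) (sE : fspace k (total_space E)).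
Variable actE : forall g x, E x -> E (act g x).
Variables (T : set G) (d : nat) (phi : 'rV[k]_d -> G).
Hypothesis hT : torus_chart sG T phi.
Hypotheses (hX : variety sX) (hact : algebraic_action sG sX act).
Hypothesis hE : equivariant_bundle sG sX sE actE.

Variables (p : nat) (tau : 'I_p -> 'rV[int]_d) (gamma : 'rV[k]_p -> X).
Local Notation affp := (affine_space 'rV[k]_p).
Local Notation line := (affine_line k).
Local Notation total := (total_space E).
Local Notation A := (tot_act actE).
Local Notation th := (theta (k := k) tau).
Definition shift (x : 'rV[k]_p) : G * G := (1%g, phi (th x)).
Definition unshift (x : 'rV[k]_p) : G * G := (1%g, phi (gm_inv (th x))).
Hypothesis gamma_reg : regular_map affp sX gamma.
Hypothesis gammaE : forall x, gm x -> gamma x = act (shift x) e.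

Let hA : ringed affp := affine_space_ringed _.
Let hB : vector_bundle sX sE := eb_bundle hE.

Lemma chart1 : phi (const_mx 1) = 1%g.
Proof.
have [_ _ hm _] := hT; have := hm _ _ (@gm_one k d) (@gm_one k d).
by rewrite gm_mul1 => h; apply: (@mulgI _ (phi (const_mx 1))); rewrite mulg1 -h.
Qed.

Lemma shiftM x y : gm x -> gm y -> shift (gm_mul x y) = (shift x * shift y)%g.
Proof.
move=> hx hy; have [_ _ hm _] := hT; rewrite /shift thetaM hm; try exact: theta_gm.
by congr pair; rewrite mulg1.
Qed.

Lemma unshiftK x : gm x -> (unshift x * shift x = 1)%g.
Proof.
move=> hx; have [_ _ hm _] := hT; have ht := theta_gm tau hx.
congr pair; first by rewrite /= mulg1.
change (phi (gm_inv (th x)) * phi (th x) = 1)%g.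
rewrite -hm //; last exact: gm_inv_gm.
by rewrite gm_mulC gm_mulV ?chart1.
Qed.

Lemma shiftK x : gm x -> (shift x * unshift x = 1)%g.
Proof.
move=> hx; have [_ _ hm _] := hT; have ht := theta_gm tau hx.
congr pair; first by rewrite /= mulg1.
change (phi (th x) * phi (gm_inv (th x)) = 1)%g.
by rewrite -hm ?gm_mulV ?chart1 //; exact: gm_inv_gm.
Qed.

Lemma unshift_regular :
  regular_on affp (@gm k p) sG (fun x => phi (gm_inv (th x))).
Proof.
rewrite (_ : (fun _ => _) = phi \o (fun x => gm_inv (th x))) //.
have oG := @gm_opn k p.
apply: (chart_regular hT hA oG); last by move=> x hx; exact/gm_inv_gm/theta_gm.
move=> j; apply: (reg_eq hA oG (h := fun x => (chi (\row_i tau i 0 j) x)^-1)).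
  by move=> x _; rewrite !mxE.
apply: (reg_inv hA) => //; last by move=> x; exact: chi_neq0.
exact: chi_reg.
Qed.

(** 0 is a fixed point of the torus acting on the affine space, so translation
    by s maps the curve to its reparametrization by s, also on the boundary. *)
Lemma gamma_shift s x : gm s -> act (shift s) (gamma x) = gamma (gm_mul s x).
Proof.
move=> hs; move: x.
apply: (separated_ext hX (f := fun x : 'rV[k]_p => act (shift s) (gamma x))
  (g := fun x : 'rV[k]_p => gamma (gm_mul s x))
  (q := fun x : 'rV[k]_p => \prod_j x 0 j) (w0 := const_mx 1)).
- apply/(regular_mapE _ _ hA).
  have h1 : regular_on affp setT (prod_space (prod_space sG sG) sX)
      (fun x => (shift s, gamma x)).
    apply: (regular_on_pair hA); last exact/(regular_mapE _ _ hA).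
    by apply: (regular_on_cst _ _ hA); exact: (opnT hA).
  exact: (regular_on_comp h1 (act_morph hact)).
- apply/(regular_mapE _ _ hA).
  apply: (regular_on_comp (sY := affp) (f := gm_mul s)) => //.
  apply: (regular_on_row hA (opnT hA)) => j; apply: reg_polyfun.
  exact: (polyfun_scale s (polyfun_coord k j)).
- exact: gm_polyfun.
- exact: (proj1 (gmP _) (@gm_one k p)).
- move=> x /gmP hx; rewrite (gammaE hx) (gammaE (gm_mul_gm hs hx)) shiftM //.
  by rewrite (act_mul hact).
Qed.

Variables (U U1 : set X) (r r1 : nat).
Variables (psi : forall y, 'rV[k]_r -> E y) (psi1 : forall y, 'rV[k]_r1 -> E y).
Variables (kap : total -> 'rV[k]_r) (kap1 : total -> 'rV[k]_r1).
Hypotheses (tr : trivialization sX sE U psi kap).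
Hypotheses (tr1 : trivialization sX sE U1 psi1 kap1).
Hypotheses (U_0 : U (gamma 0)) (U1_e : U1 e).

(** The value at gamma x of the constant local section w, carried to the fibre
    over e. *)
Definition back x w : total := A (unshift x) (Tagged E (psi (gamma x) w)).

Lemma tag_back x w : gm x -> tag (back x w) = e.
Proof.
move=> hx; rewrite /back /= (gammaE hx) -(act_mul hact) unshiftK //.
exact: (act_one hact).
Qed.

Lemma shift_back x w : gm x -> A (shift x) (back x w) = Tagged E (psi (gamma x) w).
Proof. by move=> hx; rewrite /back -(totM hE) shiftK // (tot1 hE). Qed.

(** The matrix S of the introduction; forth_mx is its inverse. *)
Definition back_mx x : 'M[k]_(r, r1) := \matrix_(i < r) kap1 (back x (delta_mx 0 i)).

Definition forth_mx x : 'M[k]_(r1, r) :=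
  \matrix_(i < r1) kap (A (shift x) (Tagged E (psi1 e (delta_mx 0 i)))).

Lemma back_mxE x w : gm x -> U (gamma x) -> w *m back_mx x = kap1 (back x w).
Proof.
move=> hx Ux; apply: (mul_row_linear w (f := fun w => kap1 (back x w))).
move=> a v w'; rewrite {1}/back (tr_lin tr Ux) /tot_act /= (eb_linear hE).
by rewrite (kap_lin tr1) //; have := tag_back v hx => /= ->.
Qed.

Lemma forth_mxE x w : gm x -> U (gamma x) ->
  w *m forth_mx x = kap (A (shift x) (Tagged E (psi1 e w))).
Proof.
move=> hx Ux.
apply: (mul_row_linear w (f := fun w => kap (A (shift x) (Tagged E (psi1 e w))))).
move=> a v w'; rewrite (tr_lin tr1 U1_e) /tot_act /= (eb_linear hE).
by rewrite (kap_lin tr) // -gammaE.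
Qed.

Lemma back_forth x (z : total) : gm x -> U (gamma x) -> tag z = gamma x ->
  back x (kap z) = A (unshift x) z.
Proof. by move=> hx Ux tz; rewrite /back -tz (tr_tagged tr) // tz. Qed.

Lemma psi1_tag (z : total) : tag z = e -> Tagged E (psi1 e (kap1 z)) = z.
Proof.
have aux y : tag z = y -> U1 y -> Tagged E (psi1 y (kap1 z)) = z.
  by move=> <-; exact: (tr_tagged tr1).
by move=> tz; exact: aux.
Qed.

Lemma forth_mx_back x : gm x -> U (gamma x) -> forth_mx x *m back_mx x = 1%:M.
Proof.
move=> hx Ux; apply/row_matrixP => i; rewrite row_mul row1 rowK back_mxE //.
rewrite back_forth //=; last by rewrite gammaE.
by rewrite -(totM hE) unshiftK // (tot1 hE) (tr_K tr1).
Qed.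

Lemma back_mx_forth x : gm x -> U (gamma x) -> back_mx x *m forth_mx x = 1%:M.
Proof.
move=> hx Ux; apply/row_matrixP => i; rewrite row_mul row1 rowK forth_mxE //.
by rewrite psi1_tag ?tag_back // shift_back // (tr_K tr).
Qed.

Lemma gamma_opn : opn affp (gamma @^-1` U).
Proof. by have [] := gamma_reg (tr_open tr). Qed.

Lemma section_regular w :
  regular_on affp (gamma @^-1` U) sE (fun x => Tagged E (psi (gamma x) w)).
Proof.
have oN := gamma_opn.
apply: (tr_section tr hA (f := gamma) (w := fun=> w)) => //.
  apply: (regular_on_restrict hA (N := setT)) => //.
  exact: (proj1 (regular_mapE _ _ hA)).
by move=> i; exact: (reg_cst hA).
Qed.

(** This matrix describes the action of s from the fibre over gamma x to the
    fibre over gamma (s x), which makes sense at x = 0 as well. *)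
Lemma back_forth_cocycle s i j : gm s ->
  regular_at_origin (fun x => (back_mx x *m forth_mx (gm_mul s x)) i j).
Proof.
move=> hs; have oN := gamma_opn.
pose f x := A (shift s) (Tagged E (psi (gamma x) (delta_mx 0 i))).
have hf : regular_on affp (gamma @^-1` U) sE f.
  apply: (act_regular hE hA); last exact: section_regular.
    exact: (regular_on_cst _ _ hA oN).
  exact: (regular_on_cst _ _ hA oN).
have [oM _] := proj2 hf _ (tr_over tr).
set M := _ `&` _ in oM.
have M0 : M 0.
  by split; [exact: U_0|rewrite /= gamma_shift // gm_mul0; exact: U_0].
have rk : reg affp M (fun x => kap (f x) 0 j).
  apply: (kap_regular tr _ (N := M)); last by move=> x [].
  by apply: (regular_on_restrict hA hf oM) => x [].
have [u [hu u0 uM]] := oM _ M0.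
apply: (@origin_eq _ _ _ _ u (reg_origin oM M0 rk)) => // x hx ux.
have [Ux Usx] := uM _ ux.
have hsx := gm_mul_gm hs hx.
have Usx' : U (gamma (gm_mul s x)) by rewrite -gamma_shift.
have -> : (back_mx x *m forth_mx (gm_mul s x)) i j =
    (row i (back_mx x) *m forth_mx (gm_mul s x)) 0 j by rewrite -row_mul [RHS]mxE.
rewrite rowK forth_mxE // psi1_tag ?tag_back // shiftM // (totM hE) shift_back //.
Qed.

Lemma back_mx_rational : exists h Q w, [/\ polyfun h, h w != 0,
  forall i j, polyfun (fun x => (Q x : 'M[k]_(r, r1)) i j) &
  forall x, gm x -> U (gamma x) -> h x *: back_mx x = Q x].
Proof.
have oN := opnI hA (@gm_opn k p) gamma_opn.
have [u [hu u0 uN]] := gamma_opn U_0.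
have [w0 [gw0 uw0]] := polyfun_dense (@gm_polyfun k p) hu
  (proj1 (gmP _) (@gm_one k p)) u0.
have Nw0 : (@gm k p `&` gamma @^-1` U) w0 by split; [exact/gmP|exact: uN].
have ra (z : 'I_r * 'I_r1) : reg affp (@gm k p `&` gamma @^-1` U)
    (fun x => back_mx x z.1 z.2).
  apply: (reg_eq hA oN (h := fun x => kap1 (back x (delta_mx 0 z.1)) 0 z.2)).
    by move=> x _; rewrite mxE.
  apply: (kap_regular tr1); last first.
    move=> x [hx _]; change (U1 (tag (back x (delta_mx 0 z.1)))).
    by rewrite tag_back.
  apply: (act_regular hE hA).
  - exact: (regular_on_cst _ _ hA oN).
  - by apply: (regular_on_restrict hA unshift_regular oN) => x [].
  - by apply: (regular_on_restrict hA (section_regular _) oN) => x [].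
have [h [Q [hh hw hQ QE]]] := reg_clear oN Nw0 ra.
exists h, (fun x => \matrix_(i, j) Q (i, j) x), w0; split=> //.
  move=> i j; rewrite (_ : (fun _ => _) = Q (i, j)) //.
  by apply: funext => x; rewrite mxE.
by move=> x hx Ux; apply/matrixP => i j; rewrite !mxE -(QE (i, j)) //= mxE.
Qed.

Lemma rank_eq : r1 = r.
Proof.
have [u [hu u0 uN]] := gamma_opn U_0.
have [x [/gmP hx ux]] := polyfun_dense (@gm_polyfun k p) hu
  (proj1 (gmP _) (@gm_one k p)) u0.
have Ux : U (gamma x) by exact: uN.
have e1 := forth_mx_back hx Ux; have e2 := back_mx_forth hx Ux.
apply/eqP; rewrite eqn_leq; apply/andP; split.
  have := mxrankM_maxl (forth_mx x) (back_mx x); rewrite e1 mxrank1 => h.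
  exact: leq_trans h (rank_leq_col _).
have := mxrankM_maxl (back_mx x) (forth_mx x); rewrite e2 mxrank1 => h.
exact: leq_trans h (rank_leq_col _).
Qed.

End Adapted.

Section CoordinateLine.
Variables (k : fieldType) (p : nat) (j : 'I_p).

Definition set_coord (x : 'rV[k]_p) (t : k) : 'rV[k]_p :=
  \row_l (if l == j then t else x 0 l).

Lemma set_coord_gm x t : gm x -> t != 0 -> gm (set_coord x t).
Proof. by move=> hx t0 l; rewrite mxE; case: ifP. Qed.

Lemma set_coordE x t :
  set_coord x t = gm_mul (set_coord x 1) (set_coord (const_mx 1) t).
Proof.
by apply/rowP => l; rewrite !mxE; case: ifP => _; rewrite ?mul1r ?mulr1.
Qed.

Lemma chi_set_coord (m : 'rV[int]_p) t : chi m (set_coord (const_mx 1) t) = t ^ m 0 j.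
Proof.
rewrite /chi (bigD1 j) //= mxE eqxx big1 ?mulr1 // => l lj.
by rewrite !mxE (negPf lj) exp1rz.
Qed.

Lemma polyfun_set_coord x (F : 'rV[k]_p -> k) :
  polyfun F -> polyfun (fun t : k^o => F (set_coord x t)).
Proof.
apply: (@polyfun_comp_row _ k^o _ (fun t : k^o => set_coord x t)) => l.
have [->|lj] := eqVneq l j.
  rewrite (_ : (fun _ => _) = (fun t : k^o => t : k)); last first.
    by apply: funext => t; rewrite mxE eqxx.
  exact: (polyfun_lin (f := id)).
rewrite (_ : (fun _ => _) = (fun t : k^o => x 0 l)); first exact: Polyfun_const.
by apply: funext => t; rewrite mxE (negPf lj).
Qed.

Lemma polyfun_set_coord0 (F : 'rV[k]_p -> k) :
  polyfun F -> polyfun (fun x => F (set_coord x 0)).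
Proof.
apply: (@polyfun_comp_row _ _ _ (fun x => set_coord x 0)) => l.
have [->|lj] := eqVneq l j.
  rewrite (_ : (fun _ => _) = (fun x => 0)); first exact: Polyfun_const.
  by apply: funext => t; rewrite mxE eqxx.
rewrite (_ : (fun _ => _) = (fun x : 'rV[k]_p => x 0 l)); first exact: polyfun_coord.
by apply: funext => t; rewrite mxE (negPf lj).
Qed.

Lemma theta_set_coord d (tau : 'I_p -> 'rV[int]_d) t :
  theta tau (set_coord (const_mx 1) t) = \row_i t ^ tau j 0 i.
Proof. by apply/rowP => i; rewrite !mxE chi_set_coord mxE. Qed.

End CoordinateLine.

Section FrameFiltration.
Variables (k : closedFieldType) (G : groupType) (sG : fspace k G).
Variables (X : choiceType) (sX : fspace k X) (act : G * G -> X -> X) (e : X).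
Variables (E : X -> vectType k) (sE : fspace k (total_space E)).
Variable actE : forall g x, E x -> E (act g x).
Variables (T : set G) (d : nat) (phi : 'rV[k]_d -> G).
Hypothesis hT : torus_chart sG T phi.
Hypothesis hX : variety sX.
Hypothesis hE : equivariant_bundle sG sX sE actE.
Variables (p : nat) (tau : 'I_p -> 'rV[int]_d) (gamma : 'rV[k]_p -> X).
Local Notation affp := (affine_space 'rV[k]_p).
Local Notation line := (affine_line k).
Local Notation total := (total_space E).
Local Notation A := (tot_act actE).
Local Notation sh := (shift phi tau).
Hypothesis gamma_reg : regular_map affp sX gamma.
Hypothesis gammaE : forall x, gm x -> gamma x = act (sh x) e.
Variables (U U1 : set X) (r : nat).
Variables (psi psi1 : forall y, 'rV[k]_r -> E y) (kap kap1 : total -> 'rV[k]_r).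
Hypotheses (tr : trivialization sX sE U psi kap).
Hypotheses (tr1 : trivialization sX sE U1 psi1 kap1).
Hypothesis U1_e : U1 e.
Local Notation forth := (forth_mx e actE phi tau psi1 kap).

Variables (v : 'M[k]_r) (mu : 'I_r -> 'rV[int]_p) (P : 'rV[k]_p -> 'M[k]_r).
Variable q : 'rV[k]_p -> k.
Hypotheses (v_unit : v \in unitmx) (P_poly : forall i j, polyfun (fun x => P x i j)).
Hypotheses (q_poly : polyfun q) (q_0 : q 0 != 0) (detP_0 : \det (P 0) != 0).
Hypothesis q_U : forall x, q x != 0 -> U (gamma x).
Hypothesis frameE : forall x, gm x -> q x != 0 -> forall i j,
  (v *m forth x) i j = chi (mu i) x * (P x i j / q x).

Let hL : ringed line := affine_space_ringed _.

Definition frame_coord (w : E e) : 'rV[k]_r := kap1 (Tagged E w) *m invmx v.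

(** The limit of the curve of tau j itself need not lie in the trivializing
    neighbourhood of gamma 0; a translate of the curve by a torus element has
    its limit at a point where the frame is known to be invertible. *)
Lemma filt_frame_coord j n w : fiber_filt phi (e := e) sE actE (tau j) n w <->
  forall i, frame_coord w 0 i != 0 -> n <= mu i 0 j.
Proof.
have hdet : polyfun (fun x => q x * \det (P x)).
  by apply: Polyfun_mul => //; exact: polyfun_det.
have set00 : set_coord j 0 0 = 0 :> 'rV[k]_p.
  by apply/rowP => l; rewrite !mxE; case: ifP.
have det0 : q (set_coord j 0 0) * \det (P (set_coord j 0 0)) != 0.
  by rewrite set00 mulf_neq0.
have [x1 [/gmP gx1 qdet1]] := polyfun_dense (@gm_polyfun k p)
  (polyfun_set_coord0 j hdet) (proj1 (gmP _) (@gm_one k p)) det0.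
pose xt t := set_coord j x1 t; pose y1 := xt 1.
have gy1 : gm y1 by apply: set_coord_gm => //; exact: oner_neq0.
have gxt t : t != 0 -> gm (xt t) by exact: set_coord_gm.
have shxt t : t != 0 -> sh (xt t) = (sh y1 * (1, cochar phi (tau j) t))%g.
  move=> t0; rewrite /xt set_coordE (shiftM hT tau) //; last first.
    by apply: set_coord_gm => //; exact: gm_one.
  by congr (_ * _)%g; rewrite /shift theta_set_coord.
have [qx0 dx0] : q (xt 0) != 0 /\ \det (P (xt 0)) != 0.
  by move: qdet1; rewrite mulf_eq0 negb_or => /andP.
pose N := [set t : k^o | q (xt t) != 0].
have oN : opn line N by exact: (opn_polyfun (polyfun_set_coord j x1 q_poly)).
have NU t : N t -> U (gamma (xt t)) by exact: q_U.
have [a aE] : exists a, a = frame_coord w by exists (frame_coord w).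
have key t l : t != 0 -> N t -> kap (A (sh (xt t)) (Tagged E w)) 0 l =
    \sum_i a 0 i * (chi (mu i) y1 * t ^ mu i 0 j * (P (xt t) i l / q (xt t))).
  move=> t0 Nt.
  rewrite -[in LHS](tr_fiber tr1 w U1_e) -(forth_mxE hE gammaE tr tr1 U1_e); last 2 first.
  - exact: gxt.
  - exact: NU.
  rewrite -[kap1 _](mulmxKV v_unit) -(mulmxA (_ *m invmx v)) -/(frame_coord w) -aE mxE; apply: eq_bigr => i _.
  rewrite frameE //; last exact: gxt.
  by rewrite [in chi _ (xt t)]/xt set_coordE chiM chi_set_coord.
have gam_line : regular_map line sX (fun t => gamma (xt t)).
  apply/(regular_mapE _ _ hL).
  apply: (regular_on_comp (sY := affp) (f := fun t : k^o => xt t)) => //.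
  apply: (regular_on_row hL (opnT hL)) => l; apply: reg_polyfun.
  exact: (polyfun_set_coord j x1 (polyfun_coord k l)).
have regP i l : reg line N (fun t => P (xt t) i l / q (xt t)).
  apply: (reg_mul hL) => //.
    by apply: reg_polyfun; exact: (polyfun_set_coord j x1 (P_poly i l)).
  apply: (reg_inv hL) => //.
  by apply: reg_polyfun; exact: (polyfun_set_coord j x1 q_poly).
rewrite -aE; split=> [[c hc cE] i ai|H].
  have {}cE (t : k) : t != 0 -> c t =
      scale_tot (t ^ (- n)) (A (1%g, cochar phi (tau j) t) (Tagged E w)).
    exact: cE.
  pose c' (t : k^o) := A (sh y1) (c t).
  have c'E (t : k) : t != 0 ->
      c' t = scale_tot (t ^ (- n)) (A (sh (xt t)) (Tagged E w)).
    by move=> t0; rewrite /c' cE // (tot_scale hE) -(totM hE) -shxt.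
  have hc' : regular_map line sE c'.
    apply/(regular_mapE _ _ hL); apply: (act_regular hE hL).
    - exact: (regular_on_cst _ _ hL (opnT hL)).
    - exact: (regular_on_cst _ _ hL (opnT hL)).
    - exact/(regular_mapE _ _ hL).
  have tagc t : tag (c' t) = gamma (xt t).
    move: t; apply: (separated_ext hX (f := fun t : k^o => tag (c' t))
      (g := fun t : k^o => gamma (xt t)) (q := fun t : k^o => t : k) (w0 := 1)).
    - exact: (tag_map_regular hX hE hL hc').
    - exact: gam_line.
    - exact: (polyfun_lin (f := id)).
    - exact: oner_neq0.
    - by move=> t t0; rewrite c'E // gammaE //; exact: gxt.
  have rK l : reg line N (fun t => kap (c' t) 0 l).
    apply: (kap_regular tr _ (N := N)).
      apply: (regular_on_restrict hL (N := setT)) => //.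
      exact: (proj1 (regular_mapE _ _ hL)).
    by move=> t Nt; change (U (tag (c' t))); rewrite tagc; exact: NU.
  rewrite leNgt; apply/negP => lt.
  pose m := absz (n - mu i 0 j)%R.
  have mE : n - mu i 0 j = m%:Z by rewrite /m gez0_abs // subr_ge0 ltW.
  have m0 : (0 < m)%N by rewrite -ltz_nat -mE subr_gt0.
  (* By Cramer's rule F vanishes for t <> 0.  Hence F 0 = 0, but F 0 is a unit
     multiple of a 0 i, because the second term has a factor t ^+ m. *)
  pose R (t : k^o) : k := q (xt t) * \sum_l kap (c' t) 0 l * (\adj (P (xt t))) l i.
  pose F (t : k^o) : k := a 0 i * chi (mu i) y1 * \det (P (xt t)) - (t : k) ^+ m * R t.
  have rF : reg line N F.
    apply: (reg_add hL) => //.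
      apply: (reg_mul hL) => //; first exact: (reg_cst hL).
      exact/reg_polyfun/(polyfun_set_coord j x1 (polyfun_det P_poly)).
    apply: (reg_eq hL oN (h := fun t => -1 * ((t : k) ^+ m * R t))).
      by move=> t _; rewrite mulN1r.
    apply: (reg_mul hL) => //; first exact: (reg_cst hL).
    apply: (reg_mul hL) => //; first by apply: (reg_exprn hL) => //; exact: reg_line_id.
    apply: (reg_mul hL) => //; first exact/reg_polyfun/(polyfun_set_coord j x1 q_poly).
    apply: (@reg_sum _ _ _ _ _ _ (fun l t => kap (c' t) 0 l * (\adj (P (xt t))) l i)) => // l.
    apply: (reg_mul hL) => //; apply: reg_polyfun.
    apply: (polyfun_set_coord j x1 (F := fun x => (\adj (P x)) l i)).
    rewrite (_ : (fun _ => _) = fun x => cofactor (P x) i l); last first.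
      by apply: funext => x; rewrite mxE.
    apply: Polyfun_mul; first exact: Polyfun_const.
    apply: polyfun_det => b b'.
    rewrite (_ : (fun _ => _) = fun x => P x (lift i b) (lift l b')) //.
    by apply: funext => x; rewrite !mxE.
  have F0 : F 0 = 0.
    apply: (reg_affine_ext oN rF (q := fun t : k^o => t : k) (w0 := 1)) => //.
    - exact: (polyfun_lin (f := id)).
    - exact: oner_neq0.
    move=> t Nt t0; apply/eqP; rewrite subr_eq0; apply/eqP.
    have KE l : kap (c' t) 0 l = t ^ (- n) *
        \sum_i a 0 i * (chi (mu i) y1 * t ^ mu i 0 j * (P (xt t) i l / q (xt t))).
      rewrite c'E // (kap_scale tr) ?mxE ?key //.
      by rewrite /= -gammaE //; [exact: NU|exact: gxt].
    pose row : 'rV[k]_r := \row_i (a 0 i * (chi (mu i) y1 * t ^ mu i 0 j)).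
    have e1 : kap (c' t) = (t ^ (- n) / q (xt t)) *: (row *m P (xt t)).
      apply/rowP => l; rewrite KE !mxE -mulrA; congr (_ * _).
      by rewrite mulr_sumr; apply: eq_bigr => b _; rewrite mxE; ring.
    have e2 : \sum_l kap (c' t) 0 l * (\adj (P (xt t))) l i =
        t ^ (- n) / q (xt t) * (row 0 i * \det (P (xt t))).
      transitivity ((kap (c' t) *m \adj (P (xt t))) 0 i); first by rewrite mxE.
      by rewrite e1 -scalemxAl -mulmxA mul_mx_adj mul_mx_scalar !mxE mulrCA; ring.
    have qt : q (xt t) != 0 by [].
    rewrite /R e2 mxE.
    have -> : t ^ (- n) = (t ^+ m)^-1 * (t ^ mu i 0 j)^-1.
      rewrite -[t ^+ m]/(t ^ m%:Z) -mE expfzDr // -!invr_expz.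
      by field; rewrite !expfz_neq0.
    by field; rewrite qt expf_neq0 // expfz_neq0.
  move/eqP: F0; rewrite /F expr0n eqn0Ngt m0 mul0r subr0 !mulf_eq0.
  by rewrite (negPf ai) (negPf dx0) (negPf (chi_neq0 _ gy1)).
pose wt (t : k^o) : 'rV[k]_r := \row_l \sum_i
  a 0 i * (chi (mu i) y1 * (t : k) ^+ absz (mu i 0 j - n)%R * (P (xt t) i l / q (xt t))).
have rwt l : reg line N (fun t => wt t 0 l).
  apply: (reg_eq hL oN (h := fun t => \sum_i
    a 0 i * (chi (mu i) y1 * (t : k) ^+ absz (mu i 0 j - n)%R * (P (xt t) i l / q (xt t))))).
    by move=> t _; rewrite mxE.
  apply: (@reg_sum _ _ _ _ _ _ (fun i (t : k^o) =>
    a 0 i * (chi (mu i) y1 * (t : k) ^+ absz (mu i 0 j - n)%R * (P (xt t) i l / q (xt t))))) => // i.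
  apply: (reg_mul hL) => //; first exact: (reg_cst hL).
  apply: (reg_mul hL) => //; apply: (reg_mul hL) => //; first exact: (reg_cst hL).
  by apply: (reg_exprn hL) => //; exact: reg_line_id.
have hs : regular_on line N sE (fun t => Tagged E (psi (gamma (xt t)) (wt t)) : total).
  apply: (tr_section tr hL (f := fun t => gamma (xt t))) => //.
  apply: (regular_on_restrict hL (N := setT)) => //.
  exact: (proj1 (regular_mapE _ _ hL)).
have hf : regular_on line N sE
    (fun t => A (unshift phi tau y1) (Tagged E (psi (gamma (xt t)) (wt t)))).
  apply: (act_regular hE hL) => //; exact: (regular_on_cst _ _ hL oN).
apply: (filt_intro hT hX hE _ hf) => // t Nt t0.
have -> : A (1%g, cochar phi (tau j) t) (Tagged E w) =
    A (unshift phi tau y1) (A (sh (xt t)) (Tagged E w)).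
  by rewrite -(totM hE) shxt // mulgA (unshiftK hT tau gy1) mul1g.
rewrite -(tot_scale hE); congr (A _ _).
set z := scale_tot _ _.
have tz : tag z = gamma (xt t) by rewrite gammaE //; exact: gxt.
have Uz : U (tag z) by rewrite tz; exact: NU.
rewrite -[RHS](tr_tagged tr) // tz; congr (Tagged E (psi _ _)).
apply/rowP => l; rewrite (kap_scale tr) // !mxE key // mulr_sumr.
apply: eq_bigr => i _; have [->|ai] := eqVneq (a 0 i) 0; first by rewrite !mul0r mulr0.
have le := H i ai.
have -> : t ^+ absz (mu i 0 j - n)%R = t ^ (- n) * t ^ mu i 0 j.
  by rewrite -expfzDr // -[LHS]/(t ^ (Posz (absz (mu i 0 j - n)%R))) gez0_abs ?subr_ge0 // addrC.
by ring.
Qed.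

End FrameFiltration.

(** The filtrations attached to cocharacters which have a common limit map gamma
    are split by one basis, the vectors of a homogeneous frame. *)
Theorem adapted_basis (k : closedFieldType) (G : groupType) (sG : fspace k G)
    (X : choiceType) (sX : fspace k X) (act : G * G -> X -> X) (e : X)
    (E : X -> vectType k) (sE : fspace k (total_space E))
    (actE : forall g x, E x -> E (act g x))
    (T : set G) (d : nat) (phi : 'rV[k]_d -> G)
    (p : nat) (tau : 'I_p -> 'rV[int]_d) (gamma : 'rV[k]_p -> X) :
  torus_chart sG T phi -> variety sX -> algebraic_action sG sX act ->
  equivariant_bundle sG sX sE actE ->
  regular_map (affine_space 'rV[k]_p) sX gamma ->
  (forall x, gm x -> gamma x = act (shift phi tau x) e) ->
  exists r (b : r.-tuple (E e)) (mu : 'I_r -> 'I_p -> int),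
    basis_of fullv b /\ forall j n w,
      fiber_filt phi (e := e) sE actE (tau j) n w <->
      forall i, coord b i w != 0 -> n <= mu i j.
Proof.
move=> hT hX hact hE hg gE; have hB := eb_bundle hE.
have [U [r [psi [kap [U0 tr]]]]] := trivialization_exists hX hB (gamma 0).
have [U1 [r1 [psi1 [kap1 [U1e tr1]]]]] := trivialization_exists hX hB e.
have er := rank_eq hT hact hE hg gE tr tr1 U0 U1e; subst r1.
pose S := back_mx actE phi tau gamma psi kap1.
pose F := forth_mx e actE phi tau psi1 kap.
have SF x : gm x -> U (gamma x) -> S x *m F x = 1%:M.
  exact: (back_mx_forth hT hact hE gE tr tr1 U1e).
have Su x : gm x -> U (gamma x) -> S x \in unitmx.
  by move=> hx Ux; have [] := mulmx1_unit (SF x hx Ux).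
have SV x : gm x -> U (gamma x) -> invmx (S x) = F x.
  by move=> hx Ux; rewrite -[LHS]mulmx1 -(SF x hx Ux) mulKmx // Su.
have oN := gamma_opn hg tr.
have [g [gpoly g0 gU]] := oN _ U0.
have cocycle s : gm s -> forall i j,
    regular_at_origin (fun x => (S x *m invmx (S (gm_mul s x))) i j).
  move=> hs i j.
  apply: (@origin_eq _ _ _ _ (fun x => g (gm_mul s x))
    (back_forth_cocycle hT hX hact hE hg gE tr tr1 U0 U1e i j hs)).
  - exact: polyfun_scale.
  - by rewrite gm_mul0.
  - by move=> x hx gx; rewrite SV //; [exact: gm_mul_gm|exact: gU].
have [h [Q [w0 [hh hw hQ hS]]]] :=
  back_mx_rational hT hact hE hg gE tr tr1 U0 U1e.
have [v [mu [P [q [hP hq q0 dP0 [qg frameE]]]]]] :=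
  homogeneous_frame gpoly g0 (fun x hx gx => Su x hx (gU x gx)) cocycle
    hh hw hQ (fun x hx gx => hS x hx (gU x gx)).
have qU x : q x != 0 -> U (gamma x) by move=> /qg /gU.
have frameF x : gm x -> q x != 0 -> forall i j,
    (v *m F x) i j = chi (mu i) x * (P x i j / q x).
  by move=> hx qx i j; rewrite -frameE // SV //; exact: qU.
have vu : v \in unitmx.
  have hd : polyfun (fun x => q x * \det (P x)).
    by apply: Polyfun_mul => //; exact: polyfun_det.
  have d0 : q 0 * \det (P 0) != 0 by rewrite mulf_neq0.
  have [x [/gmP hx]] := polyfun_dense (@gm_polyfun k p) hd
    (proj1 (gmP _) (@gm_one k p)) d0.
  rewrite mulf_eq0 negb_or => /andP [qx dx].
  have eF : v *m F x = diag_mx (\row_i (chi (mu i) x / q x)) *m P x.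
    by apply/matrixP => i j; rewrite frameF // mul_diag_mx !mxE; ring.
  have : v *m F x \in unitmx.
    rewrite eF unitmx_mul unitmxE det_diag unitfE; apply/andP; split.
      apply/prodf_neq0 => i _; rewrite mxE mulf_neq0 ?invr_neq0 //.
      exact: chi_neq0.
    by rewrite unitmxE unitfE.
  by rewrite unitmx_mul => /andP [].
have lp : linear (psi1 e) := tr_lin tr1 U1e.
pose pL : {linear 'rV[k]_r -> E e} :=
  HB.pack (psi1 e) (GRing.isLinear.Build k _ (E e) *:%R (psi1 e) lp).
pose b : r.-tuple (E e) := [tuple psi1 e (row i v) | i < r].
have bE (i : 'I_r) : b`_i = psi1 e (row i v) by rewrite -tnth_nth tnth_mktuple.
have sumE (c : 'rV[k]_r) : \sum_(i < r) c 0 i *: b`_i = psi1 e (c *m v).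
  rewrite mulmx_sum_row -[psi1 e]/(pL : _ -> _) linear_sum.
  by apply: eq_bigr => i _; rewrite linearZ_LR bE.
have wE w : w = \sum_(i < r) frame_coord kap1 v w 0 i *: b`_i.
  by rewrite sumE /frame_coord mulmxKV // (tr_fiber tr1).
have fb : free b.
  apply/freeP => c c0 i.
  have : psi1 e ((\row_l c l) *m v) = psi1 e 0.
    rewrite -sumE -[psi1 e 0]/(pL 0) linear0 -[RHS]c0.
    by apply: eq_bigr => l _; rewrite mxE.
  move=> /(congr1 (fun y => kap1 (Tagged E y))); rewrite !(tr_K tr1) // => /eqP.
  rewrite -[0](mul0mx _ v) => /eqP /(congr1 (mulmx^~ (invmx v))).
  by rewrite !mulmxK // => /rowP /(_ i); rewrite !mxE.
exists r, b, (fun i j => mu i 0 j); split.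
  rewrite /basis_of fb andbT eqEsubv subvf /=; apply/subvP => w _.
  rewrite (wE w); apply: memv_suml => i _; apply: memvZ.
  by apply: memv_span; rewrite mem_nth // size_tuple.
move=> j n w.
have cE i : coord b i w = frame_coord kap1 v w 0 i.
  by rewrite [in LHS](wE w) coord_sum_free.
have := filt_frame_coord hT hX hE hg gE tr tr1 U1e vu hP hq q0 dP0 qU frameF j n w.
by move=> ->; split=> H i; have := H i; rewrite cE.
Qed.

(** * Rays of a fan *)

Lemma primitive_gcd d (t : 'rV[int]_d) : primitive t ->
  \big[gcdn/0%N]_(i < d) absz (t ord0 i) = 1%N.
Proof.
set g := \big[_/_]_(i < d) _ => pt.
have gt i : (g%:Z %| t ord0 i)%Z.
  by rewrite dvdzE; apply: (@biggcdn_inf _ i).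
apply: (pt g (\row_i (t ord0 i %/ g%:Z)%Z)); apply/rowP => i.
by rewrite mulmxnE mxE pmulrn mulrzz divzK.
Qed.

(** A primitive vector is determined by the ray it spans: proportional
    primitive vectors have entries of the same absolute value, their contents
    being both 1, and of the same sign. *)
Lemma ray_inj (R : realType) d (t t' : 'rV[int]_d) : primitive t -> primitive t' ->
  @ray R d t = ray t' -> t = t'.
Proof.
move=> pt pt' e.
have [c c0 cE] : @ray R d t' (real_vec R t).
  by rewrite -e; exists 1; rewrite ?ler01 // scale1r.
have tE i : (t 0 i)%:~R = c * (t' 0 i)%:~R :> R.
  by have := congr1 (fun v : 'rV[R]_d => v 0 i) cE; rewrite !mxE.
have prop i j : t 0 i * t' 0 j = t 0 j * t' 0 i.
  by apply: (@intr_inj R); rewrite !rmorphM /= !tE; ring.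
have scal a (F : 'I_d -> nat) :
    (a * \big[gcdn/0]_(i < d) F i = \big[gcdn/0]_(i < d) (a * F i))%N.
  exact: (big_morph (muln a) (@muln_gcdr a) (muln0 a)).
have absE i : absz (t 0 i) = absz (t' 0 i).
  have := scal (absz (t 0 i)) (fun j => absz (t' 0 j)).
  rewrite primitive_gcd // muln1 => ->.
  have := scal (absz (t' 0 i)) (fun j => absz (t 0 j)).
  rewrite primitive_gcd // muln1 => ->; apply: eq_bigr => j _.
  by rewrite -!abszM prop mulrC.
apply/rowP => i.
have : (t 0 i == t' 0 i) || (t 0 i == - t' 0 i).
  by rewrite -eqf_sqr -[t 0 i ^+ 2]real_normK ?num_real //
    -[t' 0 i ^+ 2]real_normK ?num_real // -!abszE absE.
case/orP => /eqP // ti.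
have : (1 + c) * (t' 0 i)%:~R = 0 :> R.
  by rewrite mulrDl mul1r -tE ti rmorphN /= subrr.
move/eqP; rewrite mulf_eq0 gt_eqF ?ltr_wpDr // intr_eq0 => /eqP t0.
by rewrite ti t0 oppr0.
Qed.

(** The rays of s are faces, hence members of the finite set Sigma. *)
Lemma cone_rays_finite (R : realType) d (Sigma : set (set 'rV[R]_d)) s :
  fan Sigma -> Sigma s -> finite_set (cone_ray s).
Proof.
move=> hS Ss.
pose inv (C : set 'rV[R]_d) : 'rV[int]_d :=
  xget 0 [set t | primitive t /\ @ray R d t = C].
apply: (sub_finite_set _ (finite_image inv (fan_finite hS))) => t [pt ft].
exists (ray t); first exact: (fan_face hS Ss ft).
have [pi ri] : primitive (inv (ray t)) /\ @ray R d (inv (ray t)) = ray t.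
  by apply: (@xgetPex _ 0 [set t' | primitive t' /\ @ray R d t' = ray t]); exists t.
exact: ray_inj ri.
Qed.

Lemma ray_mem (R : realType) d (t : 'rV[int]_d) : @ray R d t (real_vec R t).
Proof. by exists 1; rewrite ?ler01 // scale1r. Qed.

Section Assembly.
Variables (k : closedFieldType) (R : realType).
Variables (G : groupType) (sG : fspace k G) (B Bm U Um T : set G).
Variables (d : nat) (phi : 'rV[k]_d -> G) (l : nat) (alpha : 'I_l -> 'rV[int]_d).
Hypothesis hG : reductive_data sG B Bm U Um T phi alpha.
Variables (Sigma : set (set 'rV[R]_d)).
Hypothesis hSigma : fan Sigma.
Variables (Y : choiceType) (sY : fspace k Y) (aY : 'rV[k]_d -> Y -> Y) (y0 : Y).
Variables (X : choiceType) (sX : fspace k X) (act : G * G -> X -> X) (e : X).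
Variable j : Y -> X.
Hypothesis hX : group_embedding sG B U Um phi Sigma sY aY y0 sX act e j.
Variables (E : X -> vectType k) (sE : fspace k (total_space E)).
Variable actE : forall g x, E x -> E (act g x).
Hypothesis hE : equivariant_bundle sG sX sE actE.
Local Notation filt := (fiber_filt phi (e := e) sE actE).

Let hGl : linear_algebraic_group sG. Proof. by case: (rd_reductive hG). Qed.
Let hT : torus_chart sG T phi := rd_chart hG.
Let hXv : variety sX := ge_variety hX.
Let hact : algebraic_action sG sX act := ge_action hX.

Lemma stabilizer_diagonal g : act (g, g) e = e.
Proof.
have e1 : act (1%g, 1%g) e = e by exact: (act_one hact).
by rewrite -{1}e1 (ge_orbit_equiv hX) mulg1 mulgV.
Qed.

Lemma cone_basis s p (tau : 'I_p -> 'rV[int]_d) : Sigma s ->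
  (forall i, s (real_vec R (tau i))) ->
  exists r (b : r.-tuple (E e)) (mu : 'I_r -> 'I_p -> int),
    basis_of fullv b /\ forall i n w,
      filt (tau i) n w <-> forall m, coord b m w != 0 -> n <= mu m i.
Proof.
move=> Ss hs; have hY := ge_toric hX.
have [C [hC _ _]] := tv_charts hY.
have [f hf fE] := toric_curve (variety_space (tv_variety hY)) (hC s Ss) hs.
have hA := affine_space_ringed 'rV[k]_p.
apply: (adapted_basis (gamma := j \o f) hT hXv hact hE).
  apply/(regular_mapE _ _ hA).
  exact: (regular_on_comp (proj1 (regular_mapE _ _ hA) hf)
    (embedding_regular (ge_toric_sub hX))).
move=> x hx; rewrite /= fE // (ge_toric_equiv hX); last exact: theta_gm.
by rewrite (ge_toric_base hX).
Qed.

Lemma ray_basis tau : fan_ray Sigma tau ->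
  exists r (b : r.-tuple (E e)) (mu : 'I_r -> int), basis_of fullv b /\
    forall n w, filt tau n w <-> forall m, coord b m w != 0 -> n <= mu m.
Proof.
move=> [pt St].
have [|r [b [mu [hb H]]]] := cone_basis (tau := fun _ : 'I_1 => tau) St.
  by move=> _; exact: ray_mem.
by exists r, b, (fun m => mu m 0); split=> // n w; exact: (H 0).
Qed.

Lemma int_bound r (mu : 'I_r -> int) : exists M : int, forall m, - M <= mu m <= M.
Proof.
exists (\sum_m `|mu m|) => m; rewrite -ler_norml (bigD1 m) //= lerDl.
by apply: sumr_ge0 => i _; exact: normr_ge0.
Qed.

Theorem Xi_in_Cplus : in_Cplus sG phi Sigma (Xi phi e sE actE).
Proof.
split.
- exact: (fiber_rational hGl hXv hE stabilizer_diagonal).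
- move=> tau n ht; have [r [b [mu [hb H]]]] := ray_basis ht; split.
  + by apply/H => m; rewrite linear0 eqxx.
  + move=> a v w /H hv /H hw; apply/H => m.
    have [v0|v0 _] := eqVneq (coord b m v) 0; last exact: hv.
    by rewrite linearP /= v0 mulr0 add0r; exact: hw.
  + by move=> g v; exact: (filt_parabolic hT hXv hE stabilizer_diagonal).
- move=> tau n n' ht le w; have [r [b [mu [hb H]]]] := ray_basis ht.
  by move=> /H hw; apply/H => m /hw; exact: le_trans.
- move=> tau ht; have [r [b [mu [hb H]]]] := ray_basis ht.
  have [M hM] := int_bound mu; exists (- M) => n le.
  apply/seteqP; split=> // w _; apply/H => m _.
  by have /andP [h _] := hM m; exact: le_trans h.
- move=> tau ht; have [r [b [mu [hb H]]]] := ray_basis ht.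
  have [M hM] := int_bound mu; exists (M + 1) => n le.
  apply/seteqP; split=> w; last first.
    by move=> ->; apply/H => m; rewrite linear0 eqxx.
  move=> /H hw; rewrite /= (coord_basis hb (memvf w)) big1 // => m _.
  have [->|/hw h] := eqVneq (coord b m w) 0; first by rewrite scale0r.
  have /andP [_ h'] := hM m.
  by have := le_trans (le_trans le h) h'; rewrite gerDl ler10.
- move=> s Ss.
  have /finite_seqP [ts tsE] := cone_rays_finite hSigma Ss.
  pose tau (i : 'I_(size ts)) := nth 0 ts i.
  have tauP i : cone_ray s (tau i).
    by have : [set` ts] (tau i) by [apply: mem_nth]; rewrite -tsE.
  have [|r [b [mu [hb H]]]] := cone_basis (tau := tau) Ss.
    move=> i; have [_ [u _ uE]] := tauP i.
    by have := @ray_mem R d (tau i); rewrite uE => -[].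
  exists b; split=> // t n ht.
  have ti : (index t ts < size ts)%N.
    by rewrite index_mem; have : [set` ts] t by rewrite -tsE.
  pose i := Ordinal ti.
  have tE : t = tau i by rewrite /tau /= nth_index // -index_mem.
  pose b' := [seq b`_(nat_of_ord m) | m <- enum 'I_r & n <= mu m i].
  have sub : {subset b' <= b}.
    by move=> z /mapP [m _ ->]; rewrite mem_nth // size_tuple.
  exists b' => //.
  rewrite tE; apply/seteqP; split=> w.
    move=> /H hw; rewrite /= (coord_basis hb (memvf w)); apply: memv_suml => m _.
    have [->|/hw h] := eqVneq (coord b m w) 0; first by rewrite scale0r mem0v.
    apply: memvZ; apply: memv_span; apply/mapP; exists m => //.
    by rewrite mem_filter h mem_enum.
  move=> hw; apply/H => m; apply: contraNT; rewrite -ltNge => lt.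
  have {}hw : w \in <<in_tuple b'>>%VS by [].
  rewrite (coord_span hw) linear_sum big1 // => q _.
  have /mapP [m' hm' ->] : (in_tuple b')`_q \in b' by rewrite mem_nth.
  move: hm'; rewrite mem_filter => /andP [le _].
  rewrite linearZ /= coord_free ?(basis_free hb) //.
  by have [mm'|] := eqVneq m' m; [move: le; rewrite mm' leNgt lt|rewrite mulr0].
Qed.

Theorem Xi_transversal : transversality sG phi Sigma (Xi phi e sE actE).
Proof.
move=> tau _ n a _ neg D v hD hv.
exact: (filt_transversal hGl hT hXv hE stabilizer_diagonal hD neg).
Qed.

End Assembly.

Theorem proposition5
  (k : closedFieldType) (char0 : [pchar k] =i pred0) (R : realType)
  (G : groupType) (sG : fspace k G) (B Bm U Um T : set G)
  (d : nat) (phi : 'rV[k]_d -> G) (l : nat) (alpha : 'I_l -> 'rV[int]_d)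
  (hG : reductive_data sG B Bm U Um T phi alpha)
  (Sigma : set (set 'rV[R]_d)) (hSigma : fan Sigma)
  (hSigma0 : fan_morphism (to_coweights alpha) Sigma (@adjoint_fan R l))
  (Y : choiceType) (sY : fspace k Y) (aY : 'rV[k]_d -> Y -> Y) (y0 : Y)
  (X : choiceType) (sX : fspace k X) (act : G * G -> X -> X) (e : X)
  (j : Y -> X)
  (hX : group_embedding sG B U Um phi Sigma sY aY y0 sX act e j)
  (E : X -> vectType k) (sE : fspace k (total_space E))
  (actE : forall g x, E x -> E (act g x))
  (hE : equivariant_bundle sG sX sE actE) :
  in_C sG phi Sigma (Xi phi e sE actE).
Proof.
split; first exact: (Xi_in_Cplus hG hSigma hX hE).
exact: (Xi_transversal hG hX hE).
Qed.
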